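(* Let $\alpha<0$, let $\xi$ be a subordinator with $\xi_0=0$, zero drift, nonzero Lévy measure $\Pi$ and Laplace exponent $\phi$, and for a strictly positive random variable $X(0)$ independent of $\xi$ let $$X(t)=X(0)\exp\big(-\xi_{\rho(X(0)^\alpha t)}\big),\quad t\ge0,\qquad \rho(s)=\inf\Big\{u\ge0:\int_0^u\exp(\alpha\xi_r)\,dr>s\Big\}.$$ For $\lambda>0$ let $\mu_R^{(\lambda)}$ denote the law of $\lambda R^{1/|\alpha|}$, where $R$ has the distribution $\mu_R$ defined in the context. Then a probability measure $\varsigma$ on $]0,\infty[$ is a quasi-stationary distribution of $X$ if and only if $\varsigma=\mu_R^{(\lambda)}$ for some $\lambda>0$. Moreover, if $X(0)$ has law $\mu_R^{(\lambda)}$, then $$\mathbb P(X(t)>0)=\exp(-\lambda^\alpha t)\qquad\forall t\ge0.$$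
   Context: A subordinator is a nondecreasing Lévy process; with zero drift and Lévy measure $\Pi$ on $]0,\infty[$ ($\int_0^\infty(1\wedge x)\Pi(dx)<\infty$) its Laplace exponent is $\phi(\lambda)=\int_0^\infty(1-\exp(-\lambda x))\Pi(dx)$, with $\mathbb E[\exp(-\lambda\xi_t)]=\exp(-t\phi(\lambda))$. Conventions: $\inf\emptyset=\infty$, $\exp(-\xi_\infty)=0$. $\mu_R$ is the unique probability measure on $]0,\infty[$ with $\int_0^\infty x^n\mu_R(dx)=\phi(|\alpha|)\phi(2|\alpha|)\cdots\phi(n|\alpha|)$ for all integers $n\ge1$ (existence and uniqueness are known). A quasi-stationary distribution of $X$ is a distribution $\varsigma$ on $]0,\infty[$ such that, if $X(0)$ has law $\varsigma$, then $\mathbb E[f(X(t))\mid X(t)>0]=\mathbb E[f(X(0))]$ for all $t\ge0$ and all test functions $f$ on $]0,\infty[$. *)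

(* Defs.v *)
From HB Require Import structures.
From mathcomp Require Import all_boot all_order all_algebra.
From mathcomp Require Import all_classical all_reals all_analysis.

Set Implicit Arguments.
Unset Strict Implicit.
Unset Printing Implicit Defensive.

Import Order.TTheory GRing.Theory Num.Theory.
Import numFieldNormedType.Exports.

Local Open Scope classical_set_scope.
Local Open Scope ring_scope.

(* Processes are indexed by R; only the times t >= 0 are meaningful. *)

Section Independence.
Context d (Omega : measurableType d) (R : realType) (P : probability Omega R).

Definition independent_systems (F G : set (set Omega)) : Prop :=
  forall A B, F A -> G B -> P (A `&` B) = (P A * P B)%E.

Definition sigma_process (I : set R) (xi : R -> Omega -> R) : set (set Omega) :=
  <<s \bigcup_(r in I) preimage_set_system setT (xi r) measurable >>.

Definition independent_of_process (X : Omega -> R) (xi : R -> Omega -> R) :=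
  independent_systems (preimage_set_system setT X measurable)
    (sigma_process `[0, +oo[ xi).

End Independence.

Section LevyMeasure.
Context (R : realType).

Definition subordinator_levy_measure (Pi : {measure set R -> \bar R}) : Prop :=
  Pi (~` `]0, +oo[) = 0%E /\
  (\int[Pi]_(x in `]0%R, +oo[) (Num.min 1 x)%:E < +oo)%E.

Definition laplace_exponent (Pi : {measure set R -> \bar R}) (l : R) : R :=
  \int[Pi]_(x in `]0, +oo[) (1 - expR (- (l * x))).

End LevyMeasure.

Section Subordinator.
Context d (Omega : measurableType d) (R : realType) (P : probability Omega R).

Definition cadlag (x : R -> R) : Prop :=
  (forall t, 0 <= t -> x r @[r --> t^'+] --> x t) /\
  (forall t, 0 < t -> cvg (x r @[r --> t^'-])).

Record levy_process (xi : R -> Omega -> R) : Prop := {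
  levy_measurable : forall t, 0 <= t -> measurable_fun setT (xi t);
  levy_start : forall w, xi 0 w = 0;
  levy_cadlag : forall w, cadlag (fun t => xi t w);
  levy_stationary : forall s t B, 0 <= s -> s <= t -> measurable B ->
    P [set w | B (xi t w - xi s w)] = P [set w | B (xi (t - s) w)];
  levy_independent : forall s t, 0 <= s -> s <= t ->
    independent_systems P
      (preimage_set_system setT (fun w => xi t w - xi s w) measurable)
      (sigma_process `[0, s] xi) }.

Definition subordinator (xi : R -> Omega -> R) : Prop :=
  levy_process xi /\
  forall w s t, 0 <= s -> s <= t -> xi s w <= xi t w.

Definition driftless_subordinator (Pi : {measure set R -> \bar R})
    (xi : R -> Omega -> R) : Prop :=
  [/\ subordinator_levy_measure Pi, subordinator xi &
      forall l t, 0 <= l -> 0 <= t ->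
        (\int[P]_w (expR (- (l * xi t w)))%:E)%E =
        (expR (- (t * laplace_exponent Pi l)))%:E].

End Subordinator.

Section LimitLaw.
Context (R : realType).

(* This characterizes mu_R: its moments determine it. *)
Definition has_muR_moments (Pi : {measure set R -> \bar R}) (alpha : R)
    (mu : probability R R) : Prop :=
  mu `]0%R, +oo[%classic = 1%E /\
  forall n : nat, (0 < n)%N ->
    (\int[mu]_(x in `]0%R, +oo[) (x ^+ n)%:E)%E =
    (\prod_(1 <= k < n.+1) laplace_exponent Pi (k%:R * `|alpha|))%:E.

Definition muR_scaled (mu : probability R R) (alpha l : R) : set R -> \bar R :=
  pushforward mu (fun x : R => l * x `^ (`|alpha|^-1)).

End LimitLaw.

Section SelfSimilar.
Context (T : Type) (R : realType).
Implicit Types (alpha s t : R) (xi : R -> T -> R) (w : T).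

Definition lamperti_clock alpha xi s w : \bar R :=
  ereal_inf [set u%:E | u in
    [set u | 0 <= u /\
      (s%:E < \int[lebesgue_measure]_(r in `[0%R, u])
                (expR (alpha * xi r w))%:E)%E]].

(* exp (- xi_u), with exp (- xi_oo) = 0 *)
Definition exp_neg_at xi w (u : \bar R) : R :=
  if u is v%:E then expR (- xi v w) else 0.

Definition pssmp alpha xi (X0 : T -> R) t w : R :=
  X0 w * exp_neg_at xi w (lamperti_clock alpha xi (X0 w `^ alpha * t) w).

End SelfSimilar.

Section ConditionalExpectation.
Context d (Omega : measurableType d) (R : realType) (P : probability Omega R).

(* When P A = 0 this is 0 / 0 = 0, so the identity in qsd fails for f = 1:
   being quasi-stationary includes P(X(t) > 0) > 0 for all t >= 0. *)
Definition cond_expectation (A : set Omega) (Y : Omega -> R) : R :=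
  (\int[P]_(w in A) Y w) / fine (P A).

End ConditionalExpectation.

Section QuasiStationary.
Context d (Omega : measurableType d) (R : realType) (P : probability Omega R).

(* X0 is a choice of X(0) with law nu. Since (Omega, P) may be too small to
   carry one that is independent of xi, X0 lives on an extension (Omega', P')
   given by a measure-preserving map p (possibly the identity), on which xi
   becomes r |-> xi r \o p. *)
Definition initial_value (xi : R -> Omega -> R) (nu : set R -> \bar R)
    d' (Omega' : measurableType d') (P' : probability Omega' R)
    (p : Omega' -> Omega) (X0 : Omega' -> R) : Prop :=
  [/\ measurable_fun setT p /\
        (forall A, measurable A -> P' (p @^-1` A) = P A),
      measurable_fun setT X0 /\ P' [set w | 0 < X0 w] = 1%E,
      independent_of_process P' X0 (fun r => xi r \o p) &
      forall B, measurable B -> P' (X0 @^-1` B) = nu B].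

(* Test functions on ]0, +oo[ are bounded and measurable; the values of f
   outside ]0, +oo[ play no role, since X0 > 0 almost surely. *)
Definition qsd (alpha : R) (xi : R -> Omega -> R)
    (nu : set R -> \bar R) : Prop :=
  forall d' (Omega' : measurableType d') (P' : probability Omega' R)
    (p : Omega' -> Omega) (X0 : Omega' -> R),
  initial_value xi nu P' p X0 ->
  let X := pssmp alpha (fun r => xi r \o p) X0 in
  forall (t : R) (f : R -> R), 0 <= t ->
    measurable_fun setT f -> (exists M, forall x, `|f x| <= M) ->
    cond_expectation P' [set w | 0 < X t w] (f \o X t) =
    \int[P']_w f (X0 w).

End QuasiStationary.

(* Main.v *)
(* Put a := |alpha| and J := \int_0^oo exp(alpha xi_r) dr. The process is alive
   at time t iff t < X(0)^a J. Stationarity and independence of the increments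
   give E[J^m] = m! / (phi(a) phi(2a) ... phi(ma)), so for R of law mu_R
   independent of J the product R J has the moments of the standard exponential
   law. Moments of at most factorial growth determine a law on [0, +oo[; hence
   under mu_R^(l) the lifetime X(0)^a J is exponential of rate l^alpha.
   At the time when the clock \int_0^. exp(alpha xi_r) dr reaches x, moments
   also show that the remaining lifetime is distributed like that of a fresh
   copy, so that conditionally on X(t) > 0 the variable X(t)^a J' (J' a copy of
   J independent of X(t)) has the law of X(0)^a J - t given X(0)^a J > t, which
   is the same exponential law. As the moments of J do not vanish, they can be
   divided out: the law of Y^a J' determines that of Y, and mu_R^(l) is
   quasi-stationary. Conversely, under a quasi-stationary law the survival
   probability of X is multiplicative in t, hence exponential, and dividing out
   the moments of J again leaves only the laws mu_R^(l). *)

From HB Require Import structures.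
Require Import Defs.
From mathcomp Require Import all_boot all_order all_algebra.
From mathcomp Require Import all_classical all_reals all_analysis.
From mathcomp Require Import measurable_realfun ring lra.

Set Implicit Arguments.
Unset Strict Implicit.
Unset Printing Implicit Defensive.
Import Order.TTheory GRing.Theory Num.Theory.
Import numFieldNormedType.Exports.

Local Open Scope classical_set_scope.
Local Open Scope ring_scope.

(** * Determinacy by moments *)

Section MomentDeterminacy.
Context (R : realType).
Implicit Types (mu nu : {measure set R -> \bar R}) (g : R -> R).

Let D : set R := `[0, +oo[%classic.

Let mD : measurable D. Proof. exact: measurable_itv. Qed.

Let same mu nu g := [/\ measurable_fun D g, mu.-integrable D (EFin \o g),
  nu.-integrable D (EFin \o g) &
  (\int[mu]_(x in D) (g x)%:E = \int[nu]_(x in D) (g x)%:E)%E].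

Let same_add mu nu g1 g2 : same mu nu g1 -> same mu nu g2 ->
  same mu nu (g1 \+ g2).
Proof.
move=> [m1 i1 j1 e1] [m2 i2 j2 e2]; split.
- exact: measurable_funD.
- by have := integrableD mD i1 i2; apply: eq_integrable.
- by have := integrableD mD j1 j2; apply: eq_integrable.
- under eq_integral do rewrite EFinD.
  under [RHS]eq_integral do rewrite EFinD.
  by rewrite integralD// integralD// e1 e2.
Qed.

Let same_scale mu nu (c : R) g : same mu nu g -> same mu nu (fun x => c * g x).
Proof.
move=> [m1 i1 j1 e1]; split.
- exact: measurable_funM.
- by have := integrableZl mD c i1; apply: eq_integrable.
- by have := integrableZl mD c j1; apply: eq_integrable.
- under eq_integral do rewrite EFinM.
  under [RHS]eq_integral do rewrite EFinM.
  by rewrite integralZl// integralZl// e1.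
Qed.

Let same_sum mu nu n (h : nat -> R -> R) : (forall i, same mu nu (h i)) ->
  same mu nu (fun x => \sum_(0 <= i < n) h i x).
Proof.
move=> hh; elim: n => [|n IH].
  have -> : (fun x : R => \sum_(0 <= i < 0) h i x) = cst 0.
    by apply/funext => x; rewrite big_geq.
  have := same_scale 0 (hh 0%N); congr same.
  by apply/funext => x; rewrite mul0r.
have -> : (fun x : R => \sum_(0 <= i < n.+1) h i x) =
    (fun x => \sum_(0 <= i < n) h i x) \+ h n.
  by apply/funext => x; rewrite big_nat_recr.
exact: same_add.
Qed.

Let same_lim mu nu (h : nat -> R -> R) g G : (forall i, same mu nu (h i)) ->
  measurable_fun D g ->
  mu.-integrable D (EFin \o G) -> nu.-integrable D (EFin \o G) ->
  (forall n x, 0 <= x -> `|h n x| <= G x) ->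
  (forall x, 0 <= x -> h ^~ x @ \oo --> g x) -> same mu nu g.
Proof.
move=> hh mg iG jG hG hg.
have dc (m : {measure set R -> \bar R}) : m.-integrable D (EFin \o G) ->
  [/\ m.-integrable D (EFin \o g), True &
     (fun n => \int[m]_(x in D) (h n x)%:E)%E @ \oo --> (\int[m]_(x in D) (g x)%:E)%E].
  move=> imG.
  have [|||||i1 _ i3] := @dominated_convergence _ _ _ m D mD (fun n => EFin \o h n)
    (EFin \o g) (EFin \o G).
  - by move=> n; apply/measurable_EFinP; have [] := hh n.
  - exact/measurable_EFinP.
  - apply: aeW => x; rewrite /D/= in_itv/= andbT => x0.
    by apply: cvg_EFin; [exact: nearW|exact: hg].
  - exact: imG.
  - apply: aeW => x n; rewrite /D/= in_itv/= andbT => x0.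
    by rewrite lee_fin; exact: hG.
  - by split.
have [i1 _ c1] := dc _ iG.
have [i2 _ c2] := dc _ jG.
split => //.
rewrite -(cvg_lim _ c1)// -(cvg_lim _ c2)//; congr (limn _).
by apply/funext => n; have [] := hh n.
Qed.

Let exprn_le_expR (c x : R) (k : nat) : 0 < c -> 0 <= x ->
  x ^+ k <= k`!%:R * c ^- k * expR (c * x).
Proof.
move=> c0 x0.
have H : (c * x) ^+ k / k`!%:R <= expR (c * x).
  case: k => [|k].
    rewrite expr0 fact0 divr1 -[leLHS]addr0; apply: le_trans (expR_ge1Dx _).
    by rewrite lerD2l mulr_ge0// ltW.
  apply: le_trans (expR_ge1Dxn k (mulr_ge0 (ltW c0) x0)).
  by rewrite lerDr.
have ck : 0 < c ^+ k by exact: exprn_gt0.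
have kf : 0 < k`!%:R :> R by rewrite ltr0n fact_gt0.
have -> : x ^+ k = k`!%:R * c ^- k * ((c * x) ^+ k / k`!%:R).
  by rewrite exprMn; field; rewrite !gt_eqF.
by rewrite ler_pM2l// mulr_gt0// invr_gt0.
Qed.

Let integrable_exp mu (K C : R) : 0 < C ->
  (forall n, (\int[mu]_(x in D) (x ^+ n)%:E <= (K * C ^+ n * n`!%:R)%:E)%E) ->
  mu.-integrable D (EFin \o (fun x => expR ((2 * C)^-1 * x))).
Proof.
move=> C0 mb; set c := (2 * C)^-1.
have c0 : 0 < c by rewrite invr_gt0 mulr_gt0.
have mexp : measurable_fun D (fun x => expR (c * x)).
  by apply: measurable_funTS; apply: measurableT_comp => //; exact: mulrl_measurable.
apply/integrableP; split; first exact/measurable_EFinP.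
under eq_integral => x _ do rewrite /= ger0_norm ?expR_ge0//.
pose t n (x : R) : \bar R := (exp_coeff (c * x) n)%:E.
have t0 n x : D x -> (0 <= t n x)%E.
  rewrite /D/= in_itv/= andbT => x0.
  by rewrite lee_fin; apply: exp_coeff_ge0; rewrite mulr_ge0// ltW.
have mt n : measurable_fun D (t n).
  apply/measurable_EFinP; apply: measurable_funTS.
  apply: measurable_funM => //; apply: measurable_funX.
  exact: mulrl_measurable.
have -> : (\int[mu]_(x in D) (expR (c * x))%:E = \int[mu]_(x in D) \sum_(n <oo) t n x)%E.
  apply: eq_integral => x _; apply/esym/cvg_lim => //.
  rewrite (_ : (fun n => _) = EFin \o series (exp_coeff (c * x))).
    by apply: cvg_EFin; [exact: nearW|exact: is_cvg_series_exp_coeff].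
  by apply/funext => n; rewrite /= /series/= -sumEFin.
rewrite integral_nneseries//.
apply: (@le_lt_trans _ _ (\sum_(n <oo) (K * (2^-1) ^+ n)%:E)%E).
  apply: lee_nneseries => [n _ _|n _].
    by apply: integral_ge0 => x Dx; exact: t0.
  have -> : (\int[mu]_(x in D) t n x = (c ^+ n / n`!%:R)%:E * \int[mu]_(x in D) (x ^+ n)%:E)%E.
    rewrite -ge0_integralZl//.
    - apply: eq_integral => x _; rewrite /t -EFinM; congr EFin.
      by rewrite /exp_coeff/= exprMn mulrAC.
    - by apply/measurable_EFinP; apply: measurable_funX; exact: measurable_id.
    - move=> x; rewrite /D/= in_itv/= andbT => x0.
      by rewrite lee_fin exprn_ge0.
    - by rewrite lee_fin divr_ge0// exprn_ge0// ltW.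
  apply: (@le_trans _ _ ((c ^+ n / n`!%:R)%:E * (K * C ^+ n * n`!%:R)%:E)%E).
    by apply: lee_wpmul2l => //; rewrite lee_fin divr_ge0// exprn_ge0// ltW.
  rewrite -EFinM lee_fin.
  have nf : n`!%:R != 0 :> R by rewrite pnatr_eq0 -lt0n fact_gt0.
  have -> : 2^-1 = c * C :> R by rewrite /c invfM -mulrA mulVf ?mulr1// gt_eqF.
  rewrite exprMn le_eqVlt; apply/orP; left; apply/eqP.
  by field.
have K0 : 0 <= K.
  have := mb 0%N; rewrite expr0 fact0 mulr1 mulr1 => /(le_trans _).
  rewrite -lee_fin; apply.
  by apply: integral_ge0 => x _; rewrite expr0 lee_fin.
have h1 : `|2^-1 : R| < 1 by rewrite ger0_norm// invf_lt1// ltr1n.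
have := cvg_geometric_series (a := K) h1; set l := (X in _ --> X) => cl.
suff -> : (\sum_(n <oo) (K * 2^-1 ^+ n)%:E = l%:E)%E by rewrite ltry.
apply/cvg_lim => //.
rewrite (_ : (fun n => _) = EFin \o series (geometric K 2^-1)).
  by apply: cvg_EFin; [exact: nearW|exact: cl].
by apply/funext => n; rewrite /= /series/= -sumEFin.
Qed.

Let bernoulli (y : R) N : -1 <= y -> 1 + N%:R * y <= (1 + y) ^+ N.
Proof.
move=> y1; elim: N => [|N IH]; first by rewrite mul0r addr0 expr0.
rewrite exprS; apply: (@le_trans _ _ ((1 + y) * (1 + N%:R * y))); last first.
  by apply: ler_wpM2l => //; lra.
have := sqr_ge0 y; have := ler0n R N.
by rewrite -[N.+1]addn1 natrD; nra.
Qed.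

(* [(1 - e ^ (- n d x)) ^ N] with [N] about [n e ^ (n d x0)] is a polynomial in
   [e ^ (- d x)] that tends to the indicator of [x0 < x]. *)
Let ray (d x0 : R) (n : nat) (x : R) : R :=
  (1 - expR (- (n%:R * (d * x)))) ^+ (Num.truncn (n%:R * expR (n%:R * (d * x0)))).+1.

Let ray_cvg (d x0 x : R) : 0 < d -> 0 <= x0 -> 0 <= x ->
  ray d x0 ^~ x @ \oo --> ((x0 < x)%R%:R : R).
Proof.
move=> d0 x0_ge0 x_ge0.
set N := fun n : nat => (Num.truncn (n%:R * expR (n%:R * (d * x0)))).+1.
set u := fun n : nat => expR (- (n%:R * (d * x))).
have u0 n : 0 < u n by exact: expR_gt0.
have u1 n : u n <= 1 by rewrite expR_le1 oppr_le0 !mulr_ge0// ltW.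
have ray1 n : ray d x0 n x <= 1.
  by apply: exprn_ile1; [rewrite subr_ge0; exact: u1|rewrite lerBlDr lerDl expR_ge0].
have ray0 n : 0 <= ray d x0 n x by rewrite /ray exprn_ge0// subr_ge0; exact: u1.
have Nlo n : n%:R * expR (n%:R * (d * x0)) <= (N n)%:R.
  exact/ltW/truncnS_gt.
have Nhi n : (N n)%:R <= n%:R * expR (n%:R * (d * x0)) + 1.
  rewrite /N -addn1 natrD lerD2r truncn_le.
  by rewrite mulr_ge0// expR_ge0.
have key K : (forall n, (0 < n)%N -> `|(x0 < x)%R%:R - ray d x0 n x| <= K * n%:R^-1) ->
    ray d x0 ^~ x @ \oo --> ((x0 < x)%R%:R : R).
  move=> H; apply/cvgrPdist_le => e e0; near=> n.
  have n0 : (0 < n)%N by near: n; exists 1%N.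
  have nR : 0 < n%:R :> R by rewrite ltr0n.
  apply: le_trans (H _ n0) _; rewrite ler_pdivrMr// mulrC -ler_pdivrMr//.
  by near: n; exact: nbhs_infty_ger.
case: (ltP x0 x) key => [xx0|xx0] key.
  set b := d * (x - x0).
  have b0 : 0 < b by rewrite mulr_gt0// subr_gt0.
  have dx0 : 0 < d * x by rewrite mulr_gt0// (le_lt_trans x0_ge0).
  apply: (key (4 / b ^+ 2 + (d * x)^-1)) => n n0.
  have nR : 0 < n%:R :> R by rewrite ltr0n.
  rewrite ger0_norm ?subr_ge0// lerBlDr addrC -lerBlDr.
  apply: (@le_trans _ _ (1 + (N n)%:R * (- u n))); last first.
    by apply: bernoulli; rewrite lerN2.
  rewrite mulrN lerD2l lerN2.
  apply: (@le_trans _ _ ((n%:R * expR (n%:R * (d * x0)) + 1) * u n)).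
    by rewrite ler_wpM2r// ltW.
  rewrite mulrDl mul1r mulrDl; apply: lerD; last first.
    rewrite /u expRN -invfM lef_pV2 ?posrE ?expR_gt0 ?(mulr_gt0 dx0 nR)//.
    by rewrite mulrC; apply: le_trans (expR_ge1Dx _); rewrite lerDr.
  have -> : n%:R * expR (n%:R * (d * x0)) * u n = n%:R * expR (- (n%:R * b)).
    by rewrite /u -mulrA -expRD; congr (_ * expR _); rewrite /b; ring.
  have e1 : n%:R * b / 2 <= expR (n%:R * b / 2).
    by apply: le_trans (expR_ge1Dx _); rewrite lerDr.
  have e2 : expR (n%:R * b) = expR (n%:R * b / 2) ^+ 2.
    by rewrite -expRM_natr; congr expR; field.
  have e3 : (n%:R * b / 2) ^+ 2 <= expR (n%:R * b).
    by rewrite e2 !expr2; apply: ler_pM => //; rewrite divr_ge0// mulr_ge0// ltW.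
  rewrite expRN ler_pdivrMr ?expR_gt0//.
  apply: (@le_trans _ _ (4 / b ^+ 2 / n%:R * (n%:R * b / 2) ^+ 2)).
    by rewrite le_eqVlt; apply/orP; left; apply/eqP; field; rewrite !gt_eqF.
  by rewrite ler_wpM2l// !mulr_ge0// invr_ge0 ?exprn_ge0// ltW.
apply: (key 1) => n n0.
have nR : 0 < n%:R :> R by rewrite ltr0n.
rewrite sub0r normrN ger0_norm// mul1r -[leRHS]mul1r ler_pdivlMr//.
have Nu : n%:R <= (N n)%:R * u n.
  apply: (@le_trans _ _ (n%:R * expR (n%:R * (d * x0)) * u n)); last first.
    by rewrite ler_wpM2r// ltW.
  rewrite /u -mulrA -expRD ler_peMr ?ler0n// -[leLHS]expR0 ler_expR.
  by rewrite -mulrBr mulr_ge0// -mulrBr mulr_ge0 ?subr_ge0// ltW.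
have B : n%:R <= (1 + u n) ^+ N n.
  apply: (le_trans Nu); apply: le_trans (bernoulli (N n) _); first by rewrite lerDr.
  by rewrite (le_trans _ (ltW (u0 n)))// lerNl oppr0.
apply: (@le_trans _ _ (ray d x0 n x * (1 + u n) ^+ N n)).
  by rewrite ler_wpM2l.
rewrite /ray -/(N n) -/(u n) -exprMn; apply: exprn_ile1.
  by rewrite mulr_ge0 ?subr_ge0// addr_ge0// ltW.
by rewrite -subr_sqr expr1n lerBlDr lerDl sqr_ge0.
Unshelve. all: by end_near. Qed.

Let same_monomial mu nu (K C : R) : 0 < C ->
  (forall n, (\int[mu]_(x in D) (x ^+ n)%:E = \int[nu]_(x in D) (x ^+ n)%:E)%E) ->
  (forall n, (\int[mu]_(x in D) (x ^+ n)%:E <= (K * C ^+ n * n`!%:R)%:E)%E) ->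
  forall j k, same mu nu (fun x => x ^+ k * expR (- (j%:R * ((4 * C)^-1 * x)))).
Proof.
move=> C0 eqm mb; set d := (4 * C)^-1.
have d0 : 0 < d by rewrite invr_gt0 mulr_gt0.
have nb n : (\int[nu]_(x in D) (x ^+ n)%:E <= (K * C ^+ n * n`!%:R)%:E)%E.
  by rewrite -eqm.
have mM j k : measurable_fun D (fun x : R => x ^+ k * expR (- (j%:R * (d * x)))).
  apply: measurable_funTS; apply: measurable_funM; first exact: exprn_measurable.
  apply: measurableT_comp => //; apply: measurableT_comp => //.
  by apply: measurable_funM => //; exact: mulrl_measurable.
have dom (m : {measure set R -> \bar R}) k :
   (forall n, (\int[m]_(x in D) (x ^+ n)%:E <= (K * C ^+ n * n`!%:R)%:E)%E) ->
   m.-integrable D (EFin \o (fun x => x ^+ k * expR (d * x))).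
  move=> bm; have := integrable_exp C0 bm.
  move=> /(integrableZl mD (k`!%:R * d ^- k)).
  apply: le_integrable => //.
    apply/measurable_EFinP; apply: measurable_funTS; apply: measurable_funM.
      exact: exprn_measurable.
    by apply: measurableT_comp => //; exact: mulrl_measurable.
  move=> x; rewrite /D/= in_itv/= andbT => x0.
  have c0 : 0 <= k`!%:R * d ^- k :> R by rewrite mulr_ge0// invr_ge0 exprn_ge0// ltW.
  rewrite lee_fin [leLHS]ger0_norm ?mulr_ge0 ?exprn_ge0 ?expR_ge0//.
  rewrite [leRHS]ger0_norm; last by rewrite mulr_ge0// expR_ge0.
  have -> : expR ((2 * C)^-1 * x) = expR (d * x) * expR (d * x).
    by rewrite -expRD; congr expR; rewrite /d; field; rewrite gt_eqF.
  by rewrite mulrA ler_wpM2r ?expR_ge0//; exact: exprn_le_expR.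
elim=> [|j IH] k.
  have -> : (fun x : R => x ^+ k * expR (- (0%:R * (d * x)))) = (fun x => x ^+ k).
    by apply/funext => x; rewrite mul0r oppr0 expR0 mulr1.
  have ik (m : {measure set R -> \bar R}) :
     (forall n, (\int[m]_(x in D) (x ^+ n)%:E <= (K * C ^+ n * n`!%:R)%:E)%E) ->
     m.-integrable D (EFin \o (fun x => x ^+ k)).
    move=> bm; apply/integrableP; split.
      by apply/measurable_EFinP; exact: exprn_measurable.
    under eq_integral => x.
      rewrite inE /D/= in_itv/= andbT => x0; rewrite ger0_norm ?exprn_ge0//.
      over.
    by rewrite (le_lt_trans (bm k))// ltry.
  split; [exact: exprn_measurable|exact: ik|exact: ik|exact: eqm].
apply: (@same_lim mu nu
  (fun n x => \sum_(0 <= i < n) ((- d) ^+ i / i`!%:R) *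
     (x ^+ (k + i) * expR (- (j%:R * (d * x))))) _ (fun x => x ^+ k * expR (d * x))).
- move=> n; apply: (@same_sum mu nu n (fun i x => ((- d) ^+ i / i`!%:R) *
     (x ^+ (k + i) * expR (- (j%:R * (d * x)))))) => i.
  exact: same_scale.
- exact: mM.
- exact: dom.
- exact: dom.
- move=> n x x0.
  have -> : \sum_(0 <= i < n) ((- d) ^+ i / i`!%:R) *
     (x ^+ (k + i) * expR (- (j%:R * (d * x)))) =
     x ^+ k * expR (- (j%:R * (d * x))) * series (exp_coeff (- (d * x))) n.
    rewrite /series/= mulr_sumr; apply: eq_bigr => i _.
    by rewrite /exp_coeff/= exprD -[- (d * x)]mulNr exprMn; ring.
  rewrite !normrM ger0_norm ?exprn_ge0// [X in _ * X * _]ger0_norm ?expR_ge0//.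
  rewrite -mulrA; apply: ler_wpM2l; first exact: exprn_ge0.
  rewrite -[leRHS]mul1r; apply: ler_pM => //.
    by rewrite expR_le1 oppr_le0 !mulr_ge0// ltW.
  apply: le_trans (ler_norm_sum _ _ _) _.
  have -> : \sum_(0 <= i < n) `|exp_coeff (- (d * x)) i| = series (exp_coeff (d * x)) n.
    apply: eq_bigr => i _; rewrite /exp_coeff/= normrM normfV normrX normrN normr_nat.
    by rewrite ger0_norm// mulr_ge0// ltW.
  apply: nondecreasing_cvgn_le; last exact: is_cvg_series_exp_coeff.
  apply: nondecreasing_series => i _ _.
  by apply: exp_coeff_ge0; rewrite mulr_ge0// ltW.
- move=> x x0.
  have -> : x ^+ k * expR (- (j.+1%:R * (d * x))) =
     x ^+ k * expR (- (j%:R * (d * x))) * expR (- (d * x)).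
    by rewrite -mulrA -expRD; congr (_ * expR _); rewrite -addn1 natrD; ring.
  have -> : (fun n => \sum_(0 <= i < n) ((- d) ^+ i / i`!%:R) *
     (x ^+ (k + i) * expR (- (j%:R * (d * x))))) =
     (fun n => x ^+ k * expR (- (j%:R * (d * x))) * series (exp_coeff (- (d * x))) n).
    apply/funext => n.
    rewrite /series/= mulr_sumr; apply: eq_bigr => i _.
    by rewrite /exp_coeff/= exprD -[- (d * x)]mulNr exprMn; ring.
  by apply: cvgMl_tmp; exact: is_cvg_series_exp_coeff.
Qed.

Let same_ray mu nu (K C : R) : 0 < C ->
  (forall n, (\int[mu]_(x in D) (x ^+ n)%:E = \int[nu]_(x in D) (x ^+ n)%:E)%E) ->
  (forall n, (\int[mu]_(x in D) (x ^+ n)%:E <= (K * C ^+ n * n`!%:R)%:E)%E) ->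
  forall x0 n, same mu nu (ray (4 * C)^-1 x0 n).
Proof.
move=> C0 eqm mb x0 n; set d := (4 * C)^-1.
set N := (Num.truncn (n%:R * expR (n%:R * (d * x0)))).+1.
pose p : {poly R} := (1 - 'X^n) ^+ N.
have -> : ray d x0 n = fun x => \sum_(0 <= i < size p) p`_i *
    (x ^+ 0 * expR (- (i%:R * (d * x)))).
  apply/funext => x.
  have -> : ray d x0 n x = p.[expR (- (d * x))].
    have -> : p.[expR (- (d * x))] = (1 - expR (- (d * x)) ^+ n) ^+ N.
      by rewrite /p !hornerE.
    by rewrite /ray -expRM_natl mulrN.
  rewrite horner_coef big_mkord; apply: eq_bigr => i _.
  by rewrite expr0 mul1r -expRM_natl mulrN.
apply: (@same_sum mu nu (size p) (fun i x => p`_i *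
    (x ^+ 0 * expR (- (i%:R * (d * x)))))) => i.
by apply: same_scale; exact: same_monomial.
Qed.

Let eq_tail mu nu (K C : R) : 0 < C ->
  (forall n, (\int[mu]_(x in D) (x ^+ n)%:E = \int[nu]_(x in D) (x ^+ n)%:E)%E) ->
  (forall n, (\int[mu]_(x in D) (x ^+ n)%:E <= (K * C ^+ n * n`!%:R)%:E)%E) ->
  forall x0, 0 <= x0 -> mu `]x0, +oo[%classic = nu `]x0, +oo[%classic.
Proof.
move=> C0 eqm mb x0 x0_ge0.
have [_ i1 j1 _] := same_monomial C0 eqm mb 0 0.
set d := (4 * C)^-1 in i1 j1 *.
have d0 : 0 < d by rewrite invr_gt0 mulr_gt0.
have : same mu nu (fun x => (x0 < x)%R%:R).
  apply: (@same_lim mu nu (fun n => ray d x0 n) _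
    (fun x => x ^+ 0 * expR (- (0%:R * (d * x))))) => //.
  - by move=> n; exact: (same_ray C0 eqm mb).
  - have -> : (fun x : R => (x0 < x)%R%:R) = \1_(`]x0, +oo[%classic) :> (R -> R).
      apply/funext => x; rewrite indicE; congr (nat_of_bool _)%:R.
      by apply/idP/idP => [h|]; rewrite ?inE /= in_itv/= andbT.
    by apply: measurable_indic; exact: measurable_itv.
  - move=> n x x_ge0; rewrite mul0r oppr0 expR0 expr0 mul1r.
    rewrite ger0_norm; last first.
      rewrite /ray exprn_ge0// subr_ge0 expR_le1 oppr_le0.
      by rewrite !mulr_ge0// ltW.
    apply: exprn_ile1; last by rewrite lerBlDr lerDl expR_ge0.
    by rewrite subr_ge0 expR_le1 oppr_le0 !mulr_ge0// ltW.
  - by move=> x x_ge0; exact: ray_cvg.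
move=> [_ _ _].
have E (m : {measure set R -> \bar R}) :
    (\int[m]_(x in D) ((x0 < x)%R%:R)%:E = m `]x0, +oo[%classic)%E.
  rewrite (_ : (fun x => _) = EFin \o \1_(`]x0, +oo[%classic)); last first.
    apply/funext => x /=; rewrite indicE; congr (nat_of_bool _)%:R%:E.
    by apply/idP/idP => [h|]; rewrite ?inE /= in_itv/= andbT.
  rewrite integral_indic; [|exact: mD|exact: measurable_itv].
  congr (m _); apply/seteqP; split => [x []//|x xx0]; split => //.
  move: xx0; rewrite /D/= !in_itv/= !andbT.
  by move=> /ltW; exact: le_trans.
by rewrite !E.
Qed.

Lemma eq_measure_rays mu nu : (mu D < +oo)%E -> mu D = nu D ->
  (forall x0, 0 <= x0 -> mu `]x0, +oo[%classic = nu `]x0, +oo[%classic) ->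
  forall A, measurable A -> mu (D `&` A) = nu (D `&` A).
Proof.
move=> muD eD eT A mA.
rewrite ![D `&` _]setIC.
change (mrestr mu mD A = mrestr nu mD A).
apply: (@measure_unique _ _ _ (@RGenOInfty.G R) (fun n => `](- n%:R), +oo[%classic)).
- exact: RGenOInfty.measurableE.
- move=> _ _ [x ->] [y ->]; exists (Num.max x y).
  apply/seteqP; split => z /=; rewrite !in_itv/= !andbT gt_max.
    by move=> [-> ->].
  by move=> /andP[].
- by move=> n; exists (- n%:R).
- apply/seteqP; split => // x _.
  exists (Num.truncn `|x|).+1 => //=; rewrite in_itv/= andbT.
  rewrite ltrNl (le_lt_trans (ler_norm _))// normrN; exact: truncnS_gt.
- move=> _ [x ->].
  change (mu (`]x, +oo[%classic `&` D) = nu (`]x, +oo[%classic `&` D)).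
  have [x0|x0] := leP 0 x.
    have -> : `]x, +oo[%classic `&` D = `]x, +oo[%classic; last exact: eT.
    apply/seteqP; split => [z []//|z zx]; split => //; move: zx.
    by rewrite /D/= !in_itv/= !andbT => /ltW; exact: le_trans.
  have -> // : `]x, +oo[%classic `&` D = D.
  apply/seteqP; split => [z []//|z zx]; split => //; move: zx.
  by rewrite /D/= !in_itv/= !andbT; exact: lt_le_trans.
- move=> n; change (mu (`](- n%:R)%R, +oo[%classic `&` D) < +oo)%E.
  rewrite (le_lt_trans _ muD)// le_measure ?inE//.
  by apply: measurableI => //; exact: measurable_itv.
- exact: mA.
Qed.

Lemma moment_determinacy mu nu (K C : R) : 0 < C ->
  (forall n, (\int[mu]_(x in D) (x ^+ n)%:E = \int[nu]_(x in D) (x ^+ n)%:E)%E) ->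
  (forall n, (\int[mu]_(x in D) (x ^+ n)%:E <= (K * C ^+ n * n`!%:R)%:E)%E) ->
  forall A, measurable A -> mu (D `&` A) = nu (D `&` A).
Proof.
move=> C0 eqm mb.
have E (m : {measure set R -> \bar R}) :
    (\int[m]_(x in D) (x ^+ 0)%:E = m D)%E.
  by under eq_integral do rewrite expr0; rewrite integral_cst// mul1e.
apply: eq_measure_rays; last exact: (eq_tail C0 eqm mb).
  by rewrite -E (le_lt_trans (mb _))// ltry.
by rewrite -!E.
Qed.

End MomentDeterminacy.

Section ImageMeasure.
Context d1 d2 (T1 : measurableType d1) (T2 : measurableType d2) (R : realType).

Definition image_measure (mu : {measure set T1 -> \bar R}) (X : T1 -> T2)
    (mX : measurable_fun setT X) : {measure set T2 -> \bar R} :=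
  @measure_function_pushforward__canonical__measure_function_Measure
    _ _ _ _ _ mu _ mX.

End ImageMeasure.

Section LawOn.
Context d (T : measurableType d) (R : realType) (mu : {measure set T -> \bar R}).
Variables (D : set T) (X : T -> R).
Hypotheses (mD : measurable D) (mX : measurable_fun setT X).
Hypothesis X_ge0 : forall w, D w -> 0 <= X w.

Let Y w := \1_D w * (X w + 1) - 1.

Let YD w : D w -> Y w = X w.
Proof. by move=> Dw; rewrite /Y indicE mem_set// mul1r addrK. Qed.

Let YnD w : ~ D w -> Y w = -1.
Proof. by move=> Dw; rewrite /Y indicE memNset// mul0r sub0r. Qed.

Let mY : measurable_fun setT Y.
Proof.
apply: measurable_funB => //; apply: measurable_funM.
  exact: measurable_indic.
exact: measurable_funD.
Qed.

Let Y_ge0 : Y @^-1` `[0, +oo[ = D.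
Proof.
apply/seteqP; split => w /=; rewrite in_itv/= andbT.
  by move=> Yw; apply: contrapT => /YnD Ew; move: Yw; rewrite Ew; lra.
by move=> Dw; rewrite YD//; exact: X_ge0.
Qed.

Lemma law_on : exists m : {measure set R -> \bar R},
  (forall A : set R, measurable A -> m (`[0, +oo[%classic `&` A) = mu (D `&` X @^-1` A)) /\
  (forall g : R -> \bar R, measurable_fun setT g -> (forall x, 0 <= g x)%E ->
    (\int[m]_(x in `[0%R, +oo[) g x = \int[mu]_(w in D) g (X w))%E).
Proof.
exists (image_measure mu mY); split => [A mA|g mg g0].
  rewrite /= /pushforward; congr (mu _).
  rewrite preimage_setI Y_ge0; apply/seteqP; split => w /= [Dw].
    by rewrite YD.
  by rewrite YD.
rewrite (ge0_integral_pushforward mY)//; last exact: measurable_funTS.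
rewrite Y_ge0; apply: eq_integral => w; rewrite inE => Dw.
by rewrite /= YD.
Qed.

End LawOn.

Section EqualLaws.
Context d1 d2 (T1 : measurableType d1) (T2 : measurableType d2) (R : realType).
Variables (mu1 : {measure set T1 -> \bar R}) (mu2 : {measure set T2 -> \bar R}).
Variables (D1 : set T1) (D2 : set T2) (X1 : T1 -> R) (X2 : T2 -> R).
Hypotheses (mD1 : measurable D1) (mD2 : measurable D2).
Hypotheses (mX1 : measurable_fun setT X1) (mX2 : measurable_fun setT X2).
Hypotheses (X1_ge0 : forall w, D1 w -> 0 <= X1 w).
Hypotheses (X2_ge0 : forall w, D2 w -> 0 <= X2 w).

Lemma eq_law_of_moments (K C : R) : 0 < C ->
  (forall n, \int[mu1]_(w in D1) (X1 w ^+ n)%:E =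
             \int[mu2]_(w in D2) (X2 w ^+ n)%:E)%E ->
  (forall n, (\int[mu1]_(w in D1) (X1 w ^+ n)%:E <= (K * C ^+ n * n`!%:R)%:E)%E) ->
  forall A, measurable A ->
    mu1 (D1 `&` X1 @^-1` A) = mu2 (D2 `&` X2 @^-1` A).
Proof.
move=> C0 eqm mb A mA.
have [m1 [m1E m1I]] := law_on mu1 mD1 mX1 X1_ge0.
have [m2 [m2E m2I]] := law_on mu2 mD2 mX2 X2_ge0.
have mE (m : {measure set R -> \bar R}) n :
    (\int[m]_(x in `[0%R, +oo[) (x ^+ n)%:E =
     \int[m]_(x in `[0%R, +oo[) (`|x| ^+ n)%:E)%E.
  apply: eq_integral => x; rewrite inE/= in_itv/= andbT => x0.
  by rewrite ger0_norm.
have mabs n : measurable_fun setT (fun x : R => (`|x| ^+ n)%:E).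
  apply/measurable_EFinP; apply: measurable_funX; exact: normr_measurable.
have m1n n : (\int[m1]_(x in `[0%R, +oo[) (x ^+ n)%:E =
    \int[mu1]_(w in D1) (X1 w ^+ n)%:E)%E.
  rewrite mE (m1I (fun x => (`|x| ^+ n)%:E))//.
  by apply: eq_integral => w; rewrite inE => Dw; rewrite ger0_norm// X1_ge0.
have m2n n : (\int[m2]_(x in `[0%R, +oo[) (x ^+ n)%:E =
    \int[mu2]_(w in D2) (X2 w ^+ n)%:E)%E.
  rewrite mE (m2I (fun x => (`|x| ^+ n)%:E))//.
  by apply: eq_integral => w; rewrite inE => Dw; rewrite ger0_norm// X2_ge0.
rewrite -m1E// -m2E//; apply: (moment_determinacy C0) => //.
  by move=> n; rewrite m1n m2n.
by move=> n; rewrite m1n.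
Qed.

Lemma eq_law_of_tails : (mu1 D1 < +oo)%E -> mu1 D1 = mu2 D2 ->
  (forall x, 0 <= x -> mu1 (D1 `&` [set w | x < X1 w]) =
                       mu2 (D2 `&` [set w | x < X2 w])) ->
  forall g : R -> \bar R, measurable_fun setT g -> (forall x, 0 <= g x)%E ->
    (\int[mu1]_(w in D1) g (X1 w) = \int[mu2]_(w in D2) g (X2 w))%E.
Proof.
move=> fin eqD eqT g mg g0.
have [m1 [m1E m1I]] := law_on mu1 mD1 mX1 X1_ge0.
have [m2 [m2E m2I]] := law_on mu2 mD2 mX2 X2_ge0.
rewrite -m1I// -m2I//.
have D0 (m : {measure set R -> \bar R}) : m `[0, +oo[%classic = m (`[0, +oo[%classic `&` setT).
  by rewrite setIT.
have ray d (T : measurableType d) (mu : {measure set T -> \bar R}) (D : set T)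
    (X : T -> R) (m : {measure set R -> \bar R}) x : 0 <= x ->
    (forall A : set R, measurable A -> m (`[0, +oo[%classic `&` A) = mu (D `&` X @^-1` A)) ->
    m `]x, +oo[%classic = mu (D `&` [set w | x < X w]).
  move=> x0 H.
  have -> : `]x, +oo[%classic = `[0, +oo[%classic `&` `]x, +oo[%classic :> set R.
    apply/seteqP; split => [z zx|z []//]; split => //; move: zx.
    by rewrite /= !in_itv/= !andbT => /ltW; exact: le_trans.
  rewrite H; last exact: measurable_itv.
  by congr (mu (_ `&` _)); apply/seteqP; split => w /=; rewrite in_itv/= andbT.
apply: eq_measure_integral => A mA AD.
have AE : A = `[0, +oo[%classic `&` A by rewrite setIidr.
rewrite AE; apply: eq_measure_rays => //.
- by rewrite D0 m1E// preimage_setT setIT.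
- by rewrite !D0 m1E// m2E// !preimage_setT !setIT.
- by move=> x x0; rewrite (ray _ _ _ _ _ _ _ x0 m1E) (ray _ _ _ _ _ _ _ x0 m2E) eqT.
Qed.

End EqualLaws.

Section IndependentPair.
Context d d1 d2 (T : measurableType d) (T1 : measurableType d1)
  (T2 : measurableType d2) (R : realType) (P : probability T R).
Variables (m1 : probability T1 R) (m2 : probability T2 R).
Variables (X : T -> T1) (Y : T -> T2).
Hypotheses (mX : measurable_fun setT X) (mY : measurable_fun setT Y).
Hypothesis XY : forall A B, measurable A -> measurable B ->
  P (X @^-1` A `&` Y @^-1` B) = (m1 A * m2 B)%E.

Lemma integral_independent_pair (F : T1 * T2 -> \bar R) :
  measurable_fun setT F -> (forall z, 0 <= F z)%E ->
  (\int[P]_w F (X w, Y w) = \int[m1]_x \int[m2]_y F (x, y))%E.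
Proof.
move=> mF F0.
have mXY : measurable_fun setT (fun w => (X w, Y w)) by exact: measurable_fun_pair.
rewrite -(@fubini_tonelli1 _ _ _ _ _ m1 m2)//.
transitivity (\int[image_measure P mXY]_z F z)%E.
  rewrite ge0_integral_pushforward//.
by apply: eq_measure_integral => A mA _; apply/esym/product_measure_unique.
Qed.

End IndependentPair.

(** * Integration of tails *)

Section LayerCake.
Context (R : realType).
Local Notation leb := (@lebesgue_measure R).

Lemma measurable_ltr_set : measurable [set z : R * R | z.1 < z.2].
Proof.
have := measurable_fun_ltr (@measurable_fst _ _ R R) (@measurable_snd _ _ R R).
move=> /(_ measurableT [set true]); rewrite setTI; exact.
Qed.

Lemma integral_monomial (n : nat) (x : R) : 0 <= x ->
  (\int[leb]_(y in `[0%R, x[) (n.+1%:R * `|y| ^+ n)%:E = (x ^+ n.+1)%:E)%E.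
Proof.
rewrite le_eqVlt => /predU1P[<-|x0].
  by rewrite set_itvco0 integral_set0 expr0n.
rewrite integral_itv_bndo_bndc; last first.
  apply/measurable_EFinP; apply: measurable_funTS; apply: measurable_funM => //.
  by apply: measurable_funX; exact: normr_measurable.
transitivity (\int[leb]_(y in `[0%R, x]) (n.+1%:R * y ^+ n)%:E)%E.
  apply: eq_integral => y; rewrite inE/= in_itv/= => /andP[y0 _].
  by rewrite ger0_norm.
rewrite (@continuous_FTC2 R _ (fun y => y ^+ n.+1))//.
- by rewrite expr0n/= sube0.
- apply: continuous_subspaceT => y; apply: cvgMl_tmp.
  exact: exprn_continuous.
- split.
  + by move=> y _; exact: exprn_derivable.
  + by apply/cvg_at_right_filter; exact: exprn_continuous.
  + by apply/cvg_at_left_filter; exact: exprn_continuous.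
- by move=> y _; rewrite exp_derive1.
Qed.

Lemma weighted_layer_cake (mu : {sigma_finite_measure set (measurableTypeR R) -> \bar R})
    (g : R -> \bar R) (n : nat) : measurable_fun setT g -> (forall x, 0 <= g x)%E ->
  (\int[mu]_(x in `[0%R, +oo[) ((x ^+ n.+1)%:E * g x) =
   n.+1%:R%:E * \int[leb]_(y in `[0%R, +oo[) ((y ^+ n)%:E * \int[mu]_(x in `]y, +oo[) g x))%E.
Proof.
move=> mg g0.
pose S : set (R * R) := [set z | 0 <= z.1 < z.2].
have mS : measurable S.
  rewrite (_ : S = [set z | 0 <= z.1] `&` [set z | z.1 < z.2]); last first.
    by apply/seteqP; split => z /=; [move=> /andP[]|move=> [? ?]; apply/andP].
  apply: measurableI.
    rewrite (_ : mkset _ = fst @^-1` `[0, +oo[%classic); last first.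
      by apply/seteqP; split => z /=; rewrite in_itv/= andbT.
    by rewrite -[X in measurable X]setTI; apply: measurable_fst.
  exact: measurable_ltr_set.
pose F z : \bar R := ((\1_S z * (n.+1%:R * `|z.1| ^+ n))%:E * g z.2)%E.
have mF : measurable_fun setT F.
  apply: emeasurable_funM; last exact: measurableT_comp.
  apply/measurable_EFinP; apply: measurable_funM; first exact: measurable_indic.
  apply: measurable_funM => //; apply: measurable_funX.
  by apply: measurableT_comp => //; exact: measurable_fst.
have F0 z : (0 <= F z)%E.
  by rewrite mule_ge0// lee_fin mulr_ge0// mulr_ge0// exprn_ge0.
have := @fubini_tonelli _ _ _ _ _ leb mu F mF F0.
have L y : (\int[mu]_x F (y, x) = (\1_(`[0%R, +oo[%classic) y)%:E *
   ((n.+1%:R)%:E * ((`|y| ^+ n)%:E * \int[mu]_(x in `]y, +oo[) g x)))%E.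
  rewrite indicE; case: (boolP (y \in _)) => [|].
    rewrite inE/= in_itv/= andbT => y0.
    rewrite mul1e muleA -EFinM -ge0_integralZl//; last exact: measurable_funTS.
    rewrite [RHS]integral_mkcond; apply: eq_integral => x _.
    rewrite patchE /F/= indicE; case: (boolP (x \in _)).
      by rewrite inE/= in_itv/= andbT => yx; rewrite mem_set ?mul1r//; apply/andP.
    move=> h; rewrite memNset ?mul0r ?mul0e//=.
    by move=> /andP[_ yx]; move/negP: h; apply; rewrite inE/= in_itv/= yx.
  move=> h; rewrite mul0e integral0_eq// => x _.
  rewrite /F/= indicE memNset ?mul0r ?mul0e//=.
  by move=> /andP[y0 yx]; move/negP: h; apply; rewrite inE/= in_itv/= y0.
have Rr x : (\int[leb]_y F (y, x) = (\1_(`[0%R, +oo[%classic) x)%:E *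
   ((`|x| ^+ n.+1)%:E * g x))%E.
  rewrite indicE; case: (boolP (x \in _)) => [|].
    rewrite inE/= in_itv/= andbT => x0.
    rewrite mul1e [`|x|]ger0_norm// -integral_monomial// -ge0_integralZr//; last first.
      apply/measurable_EFinP; apply: measurable_funTS; apply: measurable_funM => //.
      by apply: measurable_funX; exact: normr_measurable.
    rewrite [RHS]integral_mkcond; apply: eq_integral => y _.
    rewrite patchE /F/= indicE; case: (boolP (y \in _)).
      by rewrite inE/= in_itv/= => yx; rewrite mem_set ?mul1r.
    move=> h; rewrite memNset ?mul0r ?mul0e//=.
    by move=> yx; move/negP: h; apply; rewrite inE/= in_itv/= yx.
  move=> h; rewrite mul0e integral0_eq// => y _.
  rewrite /F/= indicE memNset ?mul0r ?mul0e//=.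
  move=> /andP[y0 /ltW yx]; move/negP: h; apply; rewrite inE/= in_itv/= andbT.
  exact: le_trans yx.
under eq_integral do rewrite L.
under [RHS]eq_integral do rewrite Rr.
have ind (m : {measure set (measurableTypeR R) -> \bar R}) (k : R -> \bar R) :
  (\int[m]_x ((\1_(`[0%R, +oo[%classic) x)%:E * k x) = \int[m]_(x in `[0%R, +oo[) k x)%E.
  rewrite [RHS]integral_mkcond; apply: eq_integral => x _.
  by rewrite patchE indicE; case: ifPn; rewrite ?mul1e ?mul0e.
rewrite !ind => E.
transitivity (\int[mu]_(x in `[0%R, +oo[) ((`|x| ^+ n.+1)%:E * g x))%E.
  by apply: eq_integral => x; rewrite inE/= in_itv/= andbT => x0; rewrite ger0_norm.
rewrite -E.
rewrite (@ge0_integralZl _ _ _ leb)//.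
- congr (_ * _)%E; apply: eq_integral => x; rewrite inE/= in_itv/= andbT => x0.
  by rewrite ger0_norm.
- apply: measurable_funTS; apply: emeasurable_funM.
    apply/measurable_EFinP; apply: measurable_funX; exact: normr_measurable.
  have mT : measurable_fun setT (fun z : R * R => (\1_[set z : R * R | z.1 < z.2] z)%:E * g z.2)%E.
    apply: emeasurable_funM; last exact: measurableT_comp.
    apply/measurable_EFinP; apply: measurable_indic.
    exact: measurable_ltr_set.
  have T0 (z : R * R) : (0 <= (\1_[set z : R * R | z.1 < z.2] z)%:E * g z.2)%E.
    by rewrite mule_ge0// lee_fin.
  have := @measurable_fun_fubini_tonelli_F _ _ _ _ _ mu _ mT T0.
  set G := fubini_F _ _ => mG.
  suff -> : (fun y => \int[mu]_(x in `]y, +oo[) g x)%E = G.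
    by move=> mD Y mY; exact: (mG mD Y mY).
  apply/funext => y.
  rewrite /G /fubini_F [LHS]integral_mkcond; apply: eq_integral => x _ /=.
  rewrite patchE indicE; case: (boolP (x \in _)).
    by rewrite inE/= in_itv/= andbT => yx; rewrite mem_set// mul1e.
  move=> h; rewrite memNset ?mul0e//= => yx.
  by move/negP: h; apply; rewrite inE/= in_itv/= yx.
- by move=> y _; rewrite mule_ge0 ?lee_fin ?exprn_ge0//; exact: integral_ge0.
Qed.

Lemma exponential_prob_tail (rate y : R) : 0 < rate -> 0 <= y ->
  exponential_prob rate `]y, +oo[%classic = (expR (- (rate * y)))%:E.
Proof.
move=> r0 y0; rewrite /exponential_prob.
have cE : continuous (fun z : R => expR (- rate * z)).
  move=> x; apply: (@continuous_comp _ _ _ (fun x : R => - rate * x) expR).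
    by apply: cvgMl_tmp; exact: cvg_id.
  exact: continuous_expR.
rewrite integral_itv_obnd_cbnd; last first.
  apply/measurable_EFinP; apply: measurable_funTS.
  exact: measurable_exponential_pdf.
have sub : (`[y, +oo[%classic : set R) `<=` `[0, +oo[%classic.
  by move=> z; rewrite /= !in_itv/= !andbT; exact: le_trans.
rewrite (@ge0_continuous_FTC2y _ _ (fun x => - (expR (- rate * x))) y 0).
- by rewrite sub0e -EFinN opprK mulNr.
- by move=> x _; apply: exponential_pdf_ge0; exact: ltW.
- apply: (@continuous_subspaceW R^o _ _ [set` `[0, +oo[%R] _ sub).
  exact: within_continuous_exponential_pdf.
- rewrite -oppr0; apply: cvgN.
  rewrite (_ : (fun x => expR (- rate * x)) =
               (fun z => expR (- z)) \o (fun z => rate * z)); last first.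
    by apply: eq_fun => x; rewrite mulNr.
  apply: (@cvg_comp _ _ _ _ _ _ (pinfty_nbhs R)); last exact: cvgr_expR.
  exact: gt0_cvgMry.
- by move=> x _; exact: ex_derive.
- by apply: cvgN; apply/cvg_at_right_filter; exact: cE.
- move=> x xy; apply: derive1_exponential_pdf; move: xy.
  by rewrite !in_itv/= !andbT; exact: le_lt_trans.
Qed.

Lemma exponential_moment (rate : R) (n : nat) : 0 < rate ->
  (\int[exponential_prob rate]_(x in `[0%R, +oo[) (x ^+ n)%:E =
   (n`!%:R / rate ^+ n)%:E)%E.
Proof.
move=> r0.
pose mu : probability (measurableTypeR R) R :=
  exponential_distribution_exponential_prob__canonical__probability_measure_Probability r0.
pose e k := (\int[leb]_(x in `[0%R, +oo[) ((x ^+ k)%:E * (expR (- (rate * x)))%:E))%E.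
pose K k := (\int[leb]_(x in `[0%R, +oo[) ((x ^+ k)%:E * (exponential_pdf rate x)%:E))%E.
have mpdf : measurable_fun setT (fun x => (exponential_pdf rate x)%:E).
  by apply/measurable_EFinP; exact: measurable_exponential_pdf.
have pdf0 x : (0 <= (exponential_pdf rate x)%:E)%E.
  by rewrite lee_fin exponential_pdf_ge0// ltW.
have mu0 : mu `[0, +oo[%classic = 1%E.
  have <- : mu `]0, +oo[%classic = 1%E.
    by rewrite [LHS]exponential_prob_tail// mulr0 oppr0 expR0.
  apply/esym/integral_itv_obnd_cbnd.
  exact: measurable_funTS.
have MS k : (\int[mu]_(x in `[0%R, +oo[) (x ^+ k.+1)%:E = k.+1%:R%:E * e k)%E.
  have := @weighted_layer_cake mu (cst 1%E) k (measurable_cst _) (fun=> lee01).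
  under eq_integral do rewrite mule1; move=> ->; congr (_ * _)%E.
  apply: eq_integral => y; rewrite inE/= in_itv/= andbT => y0.
  by rewrite integral_cst// mul1e [X in (_ * X)%E]exponential_prob_tail.
have KS k : (K k.+1 = k.+1%:R%:E * e k)%E.
  rewrite /K (@weighted_layer_cake leb)//; congr (_ * _)%E.
  apply: eq_integral => y; rewrite inE/= in_itv/= andbT => y0.
  by rewrite [X in (_ * X)%E]exponential_prob_tail.
have KE k : (K k = rate%:E * e k)%E.
  rewrite /e -ge0_integralZl//.
  - apply: eq_integral => x; rewrite inE/= in_itv/= andbT => x0.
    by rewrite exponential_pdfE// -!EFinM mulNr; congr EFin; ring.
  - apply: measurable_funTS; apply/measurable_EFinP; apply: measurable_funM.
      exact: exprn_measurable.
    by apply: measurableT_comp => //; apply: measurableT_comp => //; exact: mulrl_measurable.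
  - move=> x; rewrite /= in_itv/= andbT => x0.
    by rewrite -EFinM lee_fin mulr_ge0 ?expR_ge0 ?exprn_ge0.
  - by rewrite lee_fin ltW.
have K0 : K 0%N = 1%E.
  rewrite -mu0; transitivity (\int[leb]_(x in `[0%R, +oo[) (exponential_pdf rate x)%:E)%E => //.
  by apply: eq_integral => x _; rewrite expr0 mul1e.
have eE k : e k = (rate^-1%:E * K k)%E.
  by rewrite KE muleA -EFinM mulVf ?mul1e// gt_eqF.
have Kn k : (K k = (k`!%:R / rate ^+ k)%:E)%E.
  elim: k => [|k IH]; first by rewrite K0 fact0 expr0 divr1.
  rewrite KS eE IH -!EFinM factS natrM exprS; congr EFin; field.
  by rewrite expf_neq0 gt_eqF.
change (\int[mu]_(x in `[0%R, +oo[) (x ^+ n)%:E = (n`!%:R / rate ^+ n)%:E)%E.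
case: n => [|n].
  transitivity (\int[mu]_(x in `[0%R, +oo[) cst 1%E x)%E.
    by apply: eq_integral => x _; rewrite expr0.
  rewrite integral_cst//= mu0 mule1 fact0 expr0 divr1 //.
by rewrite [LHS]MS -KS Kn.
Qed.

End LayerCake.

Section IntegralScale.
Context d (T : measurableType d) (R : realType) (mu : {measure set T -> \bar R}).
Local Open Scope ereal_scope.

Lemma ge0_integralTZl (k : \bar R) (f : T -> \bar R) :
  measurable_fun setT f -> (forall x, 0 <= f x) -> 0 <= k ->
  \int[mu]_x (k * f x) = k * \int[mu]_x f x.
Proof. by move=> mf f0 k0; exact: ge0_integralZl. Qed.

End IntegralScale.

Section TailPower.
Context (R : realType).
Local Notation leb := (@lebesgue_measure R).
Local Notation TR := (measurableTypeR R).

Lemma measurable_fun_ltr_indic d (T : measurableType d) (g h : T -> R) :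
  measurable_fun setT g -> measurable_fun setT h ->
  measurable_fun setT (fun z => ((g z < h z)%R%:R : R)).
Proof.
move=> mg mh.
rewrite (_ : (fun z => _) = \1_[set z | g z < h z]); last first.
  apply/funext => z; rewrite indicE; congr (nat_of_bool _)%:R.
  by apply/idP/idP; rewrite inE.
apply: measurable_indic.
have := measurable_fun_ltr mg mh => /(_ measurableT [set true]).
by rewrite setTI; exact.
Qed.

Lemma integral_itv_oy (mu : {measure set TR -> \bar R}) (f : R -> \bar R) (u : R) :
  (\int[mu]_(s in `]u, +oo[) f s = \int[mu]_s (((u < s)%R%:R)%:E * f s))%E.
Proof.
rewrite integral_mkcond; apply: eq_integral => s _.
rewrite patchE mem_setE in_itv/= andbT.
by case: ifPn; rewrite ?mul1e ?mul0e.
Qed.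

Lemma measurable_tail d (T : measurableType d) (f : TR * T -> \bar R) :
  measurable_fun setT f -> (forall z, 0 <= f z)%E ->
  measurable_fun setT (fun z : TR * T => \int[leb]_(s in `]z.1, +oo[) f (s, z.2))%E.
Proof.
move=> mf f0.
pose F (z : (TR * T) * TR) : \bar R := (((z.1.1 < z.2)%R%:R)%:E * f (z.2, z.1.2))%E.
have mF : measurable_fun setT F.
  apply: emeasurable_funM.
    apply/measurable_EFinP; apply: measurable_fun_ltr_indic => //.
    by apply: measurableT_comp; [exact: measurable_fst|exact: measurable_fst].
  apply: measurableT_comp => //; apply: measurable_fun_pair => //.
  by apply: measurableT_comp; [exact: measurable_snd|exact: measurable_fst].
have F0 z : (0 <= F z)%E by rewrite mule_ge0// lee_fin.
have := @measurable_fun_fubini_tonelli_F _ _ _ _ _ leb F mF F0.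
apply: eq_measurable_fun => z _.
by rewrite /fubini_F integral_itv_oy.
Qed.

Lemma tail_power (f : TR -> \bar R) (m : nat) (u : R) :
  measurable_fun setT f -> (forall x, 0 <= f x)%E ->
  (m.+1%:R%:E * \int[leb]_(r in `]u, +oo[) (f r * (\int[leb]_(s in `]r, +oo[) f s) ^+ m) =
   (\int[leb]_(s in `]u, +oo[) f s) ^+ m.+1)%E.
Proof.
move=> mf f0.
set B := fun r => (\int[leb]_(s in `]r, +oo[) f s)%E.
have mB : measurable_fun setT (B : TR -> \bar R).
  have mf2 : measurable_fun setT (fun z : TR * TR => f z.1).
    by apply: measurableT_comp => //; exact: measurable_fst.
  have := measurable_tail mf2 (fun z => f0 z.1).
  by move=> /(@measurable_fun_pair1 _ _ _ _ _ _ _ (0 : R)).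
have B0 r : (0 <= B r)%E by apply: integral_ge0.
have mexp (k : nat) : measurable_fun setT (fun r : TR => B r ^+ k)%E.
  elim: k => [|k IH]; first exact: measurable_cst.
  rewrite (_ : (fun r => _) = (fun r => B r * B r ^+ k)%E); last first.
    by apply/funext => r; rewrite expeS.
  exact: emeasurable_funM.
elim: m u => [|m IH] u.
  rewrite mul1e expeS expe0 mule1 /B; apply: eq_integral => r _.
  by rewrite expe0 mule1.
pose G (z : TR * TR) : \bar R :=
  (((u < z.1)%R%:R)%:E * (((z.1 < z.2)%R%:R)%:E * (f z.1 * (f z.2 * B z.2 ^+ m))))%E.
have mG : measurable_fun setT G.
  apply: emeasurable_funM.
    by apply/measurable_EFinP; apply: measurable_fun_ltr_indic => //; exact: measurable_fst.
  apply: emeasurable_funM.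
    apply/measurable_EFinP; apply: measurable_fun_ltr_indic.
      exact: measurable_fst.
    exact: measurable_snd.
  apply: emeasurable_funM; first by apply: measurableT_comp => //; exact: measurable_fst.
  apply: (@measurableT_comp _ _ _ _ _ _ (fun r : TR => f r * B r ^+ m)%E).
    exact: emeasurable_funM.
  exact: measurable_snd.
have G0 z : (0 <= G z)%E.
  by rewrite /G !mule_ge0 ?lee_fin ?expe_ge0.
have fB0 s k : (0 <= f s * B s ^+ k)%E by rewrite mule_ge0// expe_ge0.
have mfB k : measurable_fun setT (fun r : TR => f r * B r ^+ k)%E.
  exact: emeasurable_funM.
pose K k := (\int[leb]_(r in `]u, +oo[) (f r * B r ^+ k))%E.
have K0 k : (0 <= K k)%E by apply: integral_ge0 => r _; exact: fB0.
pose J := (\int[leb]_(s in `]u, +oo[) ((\int[leb]_(r in `]u, s[) f r) * (f s * B s ^+ m)))%E.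
have KJ : K m.+1 = (m.+1%:R%:E * J)%E.
  have EF := @fubini_tonelli _ _ _ _ _ leb leb G mG G0.
  have E1 : (\int[leb]_x \int[leb]_y G (x, y) =
     \int[leb]_(r in `]u, +oo[) (f r * \int[leb]_(s in `]r, +oo[) (f s * B s ^+ m)))%E.
    rewrite integral_itv_oy; apply: eq_integral => r _.
    have mh : measurable_fun setT (fun s : TR => ((r < s)%R%:R)%:E * (f s * B s ^+ m))%E.
      apply: (@emeasurable_funM _ _ _ _ _ _ _ (mfB m)); apply/measurable_EFinP.
      exact: (@measurable_fun_ltr_indic _ TR (cst r) id (measurable_cst _) (@measurable_id _ _ _)).
    have h0 s : (0 <= ((r < s)%R%:R)%:E * (f s * B s ^+ m))%E.
      by rewrite mule_ge0// lee_fin.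
    rewrite integral_itv_oy -(ge0_integralTZl leb mh h0 (f0 r)).
    have k0 : (0 <= ((u < r)%R%:R : R)%:E)%E by rewrite lee_fin.
    rewrite -(@ge0_integralTZl _ _ _ leb ((u < r)%R%:R)%:E _ (measurable_funeM (f r) mh)
       (fun s => mule_ge0 (f0 r) (h0 s)) k0).
    by apply: eq_integral => s _; rewrite /G/=; congr (_ * _)%E; rewrite muleCA.
  have E2 : (\int[leb]_y \int[leb]_x G (x, y) = J)%E.
    rewrite /J integral_itv_oy; apply: eq_integral => s _.
    case: (ltP u s) => [us|su]; last first.
      rewrite [RHS]mul0e; apply: integral0_eq => r _; rewrite /G/=.
      case: (ltP u r) => [ur|_]; last by rewrite [LHS]mul0e.
      by rewrite ltNge (le_trans su (ltW ur))/= [X in (_ * X)%E]mul0e mule0.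
    have Hk := @ge0_integralZl _ _ _ leb `]u, s[%classic (measurable_itv _) f
       (measurable_funTS mf) _ (fun x _ => f0 x) (fB0 s m).
    rewrite [RHS]mul1e.
    rewrite [RHS]muleC.
    rewrite -[RHS]Hk.
    rewrite [RHS]integral_mkcond; apply: eq_integral => r _.
    rewrite patchE mem_setE in_itv/= /G/=.
    case: (ltP u r) => _ /=; last by rewrite [LHS]mul0e.
    rewrite [LHS]mul1e; case: (ltP r s) => _ /=; last by rewrite [LHS]mul0e.
    by rewrite [LHS]mul1e muleC.
  rewrite -(etrans (esym E1) (etrans EF E2)) /K.
  have mT : measurable_fun (`]u, +oo[%classic : set TR)
      (fun r => f r * \int[leb]_(s in `]r, +oo[) (f s * B s ^+ m))%E.
    apply: emeasurable_funM; first exact: measurable_funTS.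
    have := @measurable_tail _ TR (fun z => f z.1 * B z.1 ^+ m)%E.
    move=> /(_ (measurableT_comp (mfB m) measurable_fst) (fun z => fB0 z.1 m)).
    move=> /(@measurable_fun_pair1 _ _ _ _ _ _ _ (0 : R)).
    exact: measurable_funTS.
  have T0 r : `]u, +oo[%classic r -> (0 <= f r * \int[leb]_(s in `]r, +oo[) (f s * B s ^+ m))%E.
    by move=> _; apply: mule_ge0; [exact: f0|apply: integral_ge0 => s _; exact: fB0].
  have k0 : (0 <= (m.+1%:R : R)%:E)%E by rewrite lee_fin.
  have H2 := @ge0_integralZl _ _ _ leb `]u, +oo[%classic (measurable_itv _) _ mT _ T0 k0.
  rewrite -[RHS]H2; apply: eq_integral => r _.
  by rewrite [RHS]muleCA; congr (_ * _)%E; rewrite -(IH r).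
have split : (J + K m.+1 = B u * K m)%E.
  have mI : measurable_fun (`]u, +oo[%classic : set TR)
      (fun s => (\int[leb]_(r in `]u, s[) f r) * (f s * B s ^+ m))%E.
    apply: emeasurable_funM; last exact: measurable_funTS.
    pose F (z : TR * TR) : \bar R := (((u < z.2)%R%:R)%:E * (((z.2 < z.1)%R%:R)%:E * f z.2))%E.
    have mF : measurable_fun setT F.
      apply: emeasurable_funM.
        by apply/measurable_EFinP; apply: measurable_fun_ltr_indic => //; exact: measurable_snd.
      apply: emeasurable_funM.
        by apply/measurable_EFinP; apply: measurable_fun_ltr_indic;
          [exact: measurable_snd|exact: measurable_fst].
      by apply: measurableT_comp => //; exact: measurable_snd.
    have F0 z : (0 <= F z)%E by rewrite !mule_ge0// lee_fin.
    have := @measurable_fun_fubini_tonelli_F _ _ _ _ _ leb F mF F0.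
    move=> /(@measurable_funTS _ _ _ _ (`]u, +oo[%classic : set TR)).
    apply: eq_measurable_fun => s _.
    rewrite /fubini_F [RHS]integral_mkcond; apply: eq_integral => r _.
    rewrite patchE mem_setE in_itv/= /F/=.
    by case: ltP => _ /=; rewrite ?mul0e// mul1e; case: ltP => _ /=; rewrite ?mul0e// mul1e.
  have I0 s : `]u, +oo[%classic s ->
      (0 <= (\int[leb]_(r in `]u, s[) f r) * (f s * B s ^+ m))%E.
    by move=> _; apply: mule_ge0; [exact: integral_ge0|exact: fB0].
  have HD := @ge0_integralD _ _ _ leb `]u, +oo[%classic (measurable_itv _) _ _
    I0 mI (fun s _ => fB0 s m.+1) (measurable_funTS (mfB m.+1)).
  have HZ := @ge0_integralZl _ _ _ leb `]u, +oo[%classic (measurable_itv _) _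
    (measurable_funTS (mfB m)) _ (fun s _ => fB0 s m) (B0 u).
  rewrite -[LHS]HD -[RHS]HZ.
  apply: eq_integral => s; rewrite inE/= in_itv/= andbT => us.
  rewrite [X in (_ + f s * X)%E]expeS [X in (_ + X)%E]muleCA.
  rewrite -[LHS]ge0_muleDl; [|exact: integral_ge0|exact: B0].
  congr (_ * _)%E.
  have HB : B s = (\int[leb]_(r in `[s, +oo[) f r)%E.
    by apply: integral_itv_obnd_cbnd; exact: measurable_funTS.
  have dus : [disjoint `]u, s[%classic : set TR & `[s, +oo[%classic].
    apply/disj_setPS => r []/=; rewrite !in_itv/= andbT => /andP[_ rs] sr.
    by move: rs; rewrite ltNge sr.
  have HU := @ge0_integral_setU _ _ _ leb `]u, s[%classic `[s, +oo[%classic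
    (measurable_itv _) (measurable_itv _) f (measurable_funTS mf) (fun r _ => f0 r) dus.
  rewrite [X in (_ + X)%E]HB -[LHS]HU.
  congr (integral _ _ _); apply/seteqP; split => r /=; rewrite !in_itv/= !andbT.
    by case=> [/andP[]//|]; exact: lt_le_trans.
  by move=> ur; case: (ltP r s) => rs; [left; rewrite ur|right].
rewrite -/(K m.+1).
have -> : (m.+2%:R%:E * K m.+1 = K m.+1 + m.+1%:R%:E * K m.+1)%E.
  by rewrite -[in LHS]add1n natrD EFinD ge0_muleDl ?lee_fin// mul1e.
rewrite [X in (X + _)%E]KJ -ge0_muleDr//; last first.
  apply: integral_ge0 => s _; rewrite mule_ge0//; exact: integral_ge0.
by rewrite split muleCA /K IH [RHS]expeS.
Qed.

End TailPower.

Section MonotoneProcess.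
Context (R : realType) d (T : measurableType d).
Local Notation TR := (measurableTypeR R).
Variable h : R -> T -> R.
Hypothesis mh : forall q, 0 <= q -> measurable_fun setT (h q).
Hypothesis h_dec : forall w s t, 0 <= s -> s <= t -> h t w <= h s w.
Hypothesis h_right : forall w s c, 0 <= s -> c < h s w ->
  exists2 t, s < t & c < h t w.

Let D : set (TR * T) := [set z | 0 <= z.1].

Let mD : measurable D.
Proof.
rewrite (_ : D = fst @^-1` (`[0, +oo[%classic : set TR)); last first.
  by apply/seteqP; split => z; rewrite /D/= in_itv/= andbT.
by rewrite -[X in measurable X]setTI; apply: measurable_fst.
Qed.

(* By monotonicity and right continuity, [c < h s w] iff [c < h q w] for some
   rational [q > s], so superlevel sets are countable unions of rectangles. *)
Lemma measurable_monotone_process :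
  measurable_fun setT (fun z : TR * T => if 0 <= z.1 then h z.1 z.2 else 0).
Proof.
rewrite (_ : (fun z => _) = (fun z => h z.1 z.2) \_ D); last first.
  apply/funext => z; rewrite patchE.
  by congr (if _ then _ else _); apply/idP/idP; rewrite inE.
apply/(measurable_restrictT _ mD).
apply: (measurability _ (RGenOInfty.measurableE R)) => _ [_ [c ->] <-].
rewrite (_ : _ `&` _ = D `&` \bigcup_(q : rat)
    (if 0 <= (ratr q : R) then `]-oo, ratr q[%classic `*` [set w | c < h (ratr q) w]
     else set0)); last first.
  apply/seteqP; split => -[s w] /= [Ds]; rewrite in_itv/= ?andbT => H; split => //.
    have [t st ct] := h_right Ds H.
    have [q /itvP qst] := rat_in_itvoo st.
    have q0 : 0 <= (ratr q : R) by rewrite (le_trans Ds)// ltW// qst.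
    exists q => //; rewrite q0; split; first by rewrite /= in_itv/= qst.
    by rewrite /= (lt_le_trans ct)// h_dec// ltW// qst.
  case: H => q _; case: ifPn => // q0 []/=; rewrite in_itv/= => sq /lt_le_trans; apply.
  by rewrite h_dec// ltW.
apply: measurableI => //; apply: bigcupT_measurable_rat => q.
case: ifPn => // q0; apply: measurableX; first exact: measurable_itv.
rewrite (_ : [set w | _] = h (ratr q) @^-1` `]c, +oo[%classic); last first.
  by apply/seteqP; split => w /=; rewrite in_itv/= andbT.
by rewrite -[X in measurable X]setTI; apply: mh.
Qed.

End MonotoneProcess.

(** * Pathwise analysis of the clock *)

Section Paths.
Context (R : realType) (T : Type).
Variables (alpha : R) (xi : R -> T -> R).
Local Notation leb := (@lebesgue_measure R).
Local Notation TR := (measurableTypeR R).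
Hypothesis alpha_lt0 : alpha < 0.
Hypothesis xi0 : forall w, xi 0 w = 0.
Hypothesis xi_inc : forall w s t, 0 <= s -> s <= t -> xi s w <= xi t w.
Hypothesis xi_right : forall w t, 0 <= t -> xi r w @[r --> t^'+] --> xi t w.

Definition decay (r : R) (w : T) : R :=
  if 0 <= r then expR (alpha * xi r w) else 0.

Definition clock_integral (u : R) (w : T) : \bar R :=
  (\int[leb]_(r in `[0%R, u]) (expR (alpha * xi r w))%:E)%E.

Definition tail_integral (u : R) (w : T) : \bar R :=
  (\int[leb]_(r in `]u, +oo[) (decay r w)%:E)%E.

Local Notation A := clock_integral.
Local Notation B := tail_integral.

Lemma decay_ge0 r w : 0 <= decay r w.
Proof. by rewrite /decay; case: ifP => // _; exact: expR_ge0. Qed.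

Lemma decayE r w : 0 <= r -> decay r w = expR (alpha * xi r w).
Proof. by rewrite /decay => ->. Qed.

Lemma decay_le1 r w : decay r w <= 1.
Proof.
rewrite /decay; case: ifP => // r0.
by rewrite expR_le1 nmulr_rle0// -(xi0 w) xi_inc.
Qed.

Lemma decay_dec w s t : 0 <= s -> s <= t -> decay t w <= decay s w.
Proof.
move=> s0 st; rewrite !decayE//; last exact: le_trans st.
by rewrite ler_expR ler_nM2l// xi_inc.
Qed.

Lemma measurable_decay_path w : measurable_fun setT (fun r : TR => (decay r w)%:E).
Proof.
apply/measurable_EFinP.
rewrite (_ : (fun r => _) =
    (fun r => expR (alpha * xi (Num.max r 0) w)) \* (\1_(`[0, +oo[%classic : set R))); last first.
  apply/funext => r /=; rewrite indicE /decay.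
  case: ifPn => r0.
    by rewrite max_l// mem_set ?mulr1//= in_itv/= r0.
  by rewrite memNset ?mulr0//= in_itv/= andbT; exact/negP.
apply: measurable_funM; last by apply: measurable_indic; exact: measurable_itv.
apply: nonincreasing_measurable => // s t st.
rewrite ler_expR ler_nM2l//; apply: xi_inc; first by rewrite le_max lexx orbT.
by rewrite ge_max !le_max st lexx !orbT.
Qed.

Lemma clock_integralE u w : A u w = (\int[leb]_(r in `[0%R, u]) (decay r w)%:E)%E.
Proof.
apply: eq_integral => r; rewrite inE/= in_itv/= => /andP[r0 _].
by rewrite decayE.
Qed.

Lemma clock_integral_ge0 u w : (0 <= A u w)%E.
Proof. by apply: integral_ge0 => r _; rewrite lee_fin expR_ge0. Qed.

Lemma tail_integral_ge0 u w : (0 <= B u w)%E.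
Proof. by apply: integral_ge0 => r _; rewrite lee_fin decay_ge0. Qed.

Lemma clock_integral_le u w : 0 <= u -> (A u w <= u%:E)%E.
Proof.
move=> u0; rewrite clock_integralE.
apply: (@le_trans _ _ (\int[leb]_(r in `[0%R, u]) (cst 1%E r))%E).
  apply: ge0_le_integral => //.
  - by move=> r _; rewrite lee_fin decay_ge0.
  - by apply: measurable_funTS; exact: measurable_decay_path.
  - by move=> r _; rewrite lee_fin decay_le1.
rewrite integral_cst//= mul1e lebesgue_measure_itv/= lte_fin.
by case: ifP => _; rewrite ?oppr0 ?adde0 lee_fin.
Qed.

Lemma clock_integral_fin u w : 0 <= u -> A u w \is a fin_num.
Proof.
move=> u0; rewrite ge0_fin_numE ?clock_integral_ge0//.
by rewrite (le_lt_trans (clock_integral_le w u0))// ltry.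
Qed.

Lemma clock_integralD u v w : 0 <= u -> u <= v ->
  A v w = (A u w + \int[leb]_(r in `]u, v]) (decay r w)%:E)%E.
Proof.
move=> u0 uv; rewrite !clock_integralE.
have md := measurable_decay_path w.
have dis : [disjoint `[0, u]%classic : set TR & `]u, v]%classic].
  apply/disj_setPS => r []/=; rewrite !in_itv/= => /andP[_ ru] /andP[ur _].
  by move: ru; rewrite leNgt ur.
have d0 : forall r, ((`[0, u]%classic : set TR) `|` `]u, v]%classic) r ->
   (0 <= (decay r w)%:E)%E by move=> r _; rewrite lee_fin decay_ge0.
have := @ge0_integral_setU _ _ _ leb `[0, u]%classic `]u, v]%classic
  (measurable_itv _) (measurable_itv _) _ (measurable_funTS md) d0 dis.
move=> <-.
congr (integral _ _ _); apply/seteqP; split => r /=; rewrite !in_itv/=.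
  by move=> /andP[r0 rv]; case: (leP r u) => ru; [left; rewrite r0|right].
case=> /andP[r1 r2]; last by rewrite r2 (le_trans u0)// ltW.
by rewrite r1 (le_trans r2).
Qed.

Lemma clock_integral_tail u w : 0 <= u -> (A u w + B u w)%E = B 0 w.
Proof.
move=> u0; rewrite clock_integralE /B.
have md := measurable_decay_path w.
have dis : [disjoint `[0, u]%classic : set TR & `]u, +oo[%classic].
  apply/disj_setPS => r []/=; rewrite !in_itv/= andbT => /andP[_ ru].
  by rewrite ltNge ru.
have d0 : forall r, ((`[0, u]%classic : set TR) `|` `]u, +oo[%classic) r ->
   (0 <= (decay r w)%:E)%E by move=> r _; rewrite lee_fin decay_ge0.
have := @ge0_integral_setU _ _ _ leb `[0, u]%classic `]u, +oo[%classic
  (measurable_itv _) (measurable_itv _) _ (measurable_funTS md) d0 dis.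
move=> <-.
rewrite [RHS]integral_itv_obnd_cbnd; last exact: measurable_funTS.
congr (integral _ _ _); apply/seteqP; split => r /=; rewrite !in_itv/= ?andbT.
  by case=> [/andP[]//|ur]; rewrite (le_trans u0)// ltW.
by move=> r0; case: (leP r u) => ru; [left; rewrite r0|right].
Qed.

Lemma clock_integral_lt u v w : 0 <= u -> u < v -> (A u w < A v w)%E.
Proof.
move=> u0 uv; rewrite (clock_integralD w u0 (ltW uv)).
rewrite lteDl ?clock_integral_fin//.
apply: (@lt_le_trans _ _ (\int[leb]_(r in `]u, v]) (cst (decay v w)%:E r))%E).
  rewrite integral_cst//= lebesgue_measure_itv/= lte_fin uv -EFinD -EFinM lte_fin.
  by rewrite mulr_gt0 ?subr_gt0// decayE ?expR_gt0// (le_trans u0)// ltW.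
apply: ge0_le_integral => //.
- by move=> r _; rewrite lee_fin decay_ge0.
- by apply: measurable_funTS; exact: measurable_decay_path.
- move=> r; rewrite /= in_itv/= => /andP[ur rv].
  by rewrite lee_fin decay_dec// (le_trans u0)// ltW.
Qed.

Lemma clock_integral_lipschitz u v w : 0 <= u -> u <= v ->
  (A v w <= A u w + (v - u)%:E)%E.
Proof.
move=> u0 uv; rewrite (clock_integralD w u0 uv) leeD2lE ?clock_integral_fin//.
apply: (@le_trans _ _ (\int[leb]_(r in `]u, v]) (cst 1%E r))%E).
  apply: ge0_le_integral => //.
  - by move=> r _; rewrite lee_fin decay_ge0.
  - by apply: measurable_funTS; exact: measurable_decay_path.
  - by move=> r _; rewrite lee_fin decay_le1.
rewrite integral_cst//= mul1e lebesgue_measure_itv/= lte_fin.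
by case: ifP => _; rewrite -?EFinD ?lee_fin ?subr_ge0.
Qed.

Lemma clock_integral_mono u v w : 0 <= u -> u <= v -> (A u w <= A v w)%E.
Proof.
move=> u0; rewrite le_eqVlt => /predU1P[->//|uv].
by apply/ltW; exact: clock_integral_lt.
Qed.

Lemma clock_integral_lt_tail u w : 0 <= u -> (A u w < B 0 w)%E.
Proof.
move=> u0; have u1 : u < u + 1 by rewrite ltrDl.
apply: (lt_le_trans (clock_integral_lt w u0 u1)).
rewrite -(@clock_integral_tail (u + 1)) ?addr_ge0//.
by rewrite leeDl// tail_integral_ge0.
Qed.

Lemma clock_integral_unbounded x w : (x < B 0 w)%E ->
  exists2 u, 0 <= u & (x < A u w)%E.
Proof.
move=> xB; apply: contrapT => H.
have {}H u : 0 <= u -> (A u w <= x)%E.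
  by move=> u0; rewrite leNgt; apply/negP => xA; apply: H; exists u.
move: xB; rewrite ltNge => /negP; apply.
have md := measurable_decay_path w.
have nd : nondecreasing_seq (fun n : nat => `[0, n%:R]%classic : set TR).
  move=> m n mn; rewrite subsetEset => r /=; rewrite !in_itv/= => /andP[-> rm].
  by rewrite (le_trans rm)// ler_nat.
have cv := @ge0_nondecreasing_set_cvg_integral _ TR R (fun n : nat => `[0, n%:R]%classic)
  (fun r => (decay r w)%:E) leb nd (fun=> measurable_itv _) (fun=> measurable_funTS md)
  (fun n r _ => decay_ge0 r w).
have -> : B 0 w = (\int[leb]_(r in \bigcup_(n : nat) `[0%R, n%:R]%classic) (decay r w)%:E)%E.
  rewrite /B integral_itv_obnd_cbnd; last exact: measurable_funTS.
  congr (integral _ _ _); apply/seteqP; split => r /=; rewrite in_itv/= ?andbT.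
    move=> r0; exists (Num.truncn r).+1 => //=.
    by rewrite in_itv/= r0/=; apply/ltW/truncnS_gt.
  by case=> n _; rewrite /= in_itv/= => /andP[].
rewrite -(cvg_lim _ cv)//; apply: lime_le.
  by apply/cvg_ex; eexists; exact: cv.
by apply: nearW => n; rewrite -clock_integralE; exact: H.
Qed.

Lemma clock_integral_hit x w : 0 <= x -> (x%:E < B 0 w)%E ->
  exists r, [/\ 0 <= r, A r w = x%:E &
    forall u, 0 <= u -> (x%:E < A u w)%E = (r < u)].
Proof.
move=> x0 xB; have [U U0 xU] := clock_integral_unbounded xB.
pose a u := fine (A u w).
have aE u : 0 <= u -> (a u)%:E = A u w.
  by move=> u0; rewrite /a fineK// clock_integral_fin.
have ca : {within `[0, U], continuous a}.
  apply: parameterized_integral_continuous => //.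
  apply/integrableP; split.
    apply: (@eq_measurable_fun _ _ _ _ _ (fun r : TR => (decay r w)%:E)).
      by move=> r; rewrite inE/= in_itv/= => /andP[r0 _]; rewrite decayE.
    by apply: measurable_funTS; exact: measurable_decay_path.
  under eq_integral do rewrite /= ger0_norm ?expR_ge0//.
  by rewrite (le_lt_trans (clock_integral_le w U0))// ltry.
have a0 : a 0 = 0.
  by rewrite /a /A set_itv1 integral_set1.
have aU : x < a U by rewrite -lte_fin aE.
have [|r rU ar] := IVT U0 ca (v := x).
  rewrite a0 ge_min x0/= le_max (ltW aU) orbT //.
move: rU; rewrite in_itv/= => /andP[r0 rU].
exists r; split => //; first by rewrite -aE// ar.
move=> u u0; have -> : x%:E = A r w by rewrite -aE// ar.
apply/idP/idP => [|ru]; last exact: clock_integral_lt.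
by apply: contraTT; rewrite -!leNgt => ur; exact: clock_integral_mono.
Qed.

Lemma lamperti_clock_hit x r w : 0 <= r ->
  (forall u, 0 <= u -> (x%:E < A u w)%E = (r < u)) ->
  lamperti_clock alpha xi x w = r%:E.
Proof.
move=> r0 H; apply/eqP; rewrite eq_le; apply/andP; split.
  apply/lee_addgt0Pr => e e0.
  apply: ereal_inf_lbound; exists (r + e) => //; split.
    by rewrite addr_ge0// ltW.
  by rewrite -/(A (r + e) w) H ?ltrDl// addr_ge0// ltW.
apply: le_ereal_inf_tmp => _ [u [u0 xu] <-].
by rewrite lee_fin ltW// -H.
Qed.

Lemma lamperti_clock_infty x w : (B 0 w <= x%:E)%E ->
  lamperti_clock alpha xi x w = +oo%E.
Proof.
move=> Bx; apply/eqP; rewrite eq_le leey/=.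
apply: le_ereal_inf_tmp => _ [u [u0 xu] <-].
have := lt_le_trans (lt_trans xu (clock_integral_lt_tail w u0)) Bx.
by rewrite ltxx.
Qed.

Local Notation E x w := (exp_neg_at xi w (lamperti_clock alpha xi x w)).

Lemma exp_neg_clock_gt0 x w : 0 <= x -> (0 < E x w) = (x%:E < B 0 w)%E.
Proof.
move=> x0; case: (ltP x%:E (B 0 w)) => [xB|Bx].
  have [r [r0 _ H]] := clock_integral_hit x0 xB.
  by rewrite (lamperti_clock_hit r0 H)/= expR_gt0.
by rewrite (lamperti_clock_infty Bx)/= ltxx.
Qed.

Lemma exp_neg_clock_ge0 x w : 0 <= E x w.
Proof. by case: lamperti_clock => //= v; exact: expR_ge0. Qed.

Lemma expR_right w s (k c : R) : k < 0 -> 0 <= s -> c < expR (k * xi s w) ->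
  exists2 t, s < t & c < expR (k * xi t w).
Proof.
move=> k0 s0 cs.
have cv : expR (k * xi r w) @[r --> s^'+] --> expR (k * xi s w).
  apply: (@cvg_comp _ _ _ (fun r => k * xi r w) expR).
    by apply: cvgMl_tmp; exact: xi_right.
  exact: continuous_expR.
have H := cvgr_gt _ cv _ cs.
have /filter_ex[t [st ct]] : \forall t \near s^'+, s < t /\ c < expR (k * xi t w).
  by near=> t; split; near: t; [exact: nbhs_right_gt|exact: H].
by exists t.
Unshelve. all: by end_near. Qed.

Lemma exp_neg_clock_rational x w c : 0 <= x -> 0 <= c ->
  c < E x w <-> exists q : rat, [/\ 0 <= (ratr q : R),
    (x%:E < A (ratr q) w)%E & c < expR (- xi (ratr q) w)].
Proof.
move=> x0 c0; split.
  move=> cE; have := le_lt_trans c0 cE; rewrite exp_neg_clock_gt0// => xB.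
  have [r [r0 _ H]] := clock_integral_hit x0 xB.
  move: cE; rewrite (lamperti_clock_hit r0 H)/= -mulN1r => cE.
  have N1 : -1 < 0 :> R by rewrite oppr_lt0.
  have [t rt ct] := expR_right N1 r0 cE.
  have [q /itvP qrt] := rat_in_itvoo rt.
  have q0 : 0 <= (ratr q : R) by rewrite (le_trans r0)// ltW// qrt.
  exists q; split => //; first by rewrite H// qrt.
  rewrite (lt_le_trans ct)// mulN1r ler_expR lerN2 xi_inc//.
  by rewrite ltW// qrt.
move=> [q [q0 xA cq]].
have xB := lt_trans xA (clock_integral_lt_tail w q0).
have [r [r0 _ H]] := clock_integral_hit x0 xB.
rewrite (lamperti_clock_hit r0 H)/= (lt_le_trans cq)//.
by rewrite ler_expR lerN2 xi_inc// ltW// -H.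
Qed.

End Paths.

(** * Laplace exponent *)

Section LaplaceExponent.
Context (R : realType) (Pi : {measure set R -> \bar R}).
Hypothesis PiL : subordinator_levy_measure Pi.
Local Notation phi := (laplace_exponent Pi).
Let D : set R := `]0, +oo[%classic.
Let mD : measurable D. Proof. exact: measurable_itv. Qed.

Let mexp (l : R) : measurable_fun D (fun x => 1 - expR (- (l * x))).
Proof.
apply: measurable_funTS; apply: measurable_funB => //.
by apply: measurableT_comp => //; apply: measurableT_comp => //; exact: mulrl_measurable.
Qed.

Let exp_ge0 (l x : R) : 0 <= l -> D x -> 0 <= 1 - expR (- (l * x)).
Proof.
rewrite /D/= in_itv/= andbT => l0 x0.
by rewrite subr_ge0 expR_le1 oppr_le0 mulr_ge0// ltW.
Qed.

Let integrable_laplace (l : R) : 0 <= l ->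
  Pi.-integrable D (EFin \o (fun x => 1 - expR (- (l * x)))).
Proof.
move=> l0; have [_ fin] := PiL.
have mmin : measurable_fun D (fun x : R => (Num.min 1 x)%:E).
  by apply/measurable_EFinP; apply: measurable_funTS; exact: measurable_minr.
have imin : Pi.-integrable D (fun x : R => (Num.min 1 x)%:E).
  apply/integrableP; split => //.
  rewrite (le_lt_trans _ fin)// le_eqVlt; apply/orP; left; apply/eqP.
  apply: eq_integral => x; rewrite inE /D/= in_itv/= andbT => x0.
  by rewrite ger0_norm// le_min ler01 ltW.
have := integrableZl mD (Num.max 1 l) imin.
apply: le_integrable => //; first exact/measurable_EFinP.
move=> x Dx; move: (Dx); rewrite /D/= in_itv/= andbT => x0.
have min0 : 0 <= Num.min 1 x by rewrite le_min ler01 ltW.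
rewrite lee_fin (ger0_norm (exp_ge0 l0 Dx)) ger0_norm; last first.
  by rewrite mulr_ge0// le_max ler01.
have h1 : 1 - expR (- (l * x)) <= 1 by rewrite lerBlDr lerDl expR_ge0.
have h2 : 1 - expR (- (l * x)) <= l * x.
  by have := expR_ge1Dx (- (l * x)); lra.
case: (leP 1 x) => x1.
  by rewrite mulr1 (le_trans h1)// le_max lexx.
by rewrite (le_trans h2)//; apply: ler_wpM2r; rewrite ?(ltW x0)// le_max lexx orbT.
Qed.

Lemma laplace_exponent_gt0 (l : R) : Pi D <> 0%E -> 0 < l -> 0 < phi l.
Proof.
move=> PiD l0.
have l0' := ltW l0.
rewrite lt_neqAle Rintegral_ge0 ?andbT; last by move=> x; exact: exp_ge0.
apply/eqP => /esym phi0; apply: PiD.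
have I := integrable_laplace l0'.
have I0 : (\int[Pi]_(x in D) `| (1 - expR (- (l * x)))%:E | = 0)%E.
  transitivity (\int[Pi]_(x in D) (1 - expR (- (l * x)))%:E)%E.
    by apply: eq_integral => x; rewrite inE => Dx; rewrite /= ger0_norm ?exp_ge0.
  by rewrite -(fineK (integrable_fin_num mD I)) [fine _]phi0.
have me : measurable_fun D (fun x => (1 - expR (- (l * x)))%:E).
  by apply/measurable_EFinP; exact: mexp.
have [N [mN N0 sub]] := iffLR (ae_eq_integral_abs Pi mD me) I0.
apply/eqP; rewrite eq_le measure_ge0 andbT -N0 le_measure ?inE// => x Dx.
apply: sub => /= /(_ Dx) [] /eqP.
rewrite subr_eq0 => /eqP e1.
have : expR (- (l * x)) < 1.
  by rewrite expR_lt1 oppr_lt0 mulr_gt0//; move: Dx; rewrite /D/= in_itv/= andbT.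
by rewrite -e1 ltxx.
Qed.

Lemma laplace_exponent_mono (l k : R) : 0 <= l -> l <= k -> phi l <= phi k.
Proof.
move=> l0 lk; apply: le_Rintegral => //.
- exact: integrable_laplace.
- by apply: integrable_laplace; exact: le_trans lk.
- move=> x; rewrite /D/= in_itv/= andbT => x0.
  by rewrite lerD2l lerN2 ler_expR lerN2 ler_wpM2r// ltW.
Qed.

Lemma laplace_exponent_subadditive (n : nat) (l : R) : 0 <= l ->
  phi (n%:R * l) <= n%:R * phi l.
Proof.
move=> l0; have il := integrable_laplace l0.
rewrite /laplace_exponent -RintegralZl//; apply: le_Rintegral => //.
- by apply: integrable_laplace; rewrite mulr_ge0.
- by have := integrableZl mD n%:R il; apply: eq_integrable.
- move=> x Dx.
  rewrite -mulrA -mulrN expRM_natl.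
  set e := expR _.
  have e1 : e <= 1 by have := exp_ge0 l0 Dx; rewrite subr_ge0.
  have e0 : 0 <= e by exact: expR_ge0.
  elim: n => [|n IH]; first by rewrite expr0 subrr mul0r.
  rewrite exprS -natr1 mulrDl mul1r.
  have -> : 1 - e * e ^+ n = e * (1 - e ^+ n) + (1 - e) by ring.
  rewrite lerD2r (le_trans _ IH)// ler_piMl// subr_ge0.
  exact: exprn_ile1.
Qed.

End LaplaceExponent.

Section Independence.
Context d d1 d2 (T : measurableType d) (T1 : measurableType d1)
  (T2 : measurableType d2) (R : realType) (P : probability T R).
Variables (X : T -> T1) (Y : T -> T2).
Hypotheses (mX : measurable_fun setT X) (mY : measurable_fun setT Y).
Hypothesis XY : forall A B, measurable A -> measurable B ->
  P (X @^-1` A `&` Y @^-1` B) = (P (X @^-1` A) * P (Y @^-1` B))%E.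

Let mfX : {mfun T >-> T1} := HB.pack X (isMeasurableFun.Build _ _ _ _ X mX).
Let mfY : {mfun T >-> T2} := HB.pack Y (isMeasurableFun.Build _ _ _ _ Y mY).

Lemma integral_independent (F : T1 * T2 -> \bar R) :
  measurable_fun setT F -> (forall z, 0 <= F z)%E ->
  (\int[P]_w F (X w, Y w) = \int[P]_w \int[P]_w' F (X w, Y w'))%E.
Proof.
move=> mF F0.
have := @integral_independent_pair _ _ _ _ _ _ _ P (distribution P mfX)
  (distribution P mfY) _ _ mX mY XY F mF F0 => ->.
rewrite [LHS](ge0_integral_pushforward mX)//; last 2 first.
- by have := @measurable_fun_fubini_tonelli_F _ _ _ _ _ (distribution P mfY) F mF F0.
- by move=> x _; exact: integral_ge0.
rewrite preimage_setT; apply: eq_integral => w _ /=.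
rewrite [LHS](ge0_integral_pushforward mY)//.
exact: measurable_fun_pair2.
Qed.

End Independence.

(** * Measurability of the clock *)

Section MeasurableClock.
Context (R : realType) d (T : measurableType d) (alpha : R) (xi : R -> T -> R).
Local Notation leb := (@lebesgue_measure R).
Local Notation TR := (measurableTypeR R).
Hypothesis alpha_lt0 : alpha < 0.
Hypothesis mxi : forall t, 0 <= t -> measurable_fun setT (xi t).
Hypothesis xi_inc : forall w s t, 0 <= s -> s <= t -> xi s w <= xi t w.
Hypothesis xi_right : forall w t, 0 <= t -> xi r w @[r --> t^'+] --> xi t w.

Lemma measurable_expR_scale (k : R) t : 0 <= t ->
  measurable_fun setT (fun w => expR (k * xi t w)).
Proof.
move=> t0; apply: measurableT_comp => //.
by apply: measurable_funM => //; exact: mxi.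
Qed.

Lemma measurable_decay :
  measurable_fun setT (fun z : TR * T => (decay alpha xi z.1 z.2)%:E).
Proof.
apply/measurable_EFinP.
apply: (@measurable_monotone_process _ _ _ (fun r w => expR (alpha * xi r w))).
- by move=> q q0; exact: measurable_expR_scale.
- by move=> w s t s0 st; rewrite ler_expR ler_nM2l// xi_inc.
- by move=> w s c s0 cs; exact: (expR_right xi_right alpha_lt0 s0 cs).
Qed.

Lemma measurable_tail_integral :
  measurable_fun setT (fun z : TR * T => tail_integral alpha xi z.1 z.2).
Proof.
apply: (measurable_tail measurable_decay) => z.
by rewrite lee_fin decay_ge0.
Qed.

Lemma measurable_tail_integral1 u : measurable_fun setT (tail_integral alpha xi u).
Proof.
exact: (@measurable_fun_pair2 _ _ _ _ _ _ _ (u : TR) measurable_tail_integral).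
Qed.

Lemma measurable_clock_integral u : measurable_fun setT (clock_integral alpha xi u).
Proof.
pose F (z : T * TR) : \bar R :=
  ((\1_(`[0, u]%classic : set R) z.2)%:E * (decay alpha xi z.2 z.1)%:E)%E.
have mF : measurable_fun setT F.
  apply: emeasurable_funM.
    apply/measurable_EFinP; apply: measurableT_comp; last exact: measurable_snd.
    by apply: measurable_indic; exact: measurable_itv.
  apply: (@measurableT_comp _ _ _ _ _ _ (fun z : TR * T => (decay alpha xi z.1 z.2)%:E) _
    (fun z : T * TR => (z.2, z.1))).
    exact: measurable_decay.
  by apply: measurable_fun_pair; [exact: measurable_snd|exact: measurable_fst].
have F0 z : (0 <= F z)%E by rewrite mule_ge0// lee_fin// decay_ge0.
have := @measurable_fun_fubini_tonelli_F _ _ _ _ _ leb F mF F0.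
apply: eq_measurable_fun => w _.
rewrite /fubini_F clock_integralE [RHS]integral_mkcond; apply: eq_integral => r _.
by rewrite patchE /F/= indicE; case: ifPn; rewrite ?mul1e ?mul0e.
Qed.

End MeasurableClock.

Section Filtration.
Context (R : realType) d (T : measurableType d) (alpha : R) (xi : R -> T -> R).
Hypothesis alpha_lt0 : alpha < 0.
Hypothesis mxi : forall t, 0 <= t -> measurable_fun setT (xi t).
Hypothesis xi_inc : forall w s t, 0 <= s -> s <= t -> xi s w <= xi t w.
Hypothesis xi_right : forall w t, 0 <= t -> xi r w @[r --> t^'+] --> xi t w.

Definition past (I : set R) :=
  g_sigma_algebraType (\bigcup_(r in I) preimage_set_system setT (xi r) measurable).

Lemma measurable_past (I : set R) q : I q ->
  @measurable_fun _ _ (past I) R setT (xi q).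
Proof.
move=> Iq _ B mB; apply: sub_sigma_algebra; exists q => //.
by exists B.
Qed.

Lemma past_subset (I J : set R) (E : set T) : I `<=` J ->
  (measurable : set (set (past I))) E -> (measurable : set (set (past J))) E.
Proof.
move=> IJ.
suff : <<s \bigcup_(r in I) preimage_set_system setT (xi r) measurable >> `<=`
    (measurable : set (set (past J))) by apply.
apply: smallest_sub; first exact: sigma_algebra_measurable.
by move=> F [r Ir FE]; apply: sub_sigma_algebra; exists r => //; exact: IJ.
Qed.

Lemma past_measurable (I : set R) (E : set T) : I `<=` `[0, +oo[%classic ->
  (measurable : set (set (past I))) E -> measurable E.
Proof.
move=> I0.
suff : <<s \bigcup_(r in I) preimage_set_system setT (xi r) measurable >> `<=`
    (measurable : set (set T)) by apply.
apply: smallest_sub; first exact: sigma_algebra_measurable.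
move=> F [r /I0 + [B mB <-]]; rewrite /= in_itv/= andbT => r0.
exact: (mxi r0 measurableT mB).
Qed.

Lemma measurable_clock_past u q : 0 <= q -> q <= u ->
  @measurable_fun _ _ (past `[0, u]%classic) _ setT (clock_integral alpha xi q).
Proof.
move=> q0 qu; have u0 := le_trans q0 qu.
pose xi' r (w : past `[0, u]%classic) := xi (Num.min r u) w.
have mxi' t : 0 <= t -> measurable_fun setT (xi' t).
  move=> t0; apply: measurable_past.
  by rewrite /= in_itv/= le_min t0 u0 ge_min lexx orbT.
have inc' w s t : 0 <= s -> s <= t -> xi' s w <= xi' t w.
  move=> s0 st; apply: xi_inc; first by rewrite le_min s0.
  by rewrite le_min !ge_min st lexx !orbT.
have right' w t : 0 <= t -> xi' r w @[r --> t^'+] --> xi' t w.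
  move=> t0; case: (ltP t u) => tu.
    rewrite /xi' (min_l (ltW tu)).
    have := @xi_right w t t0; apply: cvg_trans.
    apply: near_eq_cvg; near=> r; rewrite min_l//; near: r.
    by apply: nbhs_right_le.
  rewrite /xi' (min_r tu).
  apply: cvg_near_cst; near=> r.
  by rewrite min_r// (le_trans tu)//; near: r; exact: nbhs_right_ge.
have := measurable_clock_integral alpha_lt0 mxi' inc' right' q.
apply: eq_measurable_fun => w _.
apply: eq_integral => r; rewrite inE/= in_itv/= => /andP[r0 rq].
by rewrite /xi' min_l// (le_trans rq).
Unshelve. all: by end_near. Qed.

End Filtration.

(** * Moments of the lifetime *)

Section TailMoments.
Context (R : realType) d (T : measurableType d) (P : probability T R).
Context (Pi : {measure set R -> \bar R}) (alpha : R) (xi : R -> T -> R).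
Local Notation leb := (@lebesgue_measure R).
Local Notation TR := (measurableTypeR R).
Local Notation phi := (laplace_exponent Pi).
Local Notation B := (tail_integral alpha xi).
Hypothesis alpha_lt0 : alpha < 0.
Hypothesis Pi_neq0 : Pi `]0%R, +oo[%classic <> 0%E.
Hypothesis xi_sub : driftless_subordinator P Pi xi.

Lemma subordinator_measurable t : 0 <= t -> measurable_fun setT (xi t).
Proof. by case: xi_sub => _ [[H _ _ _ _] _] _; exact: H. Qed.

Lemma subordinator0 w : xi 0 w = 0.
Proof. by case: xi_sub => _ [[_ H _ _ _] _] _; exact: H. Qed.

Lemma subordinator_inc w s t : 0 <= s -> s <= t -> xi s w <= xi t w.
Proof. by case: xi_sub => _ [_ H] _; exact: H. Qed.

Lemma subordinator_right w t : 0 <= t -> xi r w @[r --> t^'+] --> xi t w.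
Proof. by case: xi_sub => _ [[_ _ cad _ _] _] _; have [H _] := cad w; exact: H. Qed.

Let mxi := subordinator_measurable.
Let xi0 := subordinator0.
Let xi_inc := subordinator_inc.
Let xi_right := subordinator_right.

Let past0 u : 0 <= u -> `[0, u]%classic `<=` (`[0, +oo[%classic : set R).
Proof. by move=> u0 r; rewrite /= !in_itv/= andbT => /andP[]. Qed.

Lemma measurable_of_past d' (T' : measurableType d') u (Z : T -> T') : 0 <= u ->
  @measurable_fun _ _ (past xi `[0, u]%classic) T' setT Z -> measurable_fun setT Z.
Proof.
move=> u0 mZ _ A mA.
exact: (past_measurable mxi (past0 u0) (mZ measurableT A mA)).
Qed.

Lemma increment_expectation u r k (Z : T -> \bar R) : 0 <= u -> u <= r -> 0 <= k ->
  @measurable_fun _ _ (past xi `[0, u]%classic) _ setT Z -> (forall w, 0 <= Z w)%E ->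
  (\int[P]_w (Z w * (expR (- (k * (xi r w - xi u w))))%:E) =
   (\int[P]_w Z w) * (expR (- ((r - u) * phi k)))%:E)%E.
Proof.
move=> u0 ur k0 mZ Z0; have r0 := le_trans u0 ur.
have mZT := measurable_of_past u0 mZ.
pose Y w := xi r w - xi u w.
have mY : measurable_fun setT Y by apply: measurable_funB; exact: mxi.
have XY A C : measurable A -> measurable C ->
    P (Z @^-1` A `&` Y @^-1` C) = (P (Z @^-1` A) * P (Y @^-1` C))%E.
  move=> mA mC; case: xi_sub => _ [[_ _ _ _ ind] _] _.
  rewrite setIC muleC; apply: (ind u r u0 ur).
    by exists C => //; rewrite setTI.
  have := mZ measurableT _ mA; rewrite setTI; exact.
pose e (y : R) : \bar R := (expR (- (k * y)))%:E.
have me : measurable_fun setT e.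
  apply/measurable_EFinP; apply: measurableT_comp => //.
  by apply: measurableT_comp => //; exact: mulrl_measurable.
have e0 y : (0 <= e y)%E by rewrite lee_fin expR_ge0.
pose F (z : \bar R * R) : \bar R := (`|z.1| * e z.2)%E.
have mF : measurable_fun setT F.
  apply: emeasurable_funM.
    by apply: measurableT_comp; [exact: abse_measurable|exact: measurable_fst].
  by apply: measurableT_comp => //; exact: measurable_snd.
have F0 z : (0 <= F z)%E by rewrite mule_ge0// abse_ge0.
transitivity (\int[P]_w F (Z w, Y w))%E.
  by apply: eq_integral => w _; rewrite /F/= gee0_abs.
rewrite (integral_independent mZT mY XY mF F0).
have eY : (\int[P]_w e (Y w) = (expR (- ((r - u) * phi k)))%:E)%E.
  have ru0 : 0 <= r - u by rewrite subr_ge0.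
  case: xi_sub => _ [[_ _ _ stat _] _] /(_ k (r - u) k0 ru0) <-.
  rewrite -(ge0_integral_pushforward mY P measurableT me (fun y _ => e0 y)).
  rewrite -(ge0_integral_pushforward (mxi ru0) P measurableT me (fun y _ => e0 y)).
  apply: (@eq_measure_integral _ _ _ _ (image_measure P (mxi ru0)) (image_measure P mY)).
  move=> A mA _; exact: stat.
transitivity (\int[P]_w (Z w * (expR (- ((r - u) * phi k)))%:E))%E.
  apply: eq_integral => w _; rewrite /F/= gee0_abs//.
  rewrite ge0_integralTZl//; last exact: measurableT_comp.
  by rewrite eY.
by rewrite ge0_integralZr// lee_fin expR_ge0.
Qed.

Definition clock_moment (m : nat) : R :=
  m`!%:R / \prod_(1 <= k < m.+1) phi (k%:R * `|alpha|).

Lemma phi_gt0 k : 0 < phi (k.+1%:R * `|alpha|).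
Proof.
case: xi_sub => PiL _ _; apply: (laplace_exponent_gt0 PiL Pi_neq0).
by rewrite mulr_gt0// normr_gt0 lt_eqF.
Qed.

Lemma clock_momentS m :
  clock_moment m.+1 = m.+1%:R * clock_moment m / phi (m.+1%:R * `|alpha|).
Proof.
rewrite /clock_moment big_nat_recr//= factS natrM invfM.
by rewrite [X in _ * X]mulrC; ring.
Qed.

Let measurable_expe d' (T' : measurableType d') (g : T' -> \bar R) n :
  measurable_fun setT g -> measurable_fun setT (fun w => g w ^+ n)%E.
Proof.
move=> mg; elim: n => [|n IH]; first exact: measurable_cst.
rewrite (_ : (fun w => _) = (fun w => g w * g w ^+ n)%E); last first.
  by apply/funext => w; rewrite expeS.
exact: emeasurable_funM.
Qed.

Let exponential_tail_integral (p u : R) : 0 < p -> 0 <= u ->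
  (\int[leb]_(r in `]u, +oo[) (expR (- ((r - u) * p)))%:E = (p^-1)%:E)%E.
Proof.
move=> p0 u0.
transitivity (\int[leb]_(r in `]u, +oo[)
    ((expR (u * p) / p)%:E * (exponential_pdf p r)%:E))%E.
  apply: eq_integral => r; rewrite inE/= in_itv/= andbT => ur.
  rewrite exponential_pdfE; last by rewrite ltW// (le_lt_trans u0).
  rewrite -EFinM; congr EFin.
  have -> : - ((r - u) * p) = u * p + (- p * r) by ring.
  by rewrite expRD; field; rewrite gt_eqF.
rewrite ge0_integralZl//.
- rewrite -[X in (_ * X)%E]/(exponential_prob p _) exponential_prob_tail//.
  rewrite -EFinM mulrAC -expRD mulrC [p * u]mulrC subrr expR0 mulr1 //.
- apply: measurable_funTS; apply/measurable_EFinP; exact: measurable_exponential_pdf.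
- by move=> r _; rewrite lee_fin exponential_pdf_ge0// ltW.
- by rewrite lee_fin divr_ge0 ?expR_ge0// ltW.
Qed.

(* Writing [B_u ^ (m+1)] as the integral of [(m+1) f_r B_r ^ m] over [r > u],
   only the independence of the single increment [xi_r - xi_u] from the past of
   [u] is used. *)
Lemma tail_moment m u (Z : T -> \bar R) : 0 <= u ->
  @measurable_fun _ _ (past xi `[0, u]%classic) _ setT Z -> (forall w, 0 <= Z w)%E ->
  (\int[P]_w (Z w * B u w ^+ m) =
   (clock_moment m)%:E * \int[P]_w (Z w * (expR (m%:R * (alpha * xi u w)))%:E))%E.
Proof.
elim: m u Z => [|m IH] u Z u0 mZ Z0.
  rewrite /clock_moment big_geq// fact0 divr1 mul1e.
  by apply: eq_integral => w _; rewrite expe0 mul0r expR0.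
have mZT := measurable_of_past u0 mZ.
have mdec := measurable_decay alpha_lt0 mxi xi_inc xi_right.
have mtail := measurable_tail_integral alpha_lt0 mxi xi_inc xi_right.
have dec0 r w : (0 <= (decay alpha xi r w)%:E)%E by rewrite lee_fin decay_ge0.
have B0 r w : (0 <= B r w)%E by exact: tail_integral_ge0.
pose G (z : T * TR) : \bar R := (((u < z.2)%R%:R)%:E *
  (Z z.1 * ((decay alpha xi z.2 z.1)%:E * B z.2 z.1 ^+ m)))%E.
have mswap : measurable_fun setT (fun z : T * TR => (z.2, z.1)).
  by apply: measurable_fun_pair; [exact: measurable_snd|exact: measurable_fst].
have mdB : measurable_fun setT (fun z : TR * T =>
    (decay alpha xi z.1 z.2)%:E * B z.1 z.2 ^+ m)%E.
  apply: emeasurable_funM => //; exact: measurable_expe.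
have mG : measurable_fun setT G.
  apply: emeasurable_funM.
    apply/measurable_EFinP.
    exact: (@measurable_fun_ltr_indic _ _ _ (cst u) snd (measurable_cst _) measurable_snd).
  apply: emeasurable_funM; first by apply: measurableT_comp => //; exact: measurable_fst.
  exact: (measurableT_comp mdB mswap).
have db0 r w : (0 <= (decay alpha xi r w)%:E * B r w ^+ m)%E.
  by apply: mule_ge0 => //; exact: expe_ge0.
have G0 z : (0 <= G z)%E.
  by apply: mule_ge0; [rewrite lee_fin|apply: mule_ge0].
have step1 w : (Z w * B u w ^+ m.+1 = m.+1%:R%:E * \int[leb]_r G (w, r))%E.
  have mdw : measurable_fun setT (fun r : TR => (decay alpha xi r w)%:E).
    exact: (@measurable_fun_pair1 _ _ _ _ _ _ _ w mdec).
  rewrite -(tail_power m u mdw (fun r => dec0 r w)).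
  rewrite muleCA; congr (_ * _)%E.
  have mi : measurable_fun (`]u, +oo[%classic : set TR)
      (fun r => (decay alpha xi r w)%:E * B r w ^+ m)%E.
    apply: measurable_funTS.
    exact: (@measurable_fun_pair1 _ _ _ _ _ _ _ w mdB).
  have H := @ge0_integralZl _ _ _ leb `]u, +oo[%classic (measurable_itv _) _ mi _
    (fun r _ => db0 r w) (Z0 w).
  rewrite -[LHS]H (integral_itv_oy leb); exact: eq_integral.
have mIG : measurable_fun setT (fun w => \int[leb]_r G (w, r))%E.
  exact: (@measurable_fun_fubini_tonelli_F _ _ _ _ _ leb G mG G0).
transitivity (m.+1%:R%:E * \int[P]_w \int[leb]_r G (w, r))%E.
  rewrite -ge0_integralTZl//; last by move=> w; exact: integral_ge0.
  by apply: eq_integral => w _; exact: step1.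
rewrite (@fubini_tonelli _ _ _ _ _ P leb G mG G0).
set Ez := (\int[P]_w (Z w * (expR (m.+1%:R * (alpha * xi u w)))%:E))%E.
have Ez0 : (0 <= Ez)%E.
  by apply: integral_ge0 => w _; rewrite mule_ge0// lee_fin expR_ge0.
set p := phi (m.+1%:R * `|alpha|).
have p0 : 0 < p by exact: phi_gt0.
have cm0 : 0 <= clock_moment m.
  rewrite /clock_moment divr_ge0//; apply: prodr_ge0 => i _.
  apply: Rintegral_ge0 => x; rewrite /= in_itv/= andbT => x0.
  by rewrite subr_ge0 expR_le1 oppr_le0 !mulr_ge0// ltW.
have step2 r : u < r -> (\int[P]_w (Z w * ((decay alpha xi r w)%:E * B r w ^+ m)) =
    (clock_moment m)%:E * (Ez * (expR (- ((r - u) * p)))%:E))%E.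
  move=> ur; have r0 : 0 <= r by rewrite (le_trans u0)// ltW.
  have mono E : (measurable : set (set (past xi `[0, u]%classic))) E ->
      (measurable : set (set (past xi `[0, r]%classic))) E.
    apply: past_subset => s; rewrite /= !in_itv/= => /andP[-> su].
    by rewrite (le_trans su)// ltW.
  have mZr : @measurable_fun _ _ (past xi `[0, r]%classic) _ setT
      (fun w => Z w * (expR (alpha * xi r w))%:E)%E.
    apply: emeasurable_funM.
      by move=> _ A mA; apply: mono; exact: mZ.
    apply/measurable_EFinP; apply: measurableT_comp => //.
    apply: measurable_funM => //; apply: measurable_past.
    by rewrite /= in_itv/= r0/=.
  have Zr0 w : (0 <= Z w * (expR (alpha * xi r w))%:E)%E.
    by rewrite mule_ge0// lee_fin expR_ge0.
  transitivity (\int[P]_w ((Z w * (expR (alpha * xi r w))%:E) * B r w ^+ m))%E.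
    by apply: eq_integral => w _; rewrite decayE// muleA.
  rewrite (IH r _ r0 mZr Zr0); congr (_ * _)%E.
  have mZu : @measurable_fun _ _ (past xi `[0, u]%classic) _ setT
      (fun w => Z w * (expR (m.+1%:R * (alpha * xi u w)))%:E)%E.
    apply: emeasurable_funM => //.
    apply/measurable_EFinP; apply: measurableT_comp => //.
    apply: measurable_funM => //; apply: measurable_funM => //; apply: measurable_past.
    by rewrite /= in_itv/= u0/=.
  have Zu0 w : (0 <= Z w * (expR (m.+1%:R * (alpha * xi u w)))%:E)%E.
    by rewrite mule_ge0// lee_fin expR_ge0.
  have k0 : 0 <= m.+1%:R * `|alpha| by rewrite mulr_ge0.
  rewrite -(increment_expectation u0 (ltW ur) k0 mZu Zu0).
  apply: eq_integral => w _; rewrite -!muleA; congr (_ * _)%E.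
  rewrite -!EFinM -!expRD; congr (expR _)%:E.
  rewrite ltr0_norm// -natr1; ring.
transitivity (m.+1%:R%:E * \int[leb]_(r in `]u, +oo[)
    (((clock_moment m)%:E * Ez) * (expR (- ((r - u) * p)))%:E))%E.
  congr (_ * _)%E; rewrite [RHS]integral_mkcond; apply: eq_integral => r _.
  rewrite patchE mem_setE in_itv/= andbT.
  case: (ltP u r) => ur.
    rewrite -muleA -(step2 r ur); apply: eq_integral => w _.
    by rewrite /G/= ur mul1e.
  by apply: integral0_eq => w _; rewrite /G/= ltNge ur/= mul0e.
have me : measurable_fun (`]u, +oo[%classic : set TR) (fun r => (expR (- ((r - u) * p)))%:E).
  apply: measurable_funTS; apply/measurable_EFinP; apply: measurableT_comp => //.
  apply: measurableT_comp => //; apply: measurable_funM => //.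
  exact: measurable_funB.
have e0 r : `]u, +oo[%classic r -> (0 <= (expR (- ((r - u) * p)))%:E)%E.
  by move=> _; rewrite lee_fin expR_ge0.
have cE0 : (0 <= (clock_moment m)%:E * Ez)%E by rewrite mule_ge0// lee_fin.
rewrite (@ge0_integralZl _ _ _ leb `]u, +oo[%classic (measurable_itv _) _ me _ e0 cE0).
rewrite exponential_tail_integral// clock_momentS -/p.
rewrite [X in (_ * X)%E]muleAC [LHS]muleA; congr (_ * _)%E.
by rewrite -!EFinM; congr EFin; ring.
Qed.

End TailMoments.

Section StoppedMoments.
Context (R : realType) d (T : measurableType d) (P : probability T R).
Context (Pi : {measure set R -> \bar R}) (alpha : R) (xi : R -> T -> R).
Local Notation leb := (@lebesgue_measure R).
Local Notation TR := (measurableTypeR R).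
Local Notation phi := (laplace_exponent Pi).
Local Notation A := (clock_integral alpha xi).
Local Notation B := (tail_integral alpha xi).
Local Notation c := (clock_moment Pi alpha).
Hypothesis alpha_lt0 : alpha < 0.
Hypothesis Pi_neq0 : Pi `]0%R, +oo[%classic <> 0%E.
Hypothesis xi_sub : driftless_subordinator P Pi xi.

Let mxi := subordinator_measurable xi_sub.
Let xi0 := subordinator0 xi_sub.
Let xi_inc := subordinator_inc xi_sub.
Let xi_right := subordinator_right xi_sub.
Let phi_gt0 := phi_gt0 alpha_lt0 Pi_neq0 xi_sub.
Let A_fin u w : 0 <= u -> A u w \is a fin_num.
Proof. exact: (clock_integral_fin alpha_lt0 xi0 xi_inc). Qed.
Let AB u w : 0 <= u -> (A u w + B u w)%E = B 0 w.
Proof. exact: (clock_integral_tail alpha_lt0 xi_inc). Qed.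
Let B_ge0 u w : (0 <= B u w)%E.
Proof. exact: tail_integral_ge0. Qed.
Let mB u : measurable_fun setT (B u).
Proof. exact: (measurable_tail_integral1 alpha_lt0 mxi xi_inc xi_right). Qed.

Lemma prod_phi_gt0 m : 0 < \prod_(1 <= k < m.+1) phi (k%:R * `|alpha|).
Proof.
rewrite big_add1/= big_mkord; apply: prodr_gt0 => i _; exact: phi_gt0.
Qed.

Lemma clock_moment_ge0 m : 0 <= c m.
Proof. by rewrite /clock_moment divr_ge0// ltW// prod_phi_gt0. Qed.

Lemma clock_moment_le m : c m <= 1 * (phi `|alpha|)^-1 ^+ m * m`!%:R.
Proof.
have p0 : 0 < phi `|alpha| by have := phi_gt0 0; rewrite mul1r.
rewrite mul1r mulrC /clock_moment ler_wpM2l// exprVn.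
rewrite lef_pV2 ?posrE ?prod_phi_gt0 ?exprn_gt0//.
rewrite big_add1/= big_mkord -[X in _ ^+ X]card_ord -prodr_const.
apply: ler_prod => i _; apply/andP; split; first exact/ltW.
case: xi_sub => PiL _ _; apply: laplace_exponent_mono => //.
by rewrite -[leLHS]mul1r ler_wpM2r// ler1n.
Qed.

Lemma tail_moment0 m : (\int[P]_w (B 0 w ^+ m) = (c m)%:E)%E.
Proof.
have := tail_moment alpha_lt0 Pi_neq0 xi_sub m (lexx 0)
  (measurable_cst (1 : \bar R)%E) (fun=> lee01).
under eq_integral do rewrite mul1e.
move=> ->; rewrite -[RHS]mule1; congr (_ * _)%E.
transitivity (\int[P]_w cst 1%E w)%E.
  by apply: eq_integral => w _; rewrite xi0 !mulr0 expR0 mul1e.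
by rewrite integral_cst//= probability_setT mule1.
Qed.

Lemma tail_integral_finite : {ae P, forall w, B 0 w \is a fin_num}.
Proof.
have i1 : P.-integrable setT (B 0).
  apply/integrableP; split => //.
  under eq_integral do rewrite gee0_abs//.
  by rewrite [ltLHS](tail_moment0 1) ltry.
have := integrable_ae measurableT i1.
by apply: filterS => w; exact.
Qed.

Definition lifetime (w : T) : R := fine (B 0 w).
Local Notation J := lifetime.
Let b u w := fine (B u w).

Lemma measurable_lifetime : measurable_fun setT J.
Proof. exact: measurableT_comp (@fine_measurable _ _ measurableT) (mB 0). Qed.

Lemma lifetime_ge0 w : 0 <= J w.
Proof. exact: fine_ge0. Qed.

Lemma lifetime_moment m : (\int[P]_w (J w ^+ m)%:E = (c m)%:E)%E.
Proof.
rewrite -tail_moment0; apply: ge0_ae_eq_integral => //.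
- by apply/measurable_EFinP; apply: measurable_funX; exact: measurable_lifetime.
- elim: m => [|m IH]; first exact: measurable_cst.
  rewrite (_ : (fun w => _) = (fun w => B 0 w * B 0 w ^+ m)%E); last first.
    by apply/funext => w; rewrite expeS.
  exact: emeasurable_funM.
- by move=> w _; rewrite lee_fin exprn_ge0// lifetime_ge0.
- by move=> w _; rewrite expe_ge0.
have := tail_integral_finite; apply: filterS => w fin _.
by rewrite EFin_expe /lifetime fineK.
Qed.

Let mb u : measurable_fun setT (b u).
Proof. exact: measurableT_comp (@fine_measurable _ _ measurableT) (mB u). Qed.

Let b_ge0 u w : 0 <= b u w. Proof. exact: fine_ge0. Qed.

Let bE u w : 0 <= u -> B 0 w \is a fin_num ->
  B u w = (b u w)%:E /\ b u w = J w - fine (A u w).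
Proof.
move=> u0 fin; have := AB w u0 => AB0.
have Af := A_fin w u0.
have Bf : B u w \is a fin_num.
  by move: fin; rewrite -AB0 fin_numD => /andP[].
split; first by rewrite /b fineK.
have -> : J w = fine (A u w) + b u w by rewrite /lifetime -AB0; exact: fineD.
by rewrite addrAC subrr add0r.
Qed.

Let b_le u w : 0 <= u -> b u w <= J w.
Proof.
move=> u0; have [fin|inf] := boolP (B 0 w \is a fin_num).
  have [_ ->] := bE u0 fin; rewrite lerBlDr lerDl.
  by apply: fine_ge0; exact: clock_integral_ge0.
suff -> : b u w = 0 by exact: lifetime_ge0.
have Af := A_fin w u0.
have : B u w \isn't a fin_num by move: inf; rewrite -(AB w u0) fin_numD Af.
by rewrite /b ge0_fin_numE// -leNgt leye_eq => /eqP ->.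
Qed.

Let tail_moment_real m u (D : set T) : 0 <= u ->
  (measurable : set (set (past xi `[0, u]%classic))) D ->
  (\int[P]_w ((\1_D w * b u w ^+ m)%:E) =
   (c m)%:E * \int[P]_w (\1_D w * expR (m%:R * (alpha * xi u w)))%:E)%E.
Proof.
move=> u0 mD.
have mDT : measurable D.
  apply: (past_measurable mxi _ mD).
  by move=> r; rewrite /= !in_itv/= andbT => /andP[].
have := @tail_moment _ _ _ P Pi alpha xi alpha_lt0 Pi_neq0 xi_sub m u
  (fun w => (\1_D w)%:E) u0.
have mD1 : @measurable_fun _ _ (past xi `[0, u]%classic) _ setT
    (fun w => (\1_D w)%:E : \bar R).
  by apply/measurable_EFinP; exact: measurable_indic.
move=> /(_ mD1 (fun w => _)) H.
have {}H := H (fun w => ler0n R _).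
transitivity (\int[P]_w ((\1_D w)%:E * B u w ^+ m))%E; last first.
  by rewrite H; congr (_ * _)%E; apply: eq_integral => w _; rewrite EFinM.
apply: ge0_ae_eq_integral => //.
- apply/measurable_EFinP; apply: measurable_funM; first exact: measurable_indic.
  exact: measurable_funX.
- apply: emeasurable_funM; first by apply/measurable_EFinP; exact: measurable_indic.
  elim: m {H} => [|m IH]; first exact: measurable_cst.
  rewrite (_ : (fun w => _) = (fun w => B u w * B u w ^+ m)%E); last first.
    by apply/funext => w; rewrite expeS.
  exact: emeasurable_funM.
- by move=> w _; rewrite lee_fin mulr_ge0// exprn_ge0.
- by move=> w _; rewrite mule_ge0 ?lee_fin// expe_ge0.
have := tail_integral_finite; apply: filterS => w fin _.
by have [-> _] := bE u0 fin; rewrite -EFin_expe -EFinM.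
Qed.

Lemma measurable_stopped : measurable_fun setT (fun z : R * T =>
  exp_neg_at xi z.2 (lamperti_clock alpha xi (Num.max z.1 0) z.2)).
Proof.
pose E (z : R * T) := exp_neg_at xi z.2 (lamperti_clock alpha xi (Num.max z.1 0) z.2).
apply: (measurability _ (RGenOInfty.measurableE R)) => _ [_ [k ->] <-].
rewrite setTI.
have [k0|k0] := ltP k 0.
  rewrite (_ : _ @^-1` _ = setT)//; apply/seteqP; split => // z _ /=.
  by rewrite in_itv/= andbT (lt_le_trans k0)// exp_neg_clock_ge0.
rewrite (_ : _ @^-1` _ = \bigcup_(q : rat) (if 0 <= (ratr q : R) then
    [set z : R * T | Num.max z.1 0 < fine (A (ratr q) z.2)] `&`
    [set z : R * T | k < expR (- xi (ratr q) z.2)] else set0)); last first.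
  have z0 (z : R * T) : 0 <= Num.max z.1 0 by rewrite le_max lexx orbT.
  apply/seteqP; split => z /=; rewrite in_itv/= andbT.
    move=> /(exp_neg_clock_rational alpha_lt0 xi0 xi_inc xi_right z.2 (z0 z) k0).
    move=> [q [q0 qA kq]]; exists q => //; rewrite q0; split => //=.
    by rewrite -lte_fin fineK// A_fin.
  move=> [q _]; case: ifPn => // q0 [/= qA kq].
  apply/(exp_neg_clock_rational alpha_lt0 xi0 xi_inc xi_right z.2 (z0 z) k0).
  exists q; split => //.
  by move: qA; rewrite -lte_fin fineK// A_fin.
apply: bigcupT_measurable_rat => q; case: ifPn => // q0.
have ltm (g h : R * T -> R) : measurable_fun setT g -> measurable_fun setT h ->
    measurable [set z | g z < h z].
  move=> mg mh; have := measurable_fun_ltr mg mh => /(_ measurableT [set true]).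
  by rewrite setTI; exact.
apply: measurableI; apply: ltm.
- by apply: measurable_maxr => //; exact: measurable_fst.
- apply: measurableT_comp; first exact: fine_measurable.
  apply: measurableT_comp; last exact: measurable_snd.
  exact: (measurable_clock_integral alpha_lt0 mxi xi_inc xi_right).
- exact: measurable_cst.
- apply: measurableT_comp => //; apply: measurableT_comp => //.
  by apply: measurableT_comp; [exact: mxi|exact: measurable_snd].
Qed.

Section Discretization.
Variable x : R.
Hypothesis x_ge0 : 0 <= x.

Let delta N : R := (N.+1%:R)^-1.
Let q N k : R := k%:R * delta N.
Let D N k : set T :=
  [set w | (A (q N k) w <= x%:E)%E] `&` [set w | (x%:E < A (q N k.+1) w)%E].

Let delta_gt0 N : 0 < delta N. Proof. by rewrite invr_gt0. Qed.

Let q_ge0 N k : 0 <= q N k. Proof. by rewrite mulr_ge0// ltW. Qed.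

Let mD N k : (measurable : set (set (past xi `[0, q N k.+1]%classic))) (D N k).
Proof.
have mA r : 0 <= r -> r <= q N k.+1 ->
    @measurable_fun _ _ (past xi `[0, q N k.+1]%classic) _ setT (A r).
  exact: measurable_clock_past.
have qq : q N k <= q N k.+1 by rewrite ler_wpM2r ?(ltW (delta_gt0 _))// ler_nat.
apply: measurableI.
  have := mA _ (q_ge0 N k) qq measurableT `]-oo, x%:E]%classic (emeasurable_itv _).
  rewrite setTI (_ : _ @^-1` _ = [set w | (A (q N k) w <= x%:E)%E])//.
have := mA _ (q_ge0 N k.+1) (lexx _) measurableT `]x%:E, +oo[%classic (emeasurable_itv _).
rewrite setTI (_ : _ @^-1` _ = [set w | (x%:E < A (q N k.+1) w)%E])//.
by apply/seteqP; split => w /=; rewrite in_itv/= andbT.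
Qed.

Let mDT N k : measurable (D N k).
Proof.
have sub : `[0, q N k.+1]%classic `<=` (`[0, +oo[%classic : set R).
  by move=> r; rewrite /= !in_itv/= andbT => /andP[].
exact: (past_measurable mxi sub (mD (k := k))).
Qed.

(* The value of [g] at the first grid point after the clock reaches [x]. *)
Let disc (g : R -> T -> R) N w : R :=
  \sum_(0 <= k < N.+1 * N.+1) \1_(D N k) w * g (q N k.+1) w.

Let disc_hit (g : R -> T -> R) N w r : 0 <= r -> (forall u, 0 <= u -> (x%:E < A u w)%E = (r < u)) ->
  let k0 := Num.truncn (r * N.+1%:R) in
  disc g N w = if (k0 < N.+1 * N.+1)%N then g (q N k0.+1) w else 0.
Proof.
move=> r0 H k0.
have N0 : 0 < N.+1%:R :> R by [].
have DE k : \1_(D N k) w = (k == k0)%:R :> R.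
  rewrite indicE; congr (nat_of_bool _)%:R.
  have rN0 : 0 <= r * N.+1%:R by rewrite mulr_ge0.
  apply/idP/idP => [|/eqP ->]; rewrite inE /D/=.
    move=> []; rewrite leNgt !H//.
    rewrite -leNgt /q /delta ler_pdivrMr// ltr_pdivlMr// => h1 h2.
    by rewrite eq_sym; apply/eqP; apply: truncn_def; rewrite h1.
  rewrite leNgt !H// -leNgt /q /delta ler_pdivrMr// ltr_pdivlMr//.
  by split; [rewrite truncn_le|exact: truncnS_gt].
rewrite /disc; under eq_bigr do rewrite DE.
rewrite big_mkord; case: ifPn => h.
  rewrite (bigD1 (Ordinal h))//= eqxx mul1r big1 ?addr0// => i ik.
  by rewrite (_ : (i == k0 :> nat) = false) ?mul0r//; apply/negbTE.
rewrite big1// => i _; rewrite (_ : (i == k0 :> nat) = false) ?mul0r//.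
by apply/negbTE; apply: contra h => /eqP <-.
Qed.

Let disc_miss (g : R -> T -> R) N w : (B 0 w <= x%:E)%E -> disc g N w = 0.
Proof.
move=> Bx; rewrite /disc big1// => k _.
rewrite indicE memNset ?mul0r// => -[_ /= xA].
have := clock_integral_lt_tail alpha_lt0 xi0 xi_inc w (q_ge0 N k.+1).
by rewrite ltNge (le_trans Bx)// ltW.
Qed.

Let disc_bound (g : R -> T -> R) N w M : 0 <= M -> (forall u, 0 <= u -> 0 <= g u w <= M) ->
  0 <= disc g N w <= M.
Proof.
move=> M0 gM; have [xB|Bx] := ltP x%:E (B 0 w); last by rewrite disc_miss// lexx.
have [r [r0 _ H]] := clock_integral_hit alpha_lt0 xi0 xi_inc x_ge0 xB.
by rewrite (disc_hit g N r0 H); case: ifP => _; [exact: gM|rewrite lexx].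
Qed.

Let disc_cvg (g : R -> T -> R) w r : 0 <= r -> (forall u, 0 <= u -> (x%:E < A u w)%E = (r < u)) ->
  g u w @[u --> r^'+] --> g r w -> disc g N w @[N --> \oo] --> g r w.
Proof.
move=> r0 H gr.
pose k0 N := Num.truncn (r * N.+1%:R).
have rk N : r < q N (k0 N).+1.
  by rewrite /q /delta ltr_pdivlMr//; exact: truncnS_gt.
have kr N : q N (k0 N).+1 <= r + delta N.
  rewrite /q -natr1 mulrDl mul1r lerD2r /delta ler_pdivrMr// truncn_le.
  by rewrite mulr_ge0.
have cq : q N (k0 N).+1 @[N --> \oo] --> r.
  apply: (@squeeze_cvgr _ _ _ _ (cst r) (fun N => r + delta N)).
  - by apply: nearW => N; rewrite (ltW (rk N)) kr.
  - exact: cvg_cst.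
  - rewrite -[X in _ --> X]addr0; apply: cvgD; first exact: cvg_cst.
    exact: cvg_harmonic.
have := iffLR (cvg_at_rightP _ _ _) gr _ (conj rk cq).
apply: cvg_trans; apply: near_eq_cvg; near=> N.
rewrite (disc_hit g N r0 H) -/(k0 N) ifT// /k0.
rewrite -(ltr_nat R) (le_lt_trans (_ : _ <= r * N.+1%:R))//.
  by rewrite truncn_le mulr_ge0.
rewrite natrM ltr_pM2r// (@le_lt_trans _ _ N%:R)// ?ltr_nat//.
by near: N; exact: nbhs_infty_ger.
Unshelve. all: by end_near. Qed.

Let mdisc (g : R -> T -> R) N : (forall u, 0 <= u -> measurable_fun setT (g u)) ->
  measurable_fun setT (disc g N).
Proof.
move=> mg; rewrite /disc; apply: measurable_sum => k.
apply: measurable_funM; last exact: mg.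
by apply: measurable_indic; exact: mDT.
Qed.

Let disc_moment m N :
  (\int[P]_w (disc (fun u w => b u w ^+ m) N w)%:E =
   (c m)%:E * \int[P]_w (disc (fun u w => expR (m%:R * (alpha * xi u w))) N w)%:E)%E.
Proof.
rewrite /disc; under eq_integral do rewrite -sumEFin.
under [in RHS]eq_integral do rewrite -sumEFin.
rewrite ge0_integral_sum//; last 2 first.
- move=> k; apply/measurable_EFinP; apply: measurable_funM.
    exact: measurable_indic.
  exact: measurable_funX.
- by move=> k w _; rewrite lee_fin mulr_ge0// exprn_ge0.
rewrite ge0_integral_sum//; last first.
  move=> k; apply/measurable_EFinP; apply: measurable_funM.
    exact: measurable_indic.
  apply: measurableT_comp => //; apply: measurable_funM => //.
  by apply: measurable_funM => //; exact: mxi.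
rewrite ge0_sume_distrr.
  by apply: eq_bigr => k _; apply: tail_moment_real => //; exact: mD.
by move=> k _; apply: integral_ge0 => w _; rewrite lee_fin mulr_ge0// expR_ge0.
Qed.

Let S : set T := [set w | x < J w].
Let E w : R := exp_neg_at xi w (lamperti_clock alpha xi x w).

Let mS : measurable S.
Proof.
rewrite (_ : S = J @^-1` `]x, +oo[%classic); last first.
  by apply/seteqP; split => w; rewrite /S/= in_itv/= andbT.
by rewrite -[X in measurable X]setTI; apply: measurable_lifetime.
Qed.

Let mE : measurable_fun setT E.
Proof.
have := @measurable_fun_pair2 _ _ _ _ _ _ _ x measurable_stopped.
by rewrite /= max_l.
Qed.

Let b_right w r : 0 <= r -> B 0 w \is a fin_num -> b u w @[u --> r^'+] --> b r w.
Proof.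
move=> r0 fin.
apply: (@squeeze_cvgr _ _ _ _ (fun u => b r w - (u - r)) (cst (b r w))).
- near=> u.
  have ru : r <= u by near: u; exact: nbhs_right_ge.
  have u0 := le_trans r0 ru.
  have [_ ->] := bE u0 fin; have [_ ->] := bE r0 fin.
  have h1 := clock_integral_mono alpha_lt0 xi0 xi_inc w r0 ru.
  have h2 := clock_integral_lipschitz alpha_lt0 xi0 xi_inc w r0 ru.
  have fu := A_fin w u0; have fr := A_fin w r0.
  move: h1 h2; rewrite -(fineK fu) -(fineK fr) -EFinD !lee_fin => h1 h2.
  by rewrite -addrA lerD2l lerD2l lerN2 h1 andbT; lra.
- rewrite -[X in _ --> X]subr0; apply: cvgB; first exact: cvg_cst.
  rewrite -(subrr r); apply: cvgB; last exact: cvg_cst.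
  exact: cvg_at_right_filter.
- exact: cvg_cst.
Unshelve. all: by end_near. Qed.

Lemma stopped_moment m :
  (\int[P]_(w in S) ((J w - x) ^+ m)%:E =
   (c m)%:E * \int[P]_(w in S) ((E w `^ (- alpha)) ^+ m)%:E)%E.
Proof.
pose f1 w := \1_S w * (J w - x) ^+ m.
pose f2 w := \1_S w * (E w `^ (- alpha)) ^+ m.
have ind (f : T -> R) : (\int[P]_(w in S) (f w)%:E = \int[P]_w (\1_S w * f w)%:E)%E.
  rewrite integral_mkcond; apply: eq_integral => w _.
  by rewrite patchE indicE; case: ifPn; rewrite ?mul1r ?mul0r.
rewrite !ind.
have mf1 : measurable_fun setT f1.
  apply: measurable_funM; first exact: measurable_indic.
  by apply: measurable_funX; apply: measurable_funB => //; exact: measurable_lifetime.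
have mf2 : measurable_fun setT f2.
  apply: measurable_funM; first exact: measurable_indic.
  apply: measurable_funX.
  by apply: (@measurableT_comp _ _ _ _ _ _ (fun y => y `^ (- alpha))) => //; exact: measurable_powR.
have c1 : {ae P, forall w, setT w ->
    (fun N => (disc (fun u w => b u w ^+ m) N w)%:E) @ \oo --> (f1 w)%:E}.
  have := tail_integral_finite; apply: filterS => w fin _.
  apply: cvg_EFin; first exact: nearW.
  have [xB|Bx] := ltP x%:E (B 0 w).
    have [r [r0 Ar H]] := clock_integral_hit alpha_lt0 xi0 xi_inc x_ge0 xB.
    have -> : f1 w = b r w ^+ m.
      have [_ ->] := bE r0 fin; rewrite Ar /f1 indicE mem_set ?mul1r//.
      by rewrite /S/= -lte_fin /lifetime fineK.
    apply: (disc_cvg r0 H); apply: (@cvg_comp _ _ _ (fun u => b u w) (fun y => y ^+ m)).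
      exact: b_right.
    exact: exprn_continuous.
  rewrite /f1 indicE memNset ?mul0r; last first.
    rewrite /S/= -lte_fin /lifetime fineK// => xB.
    by move: Bx; rewrite leNgt xB.
  by apply: cvg_near_cst; apply: nearW => N; exact: disc_miss.
have c2 : {ae P, forall w, setT w ->
    (fun N => (disc (fun u w => expR (m%:R * (alpha * xi u w))) N w)%:E) @ \oo --> (f2 w)%:E}.
  have := tail_integral_finite; apply: filterS => w fin _.
  apply: cvg_EFin; first exact: nearW.
  have [xB|Bx] := ltP x%:E (B 0 w).
    have [r [r0 Ar H]] := clock_integral_hit alpha_lt0 xi0 xi_inc x_ge0 xB.
    have -> : f2 w = expR (m%:R * (alpha * xi r w)).
      rewrite /f2 indicE mem_set ?mul1r//; last first.
        by rewrite /S/= -lte_fin /lifetime fineK.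
      rewrite /E (lamperti_clock_hit r0 H)/= -expRM -expRM_natl.
      by congr (expR (_ * _)); ring.
    apply: (disc_cvg (g := fun u w => expR (m%:R * (alpha * xi u w))) r0 H).
    apply: (@cvg_comp _ _ _ (fun u => m%:R * (alpha * xi u w)) expR).
      by apply: cvgMl_tmp; apply: cvgMl_tmp; exact: xi_right.
    exact: continuous_expR.
  rewrite /f2 indicE memNset ?mul0r; last first.
    rewrite /S/= -lte_fin /lifetime fineK// => xB.
    by move: Bx; rewrite leNgt xB.
  by apply: cvg_near_cst; apply: nearW => N; exact: disc_miss.
have iJ : P.-integrable setT (fun w => (J w ^+ m)%:E).
  apply/integrableP; split.
    by apply/measurable_EFinP; apply: measurable_funX; exact: measurable_lifetime.
  under eq_integral do rewrite /= ger0_norm ?exprn_ge0 ?lifetime_ge0//.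
  by rewrite lifetime_moment ltry.
have m1 N : measurable_fun setT (fun w => (disc (fun u w => b u w ^+ m) N w)%:E).
  by apply/measurable_EFinP; apply: mdisc => u _; exact: measurable_funX.
have m2 N : measurable_fun setT
    (fun w => (disc (fun u w => expR (m%:R * (alpha * xi u w))) N w)%:E).
  apply/measurable_EFinP; apply: mdisc => u u0; apply: measurableT_comp => //.
  by apply: measurable_funM => //; apply: measurable_funM => //; exact: mxi.
have mf1' : measurable_fun setT (fun w => (f1 w)%:E) by exact/measurable_EFinP.
have mf2' : measurable_fun setT (fun w => (f2 w)%:E) by exact/measurable_EFinP.
have b1 : {ae P, forall w N, setT w ->
    (`|(disc (fun u w => b u w ^+ m) N w)%:E| <= (J w ^+ m)%:E)%E}.
  apply: aeW => w N _.
  have /andP[h0 h1] : 0 <= disc (fun u w => b u w ^+ m) N w <= J w ^+ m.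
    apply: disc_bound; first by rewrite exprn_ge0// lifetime_ge0.
    by move=> u u0; rewrite exprn_ge0//= lerXn2r ?nnegrE ?lifetime_ge0// b_le.
  by rewrite lee_fin ger0_norm.
have b2 : {ae P, forall w N, setT w ->
    (`|(disc (fun u w => expR (m%:R * (alpha * xi u w))) N w)%:E| <= 1%:E)%E}.
  apply: aeW => w N _.
  have /andP[h0 h1] : 0 <= disc (fun u w => expR (m%:R * (alpha * xi u w))) N w <= 1.
    apply: disc_bound => // u u0; rewrite expR_ge0/= expR_le1.
    rewrite mulr_ge0_le0// nmulr_rle0// -(xi0 w); exact: xi_inc.
  by rewrite lee_fin ger0_norm.
have i1 : P.-integrable setT (fun w => (1 : R)%:E).
  exact: (finite_measure_integrable_cst P 1).
have [_ _ d1] := dominated_convergence measurableT m1 mf1' c1 iJ b1.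
have [_ _ d2] := dominated_convergence measurableT m2 mf2' c2 i1 b2.
have cf : (c m)%:E \is a fin_num by [].
have d3 := cvgeZl cf d2.
rewrite -(cvg_lim _ d1)// -(cvg_lim _ d3)//; congr (limn _).
by apply/funext => N; exact: disc_moment.
Qed.

End Discretization.

End StoppedMoments.

(** * Survival function *)

Section Survival.
Context (R : realType) d (T : measurableType d) (P : probability T R).
Context (Pi : {measure set R -> \bar R}) (alpha : R) (xi : R -> T -> R).
Local Notation phi := (laplace_exponent Pi).
Local Notation B := (tail_integral alpha xi).
Local Notation c := (clock_moment Pi alpha).
Local Notation J := (lifetime alpha xi).
Hypothesis alpha_lt0 : alpha < 0.
Hypothesis Pi_neq0 : Pi `]0%R, +oo[%classic <> 0%E.
Hypothesis xi_sub : driftless_subordinator P Pi xi.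

Let mxi := subordinator_measurable xi_sub.
Let xi0 := subordinator0 xi_sub.
Let xi_inc := subordinator_inc xi_sub.
Let xi_right := subordinator_right xi_sub.
Let J_ge0 w : 0 <= J w. Proof. exact: lifetime_ge0. Qed.
Let mJ : measurable_fun setT J.
Proof. exact: (measurable_lifetime alpha_lt0 xi_sub). Qed.

Definition survival (t : R) : \bar R := P [set w | t < J w].

Section Product.
Context d1 (T1 : measurableType d1) (P1 : probability T1 R).
Variables (D1 : set T1) (X1 : T1 -> R).
Hypotheses (mD1 : measurable D1) (mX1 : measurable_fun setT X1).
Hypothesis X1_gt0 : forall w, D1 w -> 0 < X1 w.

Let Y (z : T1 * T) : R := X1 z.1 `^ (- alpha) * J z.2.
Let D : set (T1 * T) := D1 `*` setT.

Lemma measurable_scaled_lifetime : measurable_fun setT Y.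
Proof.
apply: measurable_funM.
  apply: (@measurableT_comp _ _ _ _ _ _ (fun y => y `^ (- alpha))).
    exact: measurable_powR.
  by apply: measurableT_comp => //; exact: measurable_fst.
by apply: measurableT_comp => //; exact: measurable_snd.
Qed.

Lemma scaled_lifetime_ge0 z : 0 <= Y z.
Proof. by rewrite mulr_ge0// powR_ge0. Qed.

Lemma measurable_cylinder : measurable D.
Proof. exact: measurableX. Qed.

Lemma scaled_lifetime_tail t :
  ((P1 \x P) (D `&` [set z | (t < Y z)%R]) =
   \int[P1]_(w in D1) survival (X1 w `^ alpha * t))%E.
Proof.
rewrite /product_measure1 [RHS]integral_mkcond; apply: eq_integral => w _.
rewrite patchE /=; case: ifPn => Dw; last first.
  rewrite (_ : xsection _ _ = set0) ?measure0//; apply/seteqP; split => // w'.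
  rewrite /xsection/= inE => -[[/= D1w _] _].
  by move: Dw; rewrite notin_setE.
move: Dw; rewrite inE => Dw; congr (P _); apply/seteqP; split => w'.
  rewrite /xsection/= inE /Y => -[_ /=].
  by rewrite powRN mulrC ltr_pdivlMr ?powR_gt0 ?X1_gt0// mulrC.
rewrite /xsection/= inE /Y => tJ; split => //=.
by rewrite powRN mulrC ltr_pdivlMr ?powR_gt0 ?X1_gt0// mulrC.
Qed.

Lemma scaled_lifetime_moment m :
  (\int[P1 \x P]_(z in D) (Y z ^+ m)%:E =
   (c m)%:E * \int[P1]_(w in D1) ((X1 w `^ (- alpha)) ^+ m)%:E)%E.
Proof.
pose F (z : T1 * T) : \bar R :=
  ((\1_D1 z.1 * (X1 z.1 `^ (- alpha)) ^+ m)%:E * (J z.2 ^+ m)%:E)%E.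
have mX : measurable_fun setT (fun w => X1 w `^ (- alpha)).
  exact: (measurableT_comp (measurable_powR (- alpha)) mX1).
have mF1 : measurable_fun setT (fun w => \1_D1 w * (X1 w `^ (- alpha)) ^+ m).
  by apply: measurable_funM; [exact: measurable_indic|exact: measurable_funX].
have mJm : measurable_fun setT (fun w => (J w ^+ m)%:E).
  by apply/measurable_EFinP; exact: measurable_funX.
have mF : measurable_fun setT F.
  apply: emeasurable_funM.
    apply/measurable_EFinP.
    exact: (measurableT_comp mF1 measurable_fst).
  exact: (measurableT_comp mJm measurable_snd).
have F1_ge0 w : (0 <= (\1_D1 w * (X1 w `^ (- alpha)) ^+ m)%:E)%E.
  by rewrite lee_fin mulr_ge0// exprn_ge0// powR_ge0.
have F0 z : (0 <= F z)%E by rewrite mule_ge0// lee_fin exprn_ge0.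
transitivity (\int[P1 \x P]_z F z)%E.
  rewrite integral_mkcond; apply: eq_integral => z _.
  rewrite patchE /F indicE /Y exprMn -EFinM.
  case: ifPn => Dz.
    by rewrite mem_set ?mul1r//; move: Dz; rewrite inE => -[].
  rewrite memNset ?mul0r// => D1z; move: Dz; rewrite notin_setE; apply.
  by split.
have k0 : (0 <= (c m)%:E)%E.
  by rewrite lee_fin (clock_moment_ge0 alpha_lt0 Pi_neq0 xi_sub).
have mF1E : measurable_fun setT (fun w => (\1_D1 w * (X1 w `^ (- alpha)) ^+ m)%:E).
  exact/measurable_EFinP.
rewrite (fubini_tonelli1 F mF F0).
transitivity ((c m)%:E * \int[P1]_w (\1_D1 w * (X1 w `^ (- alpha)) ^+ m)%:E)%E.
  rewrite -(ge0_integralTZl P1 mF1E F1_ge0 k0).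
  apply: eq_integral => w _; rewrite /fubini_F /F/=.
  rewrite ge0_integralTZl//; first by rewrite (lifetime_moment alpha_lt0 Pi_neq0 xi_sub) muleC.
  by move=> w'; rewrite lee_fin exprn_ge0.
congr (_ * _)%E; rewrite [RHS]integral_mkcond; apply: eq_integral => w _.
by rewrite patchE indicE; case: ifPn => _; rewrite ?mul1r ?mul0r.
Qed.

End Product.

Local Notation E x w := (exp_neg_at xi w (lamperti_clock alpha xi x w)).

Lemma lt_lifetime x w : x < J w -> (x%:E < B 0 w)%E.
Proof.
move=> xJ; have [fin|inf] := boolP (B 0 w \is a fin_num).
  by rewrite -(fineK fin) lte_fin.
have := tail_integral_ge0 alpha xi 0 w; move: inf.
by case: (B 0 w) => // _ _; exact: ltry.
Qed.

Lemma measurable_stopped1 x : 0 <= x -> measurable_fun setT (fun w => E x w).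
Proof.
move=> x0.
have := @measurable_fun_pair2 _ _ _ _ _ _ _ x (measurable_stopped alpha_lt0 xi_sub).
by rewrite /= max_l.
Qed.

Lemma measurable_lt_lifetime x : measurable [set w | x < J w].
Proof.
rewrite (_ : [set w | _] = J @^-1` `]x, +oo[%classic); last first.
  by apply/seteqP; split => w /=; rewrite in_itv/= andbT.
by rewrite -[X in measurable X]setTI; apply: mJ.
Qed.

(* The strong Markov property at the time when the clock reaches [x]: as functions
   of [v], both sides are tails of laws whose moments are [c m] times those of
   the stopped process. *)
Lemma stopped_survival x v : 0 <= x -> 0 <= v ->
  (survival (x + v) =
   \int[P]_(w in [set w | (x < J w)%R]) survival (E x w `^ alpha * v))%E.
Proof.
move=> x0 v0; set S := [set w | x < J w].
have mS : measurable S by exact: measurable_lt_lifetime.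
have mE := measurable_stopped1 x0.
have E0 w : S w -> 0 < E x w.
  by move=> Sw; rewrite (exp_neg_clock_gt0 alpha_lt0 xi0 xi_inc)//; exact: lt_lifetime.
have p0 : 0 < phi `|alpha|.
  by have := phi_gt0 alpha_lt0 Pi_neq0 xi_sub 0; rewrite mul1r.
have mJx : measurable_fun setT (fun w => J w - x) by exact: measurable_funB.
have Jx0 w : S w -> 0 <= J w - x by move=> Sw; rewrite subr_ge0 ltW.
have C0 : 0 < (phi `|alpha|)^-1 by rewrite invr_gt0.
have := @eq_law_of_moments _ _ _ _ _ P (P \x P)%E S (S `*` setT)
  (fun w => J w - x) (fun z => E x z.1 `^ (- alpha) * J z.2) mS (measurable_cylinder mS)
  mJx (measurable_scaled_lifetime mE) Jx0
  (fun z _ => scaled_lifetime_ge0 (fun w => E x w) z) 1 _ C0.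
move=> /(_ _ _ `]v, +oo[%classic (measurable_itv _)) H.
rewrite -(scaled_lifetime_tail P E0).
rewrite [RHS](_ : _ = (P \x P)%E ((S `*` setT) `&`
  (fun z : T * T => E x z.1 `^ (- alpha) * J z.2) @^-1` `]v, +oo[%classic)); last first.
  by congr ((P \x P)%E (_ `&` _)); apply/seteqP; split => z /=; rewrite in_itv/= andbT.
rewrite -H.
- congr (P _); apply/seteqP; split => w /=; rewrite /S/= in_itv/= andbT.
    by move=> h; split; [rewrite (le_lt_trans _ h)// lerDl|rewrite ltrBrDl].
  by case=> _; rewrite ltrBrDl.
- move=> n; rewrite (stopped_moment alpha_lt0 Pi_neq0 xi_sub x0).
  by rewrite (scaled_lifetime_moment P mS mE).
- move=> n; apply: (@le_trans _ _ (\int[P]_w (J w ^+ n)%:E)%E); last first.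
    rewrite (lifetime_moment alpha_lt0 Pi_neq0 xi_sub) lee_fin.
    exact: (clock_moment_le alpha_lt0 Pi_neq0 xi_sub).
  rewrite integral_mkcond; apply: ge0_le_integral => //.
  + by move=> w _; apply: erestrict_ge0 => w' Sw; rewrite lee_fin exprn_ge0// Jx0.
  + apply/(measurable_restrictT _ mS); apply: measurable_funTS.
    by apply/measurable_EFinP; exact: measurable_funX.
  + by apply/measurable_EFinP; exact: measurable_funX.
  + move=> w _; rewrite patchE; case: ifPn => [|_]; last by rewrite lee_fin exprn_ge0.
    rewrite inE => Sw; rewrite lee_fin lerXn2r ?nnegrE ?Jx0//.
    by rewrite lerBlDr lerDl.
Qed.

Let D : set R := `]0, +oo[%classic.
Let mD : measurable D. Proof. exact: measurable_itv. Qed.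
Let D_gt0 (x : R) : D x -> 0 < x. Proof. by rewrite /D/= in_itv/= andbT. Qed.

Lemma exponential_survival (nu : probability R R) (theta : R) : 0 < theta ->
  (forall m, \int[nu]_(x in D) ((x `^ (- alpha)) ^+ m)%:E =
     (\prod_(1 <= k < m.+1) phi (k%:R * `|alpha|) / theta ^+ m)%:E)%E ->
  forall t, 0 <= t ->
  (\int[nu]_(x in D) survival (x `^ alpha * t) = (expR (- (theta * t)))%:E)%E.
Proof.
move=> th0 mom t t0.
pose ep : probability (measurableTypeR R) R :=
  exponential_distribution_exponential_prob__canonical__probability_measure_Probability th0.
have mid : measurable_fun setT (idfun : R -> R) by exact: measurable_id.
have mI : measurable (`[0, +oo[%classic : set (measurableTypeR R)) by exact: measurable_itv.
have I0 (x : R) : `[0, +oo[%classic x -> 0 <= x by rewrite /= in_itv/= andbT.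
have C0 : 0 < theta^-1 by rewrite invr_gt0.
have mom1 n : (\int[nu \x P]_(z in D `*` setT) ((z.1 `^ (- alpha) * J z.2) ^+ n)%:E =
    (n`!%:R / theta ^+ n)%:E)%E.
  rewrite (scaled_lifetime_moment nu mD mid) mom -EFinM; congr EFin.
  rewrite /clock_moment; field.
  by rewrite expf_neq0 ?gt_eqF// (prod_phi_gt0 alpha_lt0 Pi_neq0 xi_sub).
have := @eq_law_of_moments _ _ _ _ _ (nu \x P)%E ep (D `*` setT) `[0, +oo[%classic
  (fun z => z.1 `^ (- alpha) * J z.2) idfun (measurable_cylinder mD) mI
  (measurable_scaled_lifetime mid) mid
  (fun z _ => scaled_lifetime_ge0 (idfun : R -> R) z) I0 1 _ C0.
move=> /(_ _ _ `]t, +oo[%classic (measurable_itv _)) H.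
rewrite -(scaled_lifetime_tail nu D_gt0).
rewrite [LHS](_ : _ = (nu \x P)%E ((D `*` setT) `&`
  (fun z : R * T => z.1 `^ (- alpha) * J z.2) @^-1` `]t, +oo[%classic)); last first.
  by congr ((nu \x P)%E (_ `&` _)); apply/seteqP; split => z /=; rewrite in_itv/= andbT.
rewrite H.
- rewrite -(exponential_prob_tail th0 t0); congr (exponential_prob _ _).
  apply/seteqP; split => z /=; rewrite !in_itv/= !andbT; first by case.
  by move=> tz; split => //; rewrite (le_trans t0)// ltW.
- by move=> n; rewrite mom1 [RHS](exponential_moment n th0).
- move=> n; rewrite mom1 lee_fin mul1r exprVn mulrC //.
Qed.

Lemma determined_by_survival d1 (T1 : measurableType d1) (P1 : probability T1 R)
    (D1 : set T1) (X1 : T1 -> R) (nu : probability R R) (s : {nonneg R}) (K C : R) :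
  measurable D1 -> measurable_fun setT X1 -> (forall w, D1 w -> 0 < X1 w) -> 0 < C ->
  (P1 D1 = s%:num%:E * nu D)%E ->
  (forall t, (0 <= t)%R -> \int[P1]_(w in D1) survival (X1 w `^ alpha * t) =
    s%:num%:E * \int[nu]_(x in D) survival (x `^ alpha * t))%E ->
  (forall m, (\int[nu]_(x in D) ((x `^ (- alpha)) ^+ m)%:E <= (K * C ^+ m * m`!%:R)%:E)%E) ->
  forall A, measurable A -> (P1 (D1 `&` X1 @^-1` A) = s%:num%:E * nu (D `&` A))%E.
Proof.
move=> mD1 mX1 X1_gt0 C0 eqD eqS mb A mA.
have mid : measurable_fun setT (idfun : R -> R) by exact: measurable_id.
pose m2 : {measure set (R * T) -> \bar R} := mscale s (nu \x P)%E.
pose m3 : {measure set R -> \bar R} := mscale s nu.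
have cyl d' (T' : measurableType d') (Q : probability T' R) (D' : set T') :
    measurable D' -> ((Q \x P) (D' `*` setT) = Q D')%E.
  by move=> mD'; rewrite product_measure1E// [X in (_ * X)%E]probability_setT mule1.
have fin : ((P1 \x P) (D1 `*` setT) < +oo)%E.
  by rewrite cyl// (le_lt_trans (probability_le1 P1 mD1))// ltry.
have law := @eq_law_of_tails _ _ _ _ _ (P1 \x P)%E m2 (D1 `*` setT) (D `*` setT)
  (fun z => X1 z.1 `^ (- alpha) * J z.2) (fun z => z.1 `^ (- alpha) * J z.2)
  (measurable_cylinder mD1) (measurable_cylinder mD)
  (measurable_scaled_lifetime mX1) (measurable_scaled_lifetime mid)
  (fun z _ => scaled_lifetime_ge0 X1 z)
  (fun z _ => scaled_lifetime_ge0 (idfun : R -> R) z) fin.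
have eqc : ((P1 \x P) (D1 `*` setT) = m2 (D `*` setT))%E.
  rewrite cyl// eqD.
  change (s%:num%:E * nu D = s%:num%:E * (nu \x P) (D `*` setT))%E.
  by rewrite cyl.
have eqt x : 0 <= x ->
   ((P1 \x P) ((D1 `*` setT) `&` [set w | (x < X1 w.1 `^ (- alpha) * J w.2)%R]) =
    m2 ((D `*` setT) `&` [set w | (x < w.1 `^ (- alpha) * J w.2)%R]))%E.
  move=> x0; rewrite (scaled_lifetime_tail P1 X1_gt0) eqS//.
  by rewrite -(scaled_lifetime_tail nu D_gt0).
have {}law := law eqc eqt.
have mom n : (\int[P1]_(w in D1) ((X1 w `^ (- alpha)) ^+ n)%:E =
    \int[m3]_(x in D) ((x `^ (- alpha)) ^+ n)%:E)%E.
  have mpow : measurable_fun setT (fun x : R => ((x `^ (- alpha)) ^+ n)%:E).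
    by apply/measurable_EFinP; apply: measurable_funX; exact: measurable_powR.
  rewrite ge0_integral_mscale//; last 2 first.
  - exact: measurable_funTS.
  - by move=> x _; rewrite lee_fin exprn_ge0// powR_ge0.
  have mabs : measurable_fun setT (fun x : R => (`|x| ^+ n)%:E).
    by apply/measurable_EFinP; apply: measurable_funX; exact: normr_measurable.
  have abs0 (x : R) : (0 <= (`|x| ^+ n)%:E :> \bar R)%E by rewrite lee_fin exprn_ge0.
  have := law _ mabs abs0.
  rewrite ge0_integral_mscale//; last first.
  - apply: measurable_funTS.
    exact: (measurableT_comp mabs (measurable_scaled_lifetime mid)).
  - exact: measurable_cylinder.
  under eq_integral => z _ do rewrite (ger0_norm (scaled_lifetime_ge0 X1 z)).
  under [in RHS]eq_integral => z _ do
    rewrite (ger0_norm (scaled_lifetime_ge0 (idfun : R -> R) z)).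
  rewrite (scaled_lifetime_moment P1 mD1 mX1) (scaled_lifetime_moment nu mD mid).
  rewrite [RHS]muleCA => H.
  have cn0 : (0 < (c n)%:E)%E.
    by rewrite lte_fin divr_gt0 ?ltr0n ?fact_gt0// (prod_phi_gt0 alpha_lt0 Pi_neq0 xi_sub).
  have cfin : (c n)%:E \is a fin_num by [].
  by apply: le_anti; rewrite -[X in X && _](lee_pmul2l cfin cn0)
    -[X in _ && X](lee_pmul2l cfin cn0) H lexx.
have mY1 : measurable_fun setT (fun w => X1 w `^ (- alpha)).
  exact: (measurableT_comp (measurable_powR (- alpha)) mX1).
have mY2 : measurable_fun setT (fun x : R => x `^ (- alpha)).
  exact: measurable_powR.
have mA' : measurable ((fun y : R => y `^ (- alpha)^-1) @^-1` A).
  rewrite -[X in measurable X]setTI.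
  exact: (measurable_powR (- alpha)^-1 measurableT mA).
have powK (x : R) : 0 < x -> (x `^ (- alpha)) `^ (- alpha)^-1 = x.
  by move=> x0; rewrite -powRrM mulfV ?oppr_eq0 ?lt_eqF// powRr1// ltW.
have := @eq_law_of_moments _ _ _ _ _ P1 m3 D1 D _ _ mD1 mD mY1 mY2
  (fun w _ => powR_ge0 _ _) (fun x _ => powR_ge0 _ _) (s%:num * K) C C0 mom.
move=> /(_ _ _ mA') H.
have -> : D1 `&` X1 @^-1` A =
    D1 `&` (fun w => X1 w `^ (- alpha)) @^-1` ((fun y => y `^ (- alpha)^-1) @^-1` A).
  by apply/seteqP; split => w /= [Dw]; rewrite powK// X1_gt0.
have -> : D `&` A =
    D `&` (fun x => x `^ (- alpha)) @^-1` ((fun y => y `^ (- alpha)^-1) @^-1` A).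
  by apply/seteqP; split => x /= [Dx]; rewrite powK// D_gt0.
rewrite H// => n; rewrite mom ge0_integral_mscale//; last 2 first.
- by apply: measurable_funTS; apply/measurable_EFinP; exact: measurable_funX.
- by move=> x _; rewrite lee_fin exprn_ge0// powR_ge0.
by rewrite -!mulrA EFinM lee_wpmul2l ?lee_fin//; move: (mb n); rewrite -mulrA.
Qed.

End Survival.

Lemma multiplicative_exponential (R : realType) (s : R -> R) :
  (forall t, 0 <= t -> 0 < s t) ->
  (forall t u, 0 <= t -> 0 <= u -> s (t + u) = s t * s u) ->
  (forall t u, 0 <= t -> t <= u -> s u <= s t) -> s 1 < 1 ->
  exists2 theta, 0 < theta & forall t, 0 <= t -> s t = expR (- (theta * t)).
Proof.
move=> s0 sD s_dec s1.
pose g t := - ln (s t).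
have gD t u : 0 <= t -> 0 <= u -> g (t + u) = g t + g u.
  by move=> t0 u0; rewrite /g sD// lnM ?posrE ?s0// opprD.
have g_inc t u : 0 <= t -> t <= u -> g t <= g u.
  move=> t0 tu; rewrite lerN2 ler_ln ?posrE ?s0 ?s_dec//.
  exact: le_trans tu.
have gn n t : 0 <= t -> g (n%:R * t) = n%:R * g t.
  move=> t0; elim: n => [|n IH].
    rewrite !mul0r; have := gD 0 0 (lexx _) (lexx _); rewrite addr0 => h.
    by apply: (addIr (g 0)); rewrite add0r -h.
  by rewrite -natr1 !mulrDl !mul1r gD ?mulr_ge0// IH.
have th0 : 0 < g 1 by rewrite oppr_gt0 ln_lt0// s0/=.
exists (g 1) => // t t0.
suff -> : g 1 * t = g t by rewrite /g opprK lnK// posrE s0.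
have bound n : n%:R * `|g t - g 1 * t| <= g 1.
  pose k := Num.truncn (n%:R * t).
  have nt0 : 0 <= n%:R * t by rewrite mulr_ge0.
  have k1 : k%:R <= n%:R * t by rewrite truncn_le.
  have k2 : n%:R * t < k.+1%:R by exact: truncnS_gt.
  have h1 : k%:R * g 1 <= n%:R * g t.
    by rewrite -!gn// mulr1 g_inc.
  have h2 : n%:R * g t <= k.+1%:R * g 1.
    by rewrite -!gn// mulr1 g_inc// ltW.
  rewrite -[X in X * _]ger0_norm// -normrM mulrBr ler_norml.
  move: h2 k2; rewrite -natr1 => h2 k2.
  by apply/andP; split; nra.
apply/esym/eqP; rewrite -subr_eq0 -normr_le0 leNgt; apply/negP => e0.
have := bound (Num.truncn (g 1 / `|g t - g 1 * t|)).+1.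
rewrite leNgt => /negP; apply.
by rewrite -ltr_pdivrMr// truncnS_gt.
Qed.

Section FullSet.
Context (R : realType) d (T : measurableType d) (P : probability T R) (D : set T).
Hypotheses (mD : measurable D) (PD : P D = 1%E).

Lemma integral_full_set (f : T -> \bar R) : measurable_fun setT f ->
  (\int[P]_x f x = \int[P]_(x in D) f x)%E.
Proof.
move=> mf; rewrite [RHS]integral_mkcond; apply: ae_eq_integral => //.
  by apply/(measurable_restrictT _ mD); exact: measurable_funTS.
exists (~` D); split; first exact: measurableC.
  by have := probability_setC P mD; rewrite PD subee.
move=> x /= H Dx; apply: H => _; rewrite patchE mem_set//.
Qed.

End FullSet.

Section ScaledLaw.
Context (R : realType) d (T : measurableType d) (P : probability T R)
  (D1 : set T) (X : T -> R) (nu : probability R R) (s : {nonneg R}).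
Let D : set R := `]0, +oo[%classic.
Hypotheses (mD1 : measurable D1) (mX : measurable_fun setT X).
Hypothesis X_gt0 : forall w, D1 w -> 0 < X w.
Hypothesis law : forall A, measurable A ->
  (P (D1 `&` X @^-1` A) = s%:num%:E * nu (D `&` A))%E.

Let mD : measurable D. Proof. exact: measurable_itv. Qed.

Lemma ge0_integral_scaled_law (g : R -> \bar R) : measurable_fun setT g ->
  (forall x, 0 <= g x)%E ->
  (\int[P]_(w in D1) g (X w) = s%:num%:E * \int[nu]_(x in D) g x)%E.
Proof.
move=> mg g0.
have D_ge0 (x : R) : D x -> 0 <= x by rewrite /D/= in_itv/= andbT => /ltW.
have X_ge0 w : D1 w -> 0 <= X w by move=> /X_gt0/ltW.
have mid : measurable_fun setT (idfun : R -> R) by exact: measurable_id.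
have [m1 [m1E m1I]] := law_on P mD1 mX X_ge0.
have [m2 [m2E m2I]] := law_on nu mD mid D_ge0.
have := m2I _ mg g0 => /= <-; rewrite -m1I//.
transitivity (\int[mscale s m2]_(x in `[0%R, +oo[) g x)%E.
  apply: eq_measure_integral => A mA AD.
  have AE : A = `[0, +oo[%classic `&` A by rewrite setIidr.
  have e1 : m1 A = P (D1 `&` X @^-1` A) by rewrite [in LHS]AE m1E.
  have e2 : m2 A = nu (D `&` A) by rewrite [in LHS]AE m2E.
  by rewrite [LHS]e1 [LHS](law mA) -e2.
rewrite ge0_integral_mscale//; exact: measurable_funTS.
Qed.

Lemma Rintegral_scaled_law (f : R -> R) : measurable_fun setT f ->
  (exists M, forall x, `|f x| <= M) ->
  \int[P]_(w in D1) f (X w) = s%:num * \int[nu]_(x in D) f x.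
Proof.
move=> mf [M fM].
have mfE : measurable_fun setT (EFin \o f) by exact/measurable_EFinP.
have fin (g : R -> \bar R) : measurable_fun setT g -> (forall x, 0 <= g x <= M%:E)%E ->
    (\int[nu]_(x in D) g x)%E \is a fin_num.
  move=> mg gM; rewrite ge0_fin_numE; last first.
    by apply: integral_ge0 => x _; have /andP[] := gM x.
  apply: (@le_lt_trans _ _ (\int[nu]_(x in D) cst M%:E x)%E).
    apply: ge0_le_integral => //.
    - by move=> x _; have /andP[] := gM x.
    - exact: measurable_funTS.
    - by move=> x _; have /andP[] := gM x.
  rewrite integral_cst//= (@le_lt_trans _ _ `|M%:E|%E)//; last by rewrite ltry.
  rewrite (le_trans (lee_abs _))// abseM -[leRHS]mule1 lee_wpmul2l//.
  by rewrite gee0_abs ?probability_le1.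
have M0 : 0 <= M by rewrite (le_trans _ (fM 0)).
have finp : (\int[nu]_(x in D) (EFin \o f)^\+ x)%E \is a fin_num.
  apply: fin; first exact: measurable_funepos.
  move=> x; rewrite funepos_ge0/= funeposE/= ge_max !lee_fin M0 andbT.
  by rewrite (le_trans (ler_norm _)).
have finn : (\int[nu]_(x in D) (EFin \o f)^\- x)%E \is a fin_num.
  apply: fin; first exact: measurable_funeneg.
  move=> x; rewrite funeneg_ge0/= funenegE/= ge_max !lee_fin M0 andbT.
  by rewrite (le_trans (ler_norm _))// normrN.
rewrite /Rintegral -[X in X * _]/(fine s%:num%:E) -fineM//; last first.
  by rewrite integralE fin_numB finp finn.
congr fine; rewrite integralE [in RHS]integralE muleBr//; last first.
  by rewrite fin_num_adde_defl// fin_numN.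
rewrite -(ge0_integral_scaled_law (measurable_funepos mfE)); last exact: funepos_ge0.
rewrite -(ge0_integral_scaled_law (measurable_funeneg mfE)); last exact: funeneg_ge0.
by congr (_ - _)%E; apply: eq_integral => w _; rewrite ?funeposE ?funenegE.
Qed.

End ScaledLaw.

(** * Law of the process at a fixed time *)

Section ImageProbability.
Context d1 d2 (T1 : measurableType d1) (T2 : measurableType d2) (R : realType)
  (P : probability T1 R) (X : T1 -> T2).
Hypothesis mX : measurable_fun setT X.

Definition image_probability : probability T2 R :=
  distribution P (mfun_Sub (mem_set mX)).

Lemma ge0_integral_image_probability (D : set T2) (f : T2 -> \bar R) : measurable D ->
  measurable_fun setT f -> (forall y, 0 <= f y)%E ->
  (\int[image_probability]_(y in D) f y = \int[P]_(x in X @^-1` D) f (X x))%E.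
Proof.
by move=> mD mf f0; rewrite ge0_integral_pushforward//; exact: measurable_funTS.
Qed.

End ImageProbability.

Section PathSpace.
Context (R : realType) d (T : measurableType d) (P : probability T R).
Context (Pi : {measure set R -> \bar R}) (xi : R -> T -> R).
Hypothesis xi_sub : driftless_subordinator P Pi xi.

(* [initial_value] gives independence only from the events of [sigma_process],
   so the paths carry the sigma-algebra generated by [xi]. *)
Definition paths := past xi `[0, +oo[%classic.

Lemma measurable_paths : measurable_fun setT (id : T -> paths).
Proof.
move=> _ A mA; rewrite setTI.
exact: (past_measurable (subordinator_measurable xi_sub) _ mA).
Qed.

Definition path_law : probability paths R := image_probability P measurable_paths.

Lemma path_law_driftless : driftless_subordinator path_law Pi (xi : R -> paths -> R).
Proof.
have [PiL [xiL xi_inc] lap] := xi_sub; split => //; last first.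
  move=> l t l0 t0.
  rewrite ge0_integral_image_probability//; first exact: lap.
    have mxi : measurable_fun setT (xi t : paths -> R).
      by apply: measurable_past; rewrite /= in_itv/= andbT.
    apply/measurable_EFinP/measurableT_comp => //; apply: measurableT_comp => //.
    exact: measurable_funM.
split; last exact: xi_inc.
case: xiL => mxi xi0 xi_cadlag xi_stat xi_ind; split => //.
by move=> t t0; apply: measurable_past; rewrite /= in_itv/= andbT.
Qed.

End PathSpace.

Section LawAtTime.
Context (R : realType) d (T : measurableType d) (P : probability T R).
Context (Pi : {measure set R -> \bar R}) (alpha : R) (xi : R -> T -> R).
Hypothesis alpha_lt0 : alpha < 0.
Hypothesis Pi_neq0 : Pi `]0%R, +oo[%classic <> 0%E.
Hypothesis xi_sub : driftless_subordinator P Pi xi.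
Local Notation J := (lifetime alpha xi).
Local Notation E x w := (exp_neg_at xi w (lamperti_clock alpha xi x w)).
Local Notation paths := (paths xi).
Let Q := path_law xi_sub.
Let Q_sub : driftless_subordinator Q Pi (xi : R -> paths -> R).
Proof. exact: path_law_driftless. Qed.
Let D : set R := `]0, +oo[%classic.
Let mD : measurable D. Proof. exact: measurable_itv. Qed.
Let D_gt0 (x : R) : D x -> 0 < x. Proof. by rewrite /D/= in_itv/= andbT. Qed.

Lemma measurable_survival : measurable_fun setT (survival P alpha xi).
Proof.
pose A := [set z : R * T | z.1 < J z.2].
have mA : measurable A.
  have m : measurable_fun setT (fun z : R * T => (z.1, J z.2)).
    apply: measurable_fun_pair; first exact: measurable_fst.
    apply: measurableT_comp; last exact: measurable_snd.
    exact: (measurable_lifetime alpha_lt0 xi_sub).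
  by have := m measurableT _ (@measurable_ltr_set R); rewrite setTI.
have := measurable_fun_xsection P mA; apply: eq_measurable_fun => t _.
congr (P _); apply/seteqP; split => w /=.
  by move/xsectionP.
by move=> h; apply/xsectionP.
Qed.

Section InitialValue.
Context d' (T' : measurableType d') (P' : probability T' R) (p : T' -> T)
  (X0 : T' -> R) (nu : probability R R).
Hypothesis init : initial_value P xi nu P' p X0.
Hypothesis nuD : nu D = 1%E.

Lemma initial_value_pair (A : set R) (B : set paths) : measurable A ->
  measurable B -> P' (X0 @^-1` A `&` p @^-1` B) = (nu A * Q B)%E.
Proof.
case: init => -[mp Pp] _ ind Xnu mA mB.
rewrite ind; last 2 first.
- by exists A => //; rewrite setTI.
- suff : <<s \bigcup_(r in `[0, +oo[%classic) preimage_set_system setT (xi r) measurable >> `<=`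
    (image_set_system setT p (sigma_process `[0, +oo[ (fun r => xi r \o p))).
    by move=> /(_ _ mB); rewrite /image_set_system/= setTI.
  apply: smallest_sub; first by apply: sigma_algebra_image; exact: smallest_sigma_algebra.
  move=> F [r r0 [C mC <-]]; rewrite /image_set_system/= !setTI.
  by apply: sub_sigma_algebra; exists r => //; exists C => //; rewrite setTI.
rewrite Xnu// Pp//.
exact: (past_measurable (subordinator_measurable xi_sub) _ mB).
Qed.

Section AtTime.
Variable t : R.
Hypothesis t0 : 0 <= t.
Local Notation X := (pssmp alpha (fun r => xi r \o p) X0 t).

Let H (z : R * paths) : R := z.1 * E (z.1 `^ alpha * t) z.2.

Let XE w : X w = H (X0 w, p w). Proof. by []. Qed.

Let mH : measurable_fun setT H.
Proof.
apply: measurable_funM; first exact: measurable_fst.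
have m : measurable_fun setT (fun z : R * paths => (z.1 `^ alpha * t, z.2)).
  apply: measurable_fun_pair; last exact: measurable_snd.
  apply: measurable_funM => //.
  apply: (@measurableT_comp _ _ _ _ _ _ (fun y => y `^ alpha)); first exact: measurable_powR.
  exact: measurable_fst.
have := measurableT_comp (measurable_stopped alpha_lt0 Q_sub) m.
apply: eq_measurable_fun => z _ /=.
by rewrite max_l// mulr_ge0 ?powR_ge0.
Qed.

Let mp : measurable_fun setT (p : T' -> paths).
Proof.
case: init => -[mp _] _ _ _.
exact: (measurableT_comp (measurable_paths xi_sub) mp).
Qed.

Let mX0 : measurable_fun setT X0. Proof. by case: init => _ [mX0 _] _ _. Qed.

Lemma measurable_pssmp : measurable_fun setT X.
Proof.
exact: (measurableT_comp mH (measurable_fun_pair mX0 mp)).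
Qed.

Lemma measurable_alive : measurable [set w | 0 < X w].
Proof.
rewrite (_ : [set w | _] = X @^-1` D); last first.
  by apply/seteqP; split => w; rewrite /D/= in_itv/= andbT.
by rewrite -[X in measurable X]setTI; exact: measurable_pssmp.
Qed.

Lemma law_at_time (g : R -> \bar R) : measurable_fun setT g -> (forall y, 0 <= g y)%E ->
  (\int[P']_(w in [set w | (0 < X w)%R]) g (X w) =
   \int[nu]_(x in D) \int[Q]_(w in [set w | (x `^ alpha * t < J w)%R])
     g (x * E (x `^ alpha * t) w)%R)%E.
Proof.
move=> mg g0.
have mgD : measurable_fun setT (g \_ D).
  by apply/(measurable_restrictT _ mD); exact: measurable_funTS.
have gD0 y : (0 <= (g \_ D) y)%E by rewrite patchE; case: ifP.
have mF : measurable_fun setT ((g \_ D) \o H) by exact: measurableT_comp.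
have F0 z : (0 <= ((g \_ D) \o H) z)%E by exact: gD0.
transitivity (\int[P']_w ((g \_ D) \o H) (X0 w, p w))%E.
  rewrite [LHS]integral_mkcond; apply: eq_integral => w _.
  rewrite !patchE/= -XE; congr (if _ then _ else _).
  by apply/idP/idP; rewrite !inE/= /D/= in_itv/= andbT.
rewrite [LHS](@integral_independent_pair _ _ _ _ _ _ _ P' nu Q _ _ mX0 mp
  initial_value_pair _ mF F0).
rewrite [LHS](integral_full_set mD nuD); last first.
  exact: (@measurable_fun_fubini_tonelli_F _ _ _ _ _ Q _ mF F0).
apply: eq_integral => x; rewrite inE => /D_gt0 x0.
rewrite [RHS]integral_mkcond; apply: ae_eq_integral.
- exact: measurableT.
- exact: (@measurable_fun_pair2 _ _ _ _ _ _ _ x mF).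
- apply/(measurable_restrictT _ (measurable_lt_lifetime alpha_lt0 Q_sub _)).
  apply: measurable_funTS; apply: measurableT_comp mg _.
  exact: (@measurable_fun_pair2 _ _ _ _ _ _ _ x mH).
apply: filterS (tail_integral_finite alpha_lt0 Pi_neq0 Q_sub) => w fin _ /=.
rewrite !patchE/=; congr (if _ then _ else _).
apply/idP/idP; rewrite !inE/= /D/= in_itv/= andbT /H/= pmulr_rgt0//.
  rewrite (exp_neg_clock_gt0 alpha_lt0 (subordinator0 xi_sub) (subordinator_inc xi_sub))
    ?mulr_ge0 ?powR_ge0//.
  by rewrite -{1}(fineK fin) lte_fin.
rewrite (exp_neg_clock_gt0 alpha_lt0 (subordinator0 xi_sub) (subordinator_inc xi_sub))
    ?mulr_ge0 ?powR_ge0//.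
exact: lt_lifetime.
Qed.

Lemma survival_probability :
  P' [set w | 0 < X w] = (\int[nu]_(x in D) survival P alpha xi (x `^ alpha * t))%E.
Proof.
have := @law_at_time (cst 1%E) _ _; rewrite integral_cst ?mul1e; last exact: measurable_alive.
move=> -> //; apply: eq_integral => x _.
rewrite integral_cst ?mul1e//; exact: (measurable_lt_lifetime alpha_lt0 Q_sub).
Qed.

Lemma survival_after s : 0 <= s ->
  (\int[P']_(w in [set w | (0 < X w)%R]) survival P alpha xi (X w `^ alpha * s) =
   \int[nu]_(x in D) survival P alpha xi (x `^ alpha * (t + s)))%E.
Proof.
move=> s0.
rewrite [LHS](law_at_time (g := fun y => survival P alpha xi (y `^ alpha * s)))//; last first.
  have m : measurable_fun setT (fun y : R => y `^ alpha * s).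
    by apply: measurable_funM => //; exact: measurable_powR.
  exact: (measurableT_comp measurable_survival m).
apply: eq_integral => x; rewrite inE => /D_gt0 x0.
rewrite mulrDr [RHS](stopped_survival alpha_lt0 Pi_neq0 Q_sub) ?mulr_ge0 ?powR_ge0//.
apply: eq_integral => w _; congr (survival _ _ _ _).
by rewrite powRM ?(ltW x0) ?exp_neg_clock_ge0//; ring.
Qed.

End AtTime.
End InitialValue.
End LawAtTime.

Section FullSetLaw.
Context (R : realType) d (T : measurableType d) (P : probability T R) (D : set T).
Hypotheses (mD : measurable D) (PD : P D = 1%E).

Lemma full_setI A : measurable A -> P (D `&` A) = P A.
Proof.
move=> mA; rewrite [RHS](measureDI P mA mD) setIC.
rewrite [X in (X + _)%E](_ : _ = 0%E) ?add0e//.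
apply: (@subset_measure0 _ _ _ P _ (~` D)); [exact: measurableD|exact: measurableC| |].
  by move=> x [].
by have := probability_setC P mD; rewrite PD subee.
Qed.

Lemma ae_full_set : {ae P, forall x, D x}.
Proof.
exists (~` D); split; first exact: measurableC.
  by have := probability_setC P mD; rewrite PD subee.
by [].
Qed.

End FullSetLaw.

Section ScaledLimitLaw.
Context (R : realType) (Pi : {measure set R -> \bar R}) (alpha : R)
  (muR : probability R R) (l : R).
Local Notation phi := (laplace_exponent Pi).
Hypothesis alpha_lt0 : alpha < 0.
Hypothesis PiL : subordinator_levy_measure Pi.
Hypothesis muRP : has_muR_moments Pi alpha muR.
Hypothesis l_gt0 : 0 < l.
Let D : set R := `]0, +oo[%classic.
Let mD : measurable D. Proof. exact: measurable_itv. Qed.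
Let D_gt0 (x : R) : D x = (0 < x) :> Prop. Proof. by rewrite /D/= in_itv/= andbT. Qed.

Let h (x : R) : R := l * x `^ (`|alpha|^-1).

Lemma measurable_scaling : measurable_fun setT h.
Proof. by apply: measurable_funM => //; exact: measurable_powR. Qed.

Definition scaled_muR : probability R R := image_probability muR measurable_scaling.

Let muRD : muR D = 1%E. Proof. by case: muRP. Qed.

Let mhD : measurable (h @^-1` D).
Proof. by rewrite -[X in measurable X]setTI; apply: measurable_scaling. Qed.

Lemma scaled_muR_gt0 : scaled_muR D = 1%E.
Proof.
apply/eqP; rewrite eq_le probability_le1//= -muRD.
apply: le_measure; rewrite ?inE//.
by move=> x; rewrite /= !D_gt0 => x0; rewrite mulr_gt0// powR_gt0.
Qed.

Lemma scaled_muR_moment m : (\int[scaled_muR]_(x in D) ((x `^ (- alpha)) ^+ m)%:E =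
  (\prod_(1 <= k < m.+1) phi (k%:R * `|alpha|) / (l `^ alpha) ^+ m)%:E)%E.
Proof.
have mf : measurable_fun setT (fun x : R => ((x `^ (- alpha)) ^+ m)%:E).
  by apply/measurable_EFinP; apply: measurable_funX; exact: measurable_powR.
rewrite [LHS]ge0_integral_image_probability//; last first.
  by move=> y; rewrite lee_fin exprn_ge0// powR_ge0.
have mfh := measurableT_comp mf measurable_scaling.
rewrite -[LHS](integral_full_set mhD scaled_muR_gt0)//.
rewrite [LHS](integral_full_set mD muRD)//.
have am : `|alpha| = - alpha by rewrite ltr0_norm.
have a0 : 0 < - alpha by rewrite oppr_gt0.
transitivity (\int[muR]_(x in D) (((l `^ alpha)^-1 ^+ m)%:E * (x ^+ m)%:E))%E.
  apply: eq_integral => x; rewrite inE D_gt0 => x0.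
  rewrite -EFinM -exprMn; congr (EFin (_ ^+ _)).
  rewrite /h powRM ?powR_ge0 ?(ltW l_gt0)// powRN; congr (_ * _).
  by rewrite -powRrM am mulVf ?gt_eqF// powRr1// ltW.
rewrite [LHS]ge0_integralZl//; last 3 first.
- by apply: measurable_funTS; apply/measurable_EFinP; exact: exprn_measurable.
- by move=> x; rewrite D_gt0 => x0; rewrite lee_fin exprn_ge0// ltW.
- by rewrite lee_fin exprn_ge0// invr_ge0 powR_ge0.
rewrite exprVn mulrC EFinM; congr (_ * _)%E.
case: m {mf mfh} => [|m].
  by rewrite big_geq// -[RHS]muRD -[RHS]mul1e -integral_cst.
by case: muRP => _; apply.
Qed.

Lemma prod_phi_le m :
  \prod_(1 <= k < m.+1) phi (k%:R * `|alpha|) <= phi `|alpha| ^+ m * m`!%:R.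
Proof.
have phi0 (k : R) : 0 <= k -> 0 <= phi k.
  move=> k0; apply: Rintegral_ge0 => x; rewrite /= in_itv/= andbT => x0.
  by rewrite subr_ge0 -[leRHS]expR0 ler_expR oppr_le0 mulr_ge0// ltW.
elim: m => [|m IH]; first by rewrite big_geq// mul1r.
have -> : phi `|alpha| ^+ m.+1 * m.+1`!%:R =
    phi `|alpha| ^+ m * m`!%:R * (m.+1%:R * phi `|alpha|).
  by rewrite factS natrM exprSr; ring.
rewrite big_nat_recr//=; apply: ler_pM => //; last exact: laplace_exponent_subadditive.
- by apply: prodr_ge0 => k _; apply: phi0; rewrite mulr_ge0.
- by apply: phi0; rewrite mulr_ge0.
Qed.

Lemma scaled_muR_moment_le m :
  (\int[scaled_muR]_(x in D) ((x `^ (- alpha)) ^+ m)%:E <=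
   (1 * (phi `|alpha| / l `^ alpha) ^+ m * m`!%:R)%:E)%E.
Proof.
rewrite scaled_muR_moment lee_fin mul1r expr_div_n mulrAC.
by rewrite ler_wpM2r ?prod_phi_le// invr_ge0 exprn_ge0// powR_ge0.
Qed.

End ScaledLimitLaw.

(** * Quasi-stationary distributions *)

Section QuasiStationaryLaw.
Context (R : realType) d (T : measurableType d) (P : probability T R).
Context (Pi : {measure set R -> \bar R}) (alpha : R) (xi : R -> T -> R).
Hypothesis alpha_lt0 : alpha < 0.
Hypothesis Pi_neq0 : Pi `]0%R, +oo[%classic <> 0%E.
Hypothesis xi_sub : driftless_subordinator P Pi xi.
Local Notation phi := (laplace_exponent Pi).
Local Notation surv := (survival P alpha xi).
Let D : set R := `]0, +oo[%classic.
Let mD : measurable D. Proof. exact: measurable_itv. Qed.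
Let D_gt0 (x : R) : D x = (0 < x) :> Prop. Proof. by rewrite /D/= in_itv/= andbT. Qed.

Section Expectation.
Context d' (T' : measurableType d') (P' : probability T' R) (p : T' -> T)
  (X0 : T' -> R) (nu : probability R R).
Hypothesis init : initial_value P xi nu P' p X0.

Lemma initial_expectation (f : R -> R) : measurable_fun setT f ->
  (exists M, forall x, `|f x| <= M) ->
  \int[P']_w f (X0 w) = \int[nu]_(x in D) f x.
Proof.
move=> mf fM; case: init => _ [mX0 X0_gt0] _ X0nu.
have mD1 : measurable [set w | 0 < X0 w].
  rewrite (_ : [set w | _] = X0 @^-1` D); last first.
    by apply/seteqP; split => w; rewrite /= D_gt0.
  by rewrite -[X in measurable X]setTI; exact: mX0.
have law (A : set R) : measurable A -> P' ([set w | 0 < X0 w] `&` X0 @^-1` A) =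
    ((1%:nng : {nonneg R})%:num%:E * nu (D `&` A))%E.
  move=> mA; rewrite mul1e -X0nu; last exact: measurableI.
  by congr (P' _); apply/seteqP; split => w /=; rewrite D_gt0.
have := Rintegral_scaled_law mD1 mX0 (fun w h => h) law mf fM.
rewrite mul1r => <-; congr fine.
apply: (integral_full_set mD1 X0_gt0).
by apply/measurable_EFinP; exact: measurableT_comp.
Qed.

End Expectation.

Section ScaledLimitLaw.
Context (muR : probability R R) (l : R).
Hypotheses (muRP : has_muR_moments Pi alpha muR) (l_gt0 : 0 < l).
Local Notation nul := (scaled_muR alpha muR l).

Let PiL : subordinator_levy_measure Pi. Proof. by case: xi_sub. Qed.

Let nulD : nul D = 1%E. Proof. exact: (scaled_muR_gt0 muRP l_gt0). Qed.

Let theta_gt0 : 0 < l `^ alpha. Proof. exact: powR_gt0. Qed.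

Lemma scaled_muR_survival t : 0 <= t ->
  (\int[nul]_(x in D) surv (x `^ alpha * t))%E = (expR (- (l `^ alpha * t)))%:E.
Proof.
move=> t0; apply: (exponential_survival alpha_lt0 Pi_neq0 xi_sub theta_gt0) => // m.
exact: (scaled_muR_moment alpha_lt0 muRP l_gt0).
Qed.

Lemma determined_by_scaled_muR d1 (T1 : measurableType d1) (P1 : probability T1 R)
    (D1 : set T1) (X1 : T1 -> R) (s : {nonneg R}) :
  measurable D1 -> measurable_fun setT X1 -> (forall w, D1 w -> 0 < X1 w) ->
  P1 D1 = s%:num%:E ->
  (forall t, 0 <= t -> (\int[P1]_(w in D1) surv (X1 w `^ alpha * t))%E =
    (s%:num * expR (- (l `^ alpha * t)))%:E) ->
  forall A, measurable A -> (P1 (D1 `&` X1 @^-1` A) = s%:num%:E * nul (D `&` A))%E.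
Proof.
move=> mD1 mX1 X1_gt0 PD1 PS A mA.
have phi0 : 0 < phi `|alpha| by apply: laplace_exponent_gt0; rewrite // normr_gt0 lt_eqF.
apply: (determined_by_survival alpha_lt0 Pi_neq0 xi_sub mD1 mX1 X1_gt0
  (divr_gt0 phi0 theta_gt0) (K := 1)) => //.
- by rewrite PD1 nulD mule1.
- by move=> t t0; rewrite PS// scaled_muR_survival.
- by move=> m; exact: (scaled_muR_moment_le alpha_lt0 PiL muRP l_gt0).
Qed.

Section Lifetime.
Context d' (T' : measurableType d') (P' : probability T' R) (p : T' -> T)
  (X0 : T' -> R).
Hypothesis init : initial_value P xi nul P' p X0.
Variable t : R.
Hypothesis t0 : 0 <= t.
Local Notation X := (pssmp alpha (fun r => xi r \o p) X0 t).

Lemma scaled_muR_alive :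
  P' [set w | 0 < X w] = (expR (- (l `^ alpha * t)))%:E.
Proof.
rewrite (survival_probability alpha_lt0 Pi_neq0 xi_sub init nulD t0).
exact: scaled_muR_survival.
Qed.

Lemma scaled_muR_cond_expectation (f : R -> R) : measurable_fun setT f ->
  (exists M, forall x, `|f x| <= M) ->
  cond_expectation P' [set w | 0 < X w] (f \o X) = \int[P']_w f (X0 w).
Proof.
move=> mf fM; rewrite (initial_expectation init mf fM).
have mX := measurable_pssmp alpha_lt0 xi_sub init t0.
have mA := measurable_alive alpha_lt0 xi_sub init t0.
pose s : {nonneg R} := NngNum (expR_ge0 (- (l `^ alpha * t))).
have law := determined_by_scaled_muR mA mX (fun w h => h) (s := s) scaled_muR_alive.
rewrite /cond_expectation scaled_muR_alive.
rewrite (Rintegral_scaled_law mA mX (fun w h => h) (law _) mf fM).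
  by rewrite mulrAC divff ?mul1r// gt_eqF// expR_gt0.
move=> u u0.
rewrite (survival_after alpha_lt0 Pi_neq0 xi_sub init nulD t0 u0).
by rewrite scaled_muR_survival ?addr_ge0// mulrDr opprD expRD.
Qed.

End Lifetime.

Lemma scaled_muR_qsd : qsd P alpha xi nul.
Proof.
move=> d' T' P' p X0 init X t f t0 mf fM.
exact: scaled_muR_cond_expectation.
Qed.

End ScaledLimitLaw.

End QuasiStationaryLaw.

Section IndependentExtension.
Context (R : realType) d (T : measurableType d) (P : probability T R).
Context (xi : R -> T -> R) (nu : probability R R).
Hypothesis mxi : forall t, 0 <= t -> measurable_fun setT (xi t).
Hypothesis nuD : nu `]0%R, +oo[%classic = 1%E.

Lemma initial_value_product : initial_value P xi nu (nu \x P)%E snd fst.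
Proof.
have E1 (A : set R) : measurable A -> (nu \x P)%E (fst @^-1` A) = nu A.
  move=> mA; rewrite (_ : fst @^-1` A = A `*` setT); last by apply/seteqP; split=> z; [|case].
  apply: etrans (product_measure1E nu P mA measurableT) _.
  by apply: etrans (congr1 (mule (nu A)) (probability_setT P)) _; rewrite mule1.
have E2 (B : set T) : measurable B -> (nu \x P)%E (snd @^-1` B) = P B.
  move=> mB; rewrite (_ : snd @^-1` B = setT `*` B); last by apply/seteqP; split=> z; [|case].
  apply: etrans (product_measure1E nu P measurableT mB) _.
  by apply: etrans (congr1 (fun x => mule x (P B)) (probability_setT nu)) _; rewrite mul1e.
split; [split; [exact: measurable_snd|exact: E2]|split; [exact: measurable_fst|]| |exact: E1].
  rewrite -nuD -E1//; congr ((nu \x P)%E _).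
  by apply/seteqP; split => z; rewrite /= in_itv/= andbT.
move=> _ B [A mA <-].
have sub : sigma_process `[0, +oo[ (fun r => xi r \o snd) `<=`
    preimage_set_system setT (snd : R * T -> T) measurable.
  apply: smallest_sub; first exact/sigma_algebra_preimage/sigma_algebra_measurable.
  move=> F [r r0 [C mC <-]]; exists (xi r @^-1` C); last by rewrite !setTI.
  by rewrite -[X in measurable X]setTI; apply: mxi => //; move: r0; rewrite /= in_itv/= andbT.
move=> /sub [C mC <-]; rewrite !setTI.
apply: etrans (esym (congr2 mule (E1 _ mA) (E2 _ mC))).
apply: etrans (product_measure1E nu P mA mC).
by congr ((nu \x P)%E _); apply/seteqP; split.
Qed.

End IndependentExtension.

Section QuasiStationaryUnique.
Context (R : realType) d (T : measurableType d) (P : probability T R).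
Context (Pi : {measure set R -> \bar R}) (alpha : R) (xi : R -> T -> R).
Hypothesis alpha_lt0 : alpha < 0.
Hypothesis Pi_neq0 : Pi `]0%R, +oo[%classic <> 0%E.
Hypothesis xi_sub : driftless_subordinator P Pi xi.
Local Notation surv := (survival P alpha xi).
Local Notation J := (lifetime alpha xi).
Let D : set R := `]0, +oo[%classic.
Let mD : measurable D. Proof. exact: measurable_itv. Qed.
Let D_gt0 (x : R) : D x = (0 < x) :> Prop. Proof. by rewrite /D/= in_itv/= andbT. Qed.

Context (nu : probability R R).
Hypothesis nuD : nu D = 1%E.
Hypothesis nu_qsd : qsd P alpha xi nu.

Let P' : probability (R * T)%type R := (nu \x P)%E.
Let X t := pssmp alpha (fun r => xi r \o (snd : R * T -> T)) fst t.
Let init : initial_value P xi nu P' snd fst.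
Proof. exact: initial_value_product (subordinator_measurable xi_sub) nuD. Qed.

Definition qsd_survival (t : R) : R :=
  fine (\int[nu]_(x in D) surv (x `^ alpha * t))%E.
Local Notation S := qsd_survival.

Let aliveE t : 0 <= t -> P' [set w | 0 < X t w] = (S t)%:E.
Proof.
move=> t0; rewrite /S -(survival_probability alpha_lt0 Pi_neq0 xi_sub init nuD t0).
by rewrite fineK// fin_num_measure//; exact: (measurable_alive alpha_lt0 xi_sub init t0).
Qed.

Let mA t : 0 <= t -> measurable [set w | 0 < X t w].
Proof. exact: (measurable_alive alpha_lt0 xi_sub init). Qed.

Let survK v : (fine (surv v))%:E = surv v.
Proof. by rewrite fineK// fin_num_measure//; exact: (measurable_lt_lifetime alpha_lt0 xi_sub). Qed.

Let qsd_survival_gt0 t : 0 <= t -> 0 < S t.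
Proof.
move=> t0; rewrite lt_neqAle eq_sym; apply/andP; split; last first.
  by rewrite -lee_fin -aliveE.
apply/eqP => St.
have := nu_qsd init t0 (measurable_cst (1 : R)) (ex_intro _ 1 _).
rewrite /cond_expectation aliveE// St invr0 mulr0 => /(_ _)/esym H.
have : \int[P']_w (cst 1 \o fst) w = 1 :> R.
  apply: etrans (congr1 fine (integral_cst P' measurableT 1%:E)) _.
  by apply: etrans (congr1 (fun x => fine (mule 1%:E x)) (probability_setT P')) _; rewrite mule1.
move=> H1; have := oner_eq0 R; rewrite -H1 H ?eqxx// => x.
by rewrite normr1.
Qed.

Let qsd_survivalD t s : 0 <= t -> 0 <= s -> S (t + s) = S t * S s.
Proof.
move=> t0 s0; pose f (y : R) : R := fine (surv (y `^ alpha * s)).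
have mf : measurable_fun setT f.
  have m : measurable_fun setT (fun y : R => y `^ alpha * s).
    by apply: measurable_funM => //; exact: measurable_powR.
  apply/measurable_EFinP.
  have := measurableT_comp (measurable_survival alpha_lt0 xi_sub) m.
  by apply: eq_measurable_fun => y _ /=; rewrite /f survK.
have fM : exists M, forall x, `|f x| <= M.
  exists 1 => x; rewrite ger0_norm ?fine_ge0// -lee_fin survK.
  by apply: probability_le1; exact: (measurable_lt_lifetime alpha_lt0 xi_sub).
have := nu_qsd init t0 mf fM.
rewrite (initial_expectation init mf fM) /cond_expectation aliveE//=.
have -> : \int[nu]_(x in D) f x = S s.
  by congr fine; apply: eq_integral => x _; rewrite survK.
have -> : \int[P']_(w in [set w | 0 < X t w]) f (X t w) = S (t + s).
  rewrite /S -(survival_after alpha_lt0 Pi_neq0 xi_sub init nuD t0 s0).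
  by congr fine; apply: eq_integral => x _; rewrite survK.
by move=> <-; rewrite mulrC divfK// gt_eqF// qsd_survival_gt0.
Qed.

Let qsd_survival_mono t u : 0 <= t -> t <= u -> S u <= S t.
Proof.
move=> t0 tu; have u0 := le_trans t0 tu.
rewrite -lee_fin -(aliveE u0) -(aliveE t0).
rewrite (survival_probability alpha_lt0 Pi_neq0 xi_sub init nuD u0).
rewrite (survival_probability alpha_lt0 Pi_neq0 xi_sub init nuD t0).
have mm t' : measurable_fun D (fun x => surv (x `^ alpha * t')).
  have m : measurable_fun setT (fun y : R => y `^ alpha * t').
    by apply: measurable_funM => //; exact: measurable_powR.
  exact: measurable_funTS (measurableT_comp (measurable_survival alpha_lt0 xi_sub) m).
apply: ge0_le_integral => //.
move=> x _; apply: le_measure; rewrite ?inE; try exact: (measurable_lt_lifetime alpha_lt0 xi_sub).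
by move=> w /=; apply: le_lt_trans; rewrite ler_wpM2l// powR_ge0.
Qed.

Let qsd_survival_lt1 : S 1 < 1.
Proof.
rewrite ltNge; apply/negP => S1.
have Sle t : 0 <= t -> S t <= 1.
  by move=> t0; rewrite -lee_fin -(aliveE t0); apply: probability_le1; exact: mA.
have {}S1 : S 1 = 1 by apply/eqP; rewrite eq_le Sle.
have Sn n : S n.+1%:R = 1.
  elim: n => // n IH; rewrite -natr1 qsd_survivalD// IH S1 mulr1 //.
have alive : {ae P', forall w, forall n, 0 < X n.+1%:R w}.
  apply: ae_foralln => n; apply: ae_full_set; first exact: mA.
  by rewrite aliveE// Sn.
have pos : {ae P', forall w, 0 < w.1}.
  apply: ae_full_set; last by case: init => _ [].
  rewrite [X in measurable X](_ : _ = fst @^-1` D); last first.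
    by apply/seteqP; split => w; rewrite /= D_gt0.
  by rewrite -[X in measurable X]setTI; exact: measurable_fst.
have fin : {ae P', forall w, tail_integral alpha xi 0 w.2 \is a fin_num}.
  have [N [mN N0 BN]] := tail_integral_finite alpha_lt0 Pi_neq0 xi_sub.
  case: init => [[mp pP] _ _ _].
  exists (snd @^-1` N); split.
  - by rewrite -[X in measurable X]setTI; exact: measurable_snd.
  - by rewrite pP.
  - by move=> w /= /BN.
suff : {ae P', forall w, False}.
  move=> [N [mN N0 TN]]; have := @probability_setT _ _ _ P'.
  rewrite (_ : setT = N); last by apply/seteqP; split => // w _; exact: TN.
  by rewrite N0 => -[] /esym/eqP; rewrite oner_eq0.
apply: filterS3 alive pos fin => -[x w]/= alive x0 fin.
have xa : 0 < x `^ alpha by exact: powR_gt0.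
have := alive (Num.truncn (J w / x `^ alpha)).
rewrite /X/pssmp/= pmulr_rgt0//.
rewrite (exp_neg_clock_gt0 alpha_lt0 (subordinator0 xi_sub) (subordinator_inc xi_sub)); last first.
  by rewrite mulr_ge0// ltW.
rewrite -(fineK fin) lte_fin -ltr_pdivlMl// mulrC => h.
by have := lt_trans h (truncnS_gt _); rewrite ltxx.
Qed.

Lemma qsd_scaled_muR (muR : probability R R) : has_muR_moments Pi alpha muR ->
  exists2 l : R, 0 < l &
    forall B : set R, measurable B -> nu B = scaled_muR alpha muR l B.
Proof.
move=> muRP.
have [theta theta0 SE] := multiplicative_exponential qsd_survival_gt0 qsd_survivalD
  qsd_survival_mono qsd_survival_lt1.
exists (theta `^ alpha^-1); first exact: powR_gt0.
have l_gt0 : 0 < theta `^ alpha^-1 by exact: powR_gt0.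
have lE : (theta `^ alpha^-1) `^ alpha = theta.
  by rewrite -powRrM mulVf ?lt_eqF// powRr1// ltW.
move=> B mB; rewrite -(full_setI mD nuD mB).
rewrite -[RHS](full_setI mD (scaled_muR_gt0 muRP l_gt0) mB).
pose one : {nonneg R} := NngNum (@ler01 R).
have H := @determined_by_scaled_muR _ _ _ P _ _ _ alpha_lt0 Pi_neq0 xi_sub muR _ muRP l_gt0
  _ _ nu D idfun one mD (@measurable_id _ R setT).
rewrite -[RHS]mul1e; apply: (H _ nuD _ B mB) => [x|t t0]; first by rewrite D_gt0.
rewrite lE mul1r -SE// /S fineK//.
rewrite -(survival_probability alpha_lt0 Pi_neq0 xi_sub init nuD t0).
by rewrite fin_num_measure//; exact: mA.
Qed.

End QuasiStationaryUnique.

Theorem theorem3p2 (R : realType) (alpha : R) (alpha_lt0 : alpha < 0)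
    (d : measure_display) (Omega : measurableType d) (P : probability Omega R)
    (Pi : {measure set R -> \bar R}) (Pi_neq0 : Pi `]0%R, +oo[%classic <> 0%E)
    (xi : R -> Omega -> R) (xi_sub : driftless_subordinator P Pi xi)
    (muR : probability R R) (muRP : has_muR_moments Pi alpha muR) :
  (forall nu : probability R R, nu `]0%R, +oo[%classic = 1%E ->
    (qsd P alpha xi nu <->
     exists2 l : R, 0 < l &
       forall B : set R, measurable B -> nu B = muR_scaled muR alpha l B)) /\
  (forall l : R, 0 < l ->
    forall (d' : measure_display) (Omega' : measurableType d')
      (P' : probability Omega' R) (p : Omega' -> Omega) (X0 : Omega' -> R),
    initial_value P xi (muR_scaled muR alpha l) P' p X0 ->
    forall t : R, 0 <= t ->
      P' [set w | 0 < pssmp alpha (fun r => xi r \o p) X0 t w] =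
      (expR (- (l `^ alpha * t)))%:E).
Proof.
split => [nu nuD|l l0 d' Omega' P' p X0 init t t0]; last first.
  exact: (scaled_muR_alive alpha_lt0 Pi_neq0 xi_sub muRP l0 init t0).
split => [nu_qsd|[l l0 nuE]].
  exact: (qsd_scaled_muR alpha_lt0 Pi_neq0 xi_sub nuD nu_qsd muRP).
move=> d' Omega' P' p X0 [pP X0_gt0 ind X0nu].
apply: (scaled_muR_qsd alpha_lt0 Pi_neq0 xi_sub muRP l0).
by split => // B mB; rewrite X0nu// nuE.
Qed.
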